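(* With the data $\Gamma$, $X=X_+\sqcup X_-$, $(g_i,\chi_i)_{i\in X}$, $(\lambda_{ij})$, $R_\pm$, and the Hopf algebras $\mathcal{H}^\lambda$, $\mathcal{H}_-=R_-\# k\Gamma'$, $\mathcal{H}_+=R_+\# k\Gamma$, the $2$-cocycle $\sigma$ on $\mathcal{H}_-\otimes\mathcal{H}_+$ and the Hopf ideal $Q$ of $(\mathcal{H}_-\otimes\mathcal{H}_+)^\sigma$ described in the context, the assignments $x_i\mapsto1\otimes x_i$ ($i\in X_+$), $x_j\mapsto x_j\otimes1$ ($j\in X_-$) and $g\mapsto1\otimes g$ ($g\in\Gamma$) give an isomorphism $$\mathcal{H}^\lambda\xrightarrow{\simeq}(\mathcal{H}_-\otimes\mathcal{H}_+)^\sigma/Q$$ of Hopf algebras.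
   Context: Conventions. $k$ is an arbitrary field and $\otimes=\otimes_k$. $\Gamma$ is an abelian group, $\hat\Gamma$ the group of group homomorphisms $\Gamma\to k^\times$, $k\Gamma$ the group Hopf algebra. ${}^{k\Gamma}_{k\Gamma}\mathcal{YD}$ is the braided category of left Yetter-Drinfeld modules, i.e. $\Gamma$-graded $k\Gamma$-modules $V=\bigoplus_{g}V_g$ with each $V_g$ stable under $\Gamma$, with braiding $c(v\otimes w)=(g\rightharpoonup w)\otimes v$ for $v\in V_g$. A pre-Nichols algebra of an object $V$ is a graded braided bialgebra $R=\bigoplus_{n\ge0}R(n)$ in this category with $R(0)=k$, $R(1)=V$, generated by $R(1)$; the kernel of the canonical epimorphism $TV\to R$ from the tensor algebra (in which the elements of $V$ are primitive) is its defining ideal. The bosonization $R\# k\Gamma$ is the Hopf algebra on $R\otimes k\Gamma$ with product $(a\otimes g)(b\otimes h)=a(g\rightharpoonup b)\otimes gh$ and coproduct $\Delta(a\otimes g)=(a_1\otimes(a_2)_{-1}g)\otimes((a_2)_0\otimes g)$ for $g,h\in\Gamma$, where $\Delta_R(a)=a_1\otimes a_2$ and $a\mapsto a_{-1}\otimes a_0$ is the $k\Gamma$-coaction. Same conventions for any other abelian group. Data. $X=X_+\sqcup X_-$ with $X_\pm$ non-empty sets. For each $i\in X$ let $(g_i,\chi_i)\in\Gamma\times\hat\Gamma$, and let $kx_i$ be the one-dimensional object with $h\rightharpoonup x_i=\chi_i(h)x_i$ ($h\in\Gamma$) in degree $g_i$. Put $q_{ij}=\chi_j(g_i)$, $V_\pm=\bigoplus_{i\in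 X_\pm}kx_i$, $V=V_+\oplus V_-$. Assume $q_{ij}q_{ji}=1$ whenever $i\in X_+$, $j\in X_-$. Let $\lambda_{ij}\in k$ ($i\in X_+$, $j\in X_-$) be parameters with $\lambda_{ij}=0$ if $\chi_i\chi_j\neq1$. Let $R_\pm$ be pre-Nichols algebras of $V_\pm$ in ${}^{k\Gamma}_{k\Gamma}\mathcal{YD}$ with defining ideals $I_\pm$. $\mathcal{H}^\lambda$ is the quotient of $TV\# k\Gamma$ by the ideal generated by $I_+$, $I_-$ and the elements $x_i\otimes x_j-q_{ij}x_j\otimes x_i-\lambda_{ij}(g_ig_j-1)$ ($i\in X_+$, $j\in X_-$); it is a quotient Hopf algebra. $\Gamma'$ is the free abelian group on symbols $\{g_j'\mid j\in X_-\}$. One regards $V_-$ (resp. $R_-$) as an object (resp. its pre-Nichols algebra) in ${}^{k\Gamma'}_{k\Gamma'}\mathcal{YD}$ by $g_k'\rightharpoonup x_j=q_{kj}x_j$ with $x_j$ in degree $g_j'$ ($j,k\in X_-$). Put $\mathcal{H}_-=R_-\# k\Gamma'$, $\mathcal{H}_+=R_+\# k\Gamma$. A skew pairing of Hopf algebras $A,B$ is a linear map $\tau:A\otimes B\to k$ with $\tau(ab,x)=\tau(a,x_1)\tau(b,x_2)$, $\tau(a,xy)=\tau(a_1,y)\tau(a_2,x)$, $\tau(1,x)=\varepsilon(x)$, $\tau(a,1)=\varepsilon(a)$. There is a unique skew pairing $\tau:\mathcal{H}_-\otimes\mathcal{H}_+\to k$ with $\tau(g_j',g)=\chi_j(g)$,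 $\tau(g_j',x_i)=0=\tau(x_j,g)$, $\tau(x_j,x_i)=-\lambda_{ij}$ ($i\in X_+$, $j\in X_-$, $g\in\Gamma$). Let $\sigma$ be the corresponding $2$-cocycle on the tensor-product Hopf algebra $\mathcal{H}_-\otimes\mathcal{H}_+$: $\sigma(a\otimes x,b\otimes y)=\varepsilon(a)\tau(b,x)\varepsilon(y)$. The cocycle deformation $(\mathcal{H}_-\otimes\mathcal{H}_+)^\sigma$ is the Hopf algebra on the same coalgebra with the same unit and product $g\cdot h=\sigma(g_1,h_1)g_2h_2\sigma^{-1}(g_3,h_3)$, $\sigma^{-1}$ the convolution inverse. For each $j\in X_-$ the element $g_j'\otimes g_j^{-1}$ is a central grouplike of $(\mathcal{H}_-\otimes\mathcal{H}_+)^\sigma$; $Q$ is the Hopf ideal generated by the elements $g_j'\otimes g_j^{-1}-1$ ($j\in X_-$). In the claim, elements of $\mathcal{H}_-\otimes\mathcal{H}_+$ stand for their classes modulo $Q$.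
   Formalization: It is assumed that R_- really is a pre-Nichols algebra of V_- over Γ' (its defining ideal I_- is homogeneous when x_j has degree g_j'); this is not automatic for every pre-Nichols algebra over Γ, and without it R_-#kΓ' is undefined. *)

(* Defs.v *)
From HB Require Import structures.
From mathcomp Require Import all_boot all_algebra finmap.
From mathcomp Require Import monalg.
From mathcomp Require Import boolp classical_sets fsbigop.

Set Implicit Arguments.
Unset Strict Implicit.
Unset Printing Implicit Defensive.

Import GRing.Theory.
Local Open Scope ring_scope.
Local Open Scope classical_set_scope.
Local Open Scope quotient_scope.

(* Vector spaces over the field k are lmodType k; no dimension is bounded.    *)
(* {malg k[K]} is the vector space with basis (<< x >>)_(x : K).              *)
(* Abelian groups are zmodType, hence written additively: the product g h and *)
(* the inverse of g appear as g + h and - g, the unit as 0.                   *)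
(*                                                                            *)
(* Algebras and coalgebras are pairs (structure maps, axioms): bialg_sig and  *)
(* yd_sig below only collect structure maps, and is_alg, is_bialg, is_hopf,   *)
(* is_yd, ... are the axioms. Constructions (bosonization, tensor product,    *)
(* cocycle deformation, quotient) are thereby defined by the usual formulas   *)
(* before it is known that they yield Hopf algebras.                          *)

Section LinearAlgebra.
Variable k : fieldType.

Definition subspace (V : lmodType k) (U : set V) : Prop :=
  U 0 /\ forall a u v, U u -> U v -> U (a *: u + v).

Definition span (V : lmodType k) (S : set V) : set V :=
  [set v | forall U : set V, subspace U -> S `<=` U -> U v].

Lemma span_subspace (V : lmodType k) (S : set V) : subspace (span S).
Proof.
split=> [U [U0 _] _ //|a u v hu hv U hU SU].
by apply: (hU.2) => //; [exact: hu|exact: hv].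
Qed.

Lemma sub_span (V : lmodType k) (S : set V) : S `<=` span S.
Proof. by move=> v Sv U _; apply. Qed.

Section QuotientSpace.
Variables (V : lmodType k) (S : set V).

Lemma spanD u v : span S u -> span S v -> span S (u + v).
Proof.
by move=> hu hv; rewrite -[u]scale1r; apply: (span_subspace S).2.
Qed.

Lemma spanZ a u : span S u -> span S (a *: u).
Proof.
move=> hu; rewrite -[_ *: _]addr0.
by apply: (span_subspace S).2 => //; apply: (span_subspace S).1.
Qed.

Definition quot_equiv (u v : V) : bool := `[< span S (u - v) >].

Lemma quot_equiv_is_equiv : equiv_class_of quot_equiv.
Proof.
split=> [u|u v|v u w].
- by apply/asboolP; rewrite subrr; apply: (span_subspace S).1.
- by apply/asboolP/asboolP => /(spanZ (-1)); rewrite scaleN1r opprB.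
- move=> /asboolP huv /asboolP hvw; apply/asboolP.
  by have := spanD huv hvw; rewrite addrA subrK.
Qed.

Canonical quot_equiv_equiv := EquivRelPack quot_equiv_is_equiv.

Definition quotv_type := {eq_quot quot_equiv}.

HB.instance Definition _ : EqQuotient V quot_equiv quotv_type :=
  EqQuotient.on quotv_type.
HB.instance Definition _ := Choice.on quotv_type.

Lemma quotv_eqP (u v : V) :
  \pi_quotv_type u = \pi_quotv_type v <-> span S (u - v).
Proof.
split; first by move/eqP; rewrite piE => /asboolP.
by move=> h; apply/eqP; rewrite piE; apply/asboolP.
Qed.

Local Notation pq := (\pi_quotv_type) (only parsing).
Let q0 : quotv_type := pq 0.
Let qadd (x y : quotv_type) : quotv_type := pq (repr x + repr y).
Let qopp (x : quotv_type) : quotv_type := pq (- repr x).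
Let qscale (a : k) (x : quotv_type) : quotv_type := pq (a *: repr x).

Let reprP (u : V) : span S (repr (pq u) - u).
Proof. by apply/quotv_eqP; rewrite reprK. Qed.

Let qaddE u v : qadd (pq u) (pq v) = pq (u + v).
Proof.
apply/quotv_eqP; rewrite opprD addrACA.
by apply: spanD; apply: reprP.
Qed.

Let qoppE u : qopp (pq u) = pq (- u).
Proof.
apply/quotv_eqP; rewrite -opprD -[- (_ - _)]scaleN1r.
by apply: spanZ; apply: reprP.
Qed.

Let qscaleE a u : qscale a (pq u) = pq (a *: u).
Proof. by apply/quotv_eqP; rewrite -scalerBr; apply: spanZ; apply: reprP. Qed.

Let qaddA : associative qadd.
Proof.
elim/quotW=> u; elim/quotW=> v; elim/quotW=> w.
by rewrite (qaddE v w) (qaddE u v) (qaddE u) (qaddE _ w) addrA.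
Qed.
Let qaddC : commutative qadd.
Proof.
by elim/quotW=> u; elim/quotW=> v; rewrite (qaddE u v) (qaddE v u) addrC.
Qed.
Let qadd0 : left_id q0 qadd.
Proof. by elim/quotW=> u; rewrite (qaddE 0 u) add0r. Qed.
Let qaddN : left_inverse q0 qopp qadd.
Proof. by elim/quotW=> u; rewrite (qoppE u) (qaddE _ u) addNr. Qed.

HB.instance Definition _ :=
  GRing.isZmodule.Build quotv_type qaddA qaddC qadd0 qaddN.

Let qscaleA a b x : qscale a (qscale b x) = qscale (a * b) x.
Proof. by elim/quotW: x => u; rewrite (qscaleE b) !qscaleE scalerA. Qed.
Let qscale1 : left_id 1 qscale.
Proof. by elim/quotW=> u; rewrite (qscaleE 1 u) scale1r. Qed.
Let qscaleDr : right_distributive qscale +%R.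
Proof.
move=> a; elim/quotW=> u; elim/quotW=> v.
rewrite [pq u + pq v](qaddE u v) (qscaleE a (u + v)) scalerDr.
by rewrite (qscaleE a u) (qscaleE a v) [RHS](qaddE (a *: u)).
Qed.
Let qscaleDl x : {morph qscale^~ x : a b / a + b}.
Proof.
elim/quotW: x => u a b /=; rewrite (qscaleE (a + b) u) scalerDl.
by rewrite (qscaleE a u) (qscaleE b u) [RHS](qaddE (a *: u)).
Qed.

HB.instance Definition _ := GRing.Zmodule_isLmodule.Build k quotv_type
  qscaleA qscale1 qscaleDr qscaleDl.

(* V / span S *)
Definition quotv : lmodType k := quotv_type.
Definition cls (v : V) : quotv := \pi_quotv_type v.
Definition rep (x : quotv) : V := repr (x : quotv_type).

Lemma repK : cancel rep cls.
Proof. by move=> x; rewrite /cls reprK. Qed.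

Lemma cls_linear : linear cls.
Proof.
move=> a u v; rewrite /cls.
by rewrite -qaddE -qscaleE.
Qed.

Lemma cls_eqP (u v : V) : cls u = cls v <-> span S (u - v).
Proof. exact: quotv_eqP. Qed.

End QuotientSpace.

(* the linear extension of a map defined on the basis *)
Definition mlift (K : choiceType) (W : lmodType k) (f : K -> W)
  (u : {malg k[K]}) : W := \sum_(x <- msupp u) u@_x *: f x.

Lemma mlift_subset (K : choiceType) (W : lmodType k) (f : K -> W)
    (u : {malg k[K]}) (d : {fset K}) : (msupp u `<=` d)%fset ->
  mlift f u = \sum_(x <- d) u@_x *: f x.
Proof.
move=> le; rewrite /mlift.
rewrite [RHS](big_fsetID _ (mem (msupp u))) /= [X in _ + X]big1_fset ?addr0.
  apply: eq_fbigl => x; rewrite !inE.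
  by apply/idP/andP => [h|[]//]; split => //; apply: (fsubsetP le).
by move=> x; rewrite !inE => /andP[_ /mcoeff_outdom ->] _; rewrite scale0r.
Qed.

Lemma mlift_linear (K : choiceType) (W : lmodType k) (f : K -> W) :
  linear (mlift f).
Proof.
move=> a u v; pose d := (msupp (a *: u + v) `|` (msupp u `|` msupp v))%fset.
rewrite (@mlift_subset _ _ f (a *: u + v) d) ?fsubsetUl //.
rewrite (@mlift_subset _ _ f u d); last first.
  by apply: fsubset_trans (fsubsetUr _ _); apply: fsubsetUl.
rewrite (@mlift_subset _ _ f v d); last first.
  by apply: fsubset_trans (fsubsetUr _ _); apply: fsubsetUr.
rewrite scaler_sumr -big_split /=; apply: eq_bigr => x _.
by rewrite mcoeffD mcoeffZ scalerDl scalerA.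
Qed.

Lemma mliftU (K : choiceType) (W : lmodType k) (f : K -> W) (x : K) :
  mlift f << x >> = f x.
Proof.
by rewrite /mlift msuppU oner_eq0 big_seq_fset1 mcoeffUU scale1r.
Qed.

Definition bilin (V W U : lmodType k) (f : V -> W -> U) : Prop :=
  (forall v, linear (f v)) /\ (forall w, linear (f^~ w)).

Section Tensor.
Variables V W : lmodType k.

Let F := {malg k[(V * W)%type]}.

Definition tensor_rel : set F :=
  [set t | exists a v v' w,
     t = << (a *: v + v', w) >> - (a *: << (v, w) >> + << (v', w) >>)] `|`
  [set t | exists a v w w',
     t = << (v, a *: w + w') >> - (a *: << (v, w) >> + << (v, w') >>)].

Definition tensor : lmodType k := quotv tensor_rel.

Definition tens (v : V) (w : W) : tensor := cls tensor_rel << (v, w) >>.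

(* The linear map induced by a bilinear f; see tlift_tens and tlift_linear.   *)
Definition tlift (U : lmodType k) (f : V -> W -> U) (t : tensor) : U :=
  mlift (fun p : V * W => f p.1 p.2) (rep t).

Lemma tens_bilin : bilin tens.
Proof.
split=> [v a w w'|w a v v']; rewrite /tens /= -cls_linear;
  apply/(@cls_eqP _ tensor_rel); apply: sub_span.
- by right; exists a, v, w, w'.
- by left; exists a, v, v', w.
Qed.

Section Lift.
Variables (U : lmodType k) (f : V -> W -> U) (hf : bilin f).

Let g := mlift (fun p : V * W => f p.1 p.2).

Let gB u v : g (u - v) = g u - g v.
Proof.
have := mlift_linear (fun p : V * W => f p.1 p.2) (-1) v u.
by rewrite !scaleN1r -/g [- v + u]addrC [- g v + g u]addrC.
Qed.

Let span_ker u : span tensor_rel u -> g u = 0.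
Proof.
move=> /(_ [set u | g u = 0]); apply=> [|t]; first split.
- by rewrite /= -(subrr (0 : F)) gB subrr.
- by move=> a x y hx hy; rewrite /= /g mlift_linear -/g hx hy scaler0 addr0.
- case=> [[a [v [v' [w ->]]]]|[a [v [w [w' ->]]]]].
    by rewrite /= gB /g mlift_linear !mliftU /= (hf.2 w) subrr.
  by rewrite /= gB /g mlift_linear !mliftU /= (hf.1 v) subrr.
Qed.

Let tliftE u : tlift f (cls tensor_rel u) = g u.
Proof.
apply/eqP; rewrite -subr_eq0 /tlift -/g -gB; apply/eqP/span_ker.
by apply/(@cls_eqP _ tensor_rel); rewrite repK.
Qed.

Lemma tlift_tens v w : tlift f (tens v w) = f v w.
Proof. by rewrite /tens tliftE /g mliftU. Qed.

Lemma tlift_linear : linear (tlift f).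
Proof.
move=> a x y; rewrite -[x]repK -[y]repK -cls_linear !tliftE.
exact: mlift_linear.
Qed.
End Lift.

Lemma tens_span : span [set t | exists v w, t = tens v w] = [set: tensor].
Proof.
apply/seteqP; split=> // t _ U [U0 UD] hU; rewrite -[t]repK.
have cls0 : cls tensor_rel 0 = 0.
  by have := cls_linear tensor_rel (-1) 0 0; rewrite !scaleN1r !addNr.
suff sumU (s : seq (V * W)%type) :
    U (cls tensor_rel (\sum_(x <- s) << (rep t)@_x *g x >>)).
  by rewrite [rep t]monalgE.
elim: s => [|x s ih].
  by rewrite big_nil cls0.
rewrite big_cons (_ : << _ *g x >> = (rep t)@_x *: << x >>) ?cls_linear.
  by apply: UD => //; apply: hU; exists x.1, x.2; case: x.
by apply/malgP => y; rewrite mcoeffZ !mcoeffU mulr_natr.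
Qed.

End Tensor.
End LinearAlgebra.

Notation "v '\ox' w" := (tens v w) (at level 40, left associativity)
  : ring_scope.

Section Bialgebras.
Variable k : fieldType.

Definition tmap (V V' W W' : lmodType k) (f : V -> V') (g : W -> W') :
    tensor V W -> tensor V' W' :=
  tlift (fun v w => f v \ox g w).

Definition tassoc (U V W : lmodType k) :
    tensor (tensor U V) W -> tensor U (tensor V W) :=
  tlift (fun t w => tlift (fun u v => u \ox (v \ox w)) t).

Record bialg_sig := BialgSig {
  bsort :> lmodType k;
  bmul : bsort -> bsort -> bsort;
  bone : bsort;
  bcomul : bsort -> tensor bsort bsort;
  bcounit : bsort -> k^o }.

(* the sum of the f a_1 a_2 for Delta a = a_1 (x) a_2 *)
Definition sweedler (A : bialg_sig) (W : lmodType k) (f : A -> A -> W)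
  (a : A) : W := tlift f (bcomul a).

(* the sum of the f a_1 a_2 a_3 *)
Definition sweedler3 (A : bialg_sig) (W : lmodType k) (f : A -> A -> A -> W)
  (a : A) : W := sweedler (fun a1 => sweedler (f a1)) a.

Section Laws.
Variable A : bialg_sig.
Local Notation "a ** b" := (bmul a b) (at level 40, left associativity).

Definition is_alg : Prop :=
  [/\ bilin (@bmul A), associative (@bmul A),
      left_id (bone A) (@bmul A) & right_id (bone A) (@bmul A)].

Definition is_coalg : Prop :=
  [/\ linear (@bcomul A), linear (@bcounit A),
      forall a : A, tassoc (tmap (@bcomul A) id (bcomul a))
                    = tmap id (@bcomul A) (bcomul a),
      forall a : A, sweedler (fun x y => bcounit x *: y) a = a
    & forall a : A, sweedler (fun x y => bcounit y *: x) a = a].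

Definition is_counit_multiplicative : Prop :=
  bcounit (bone A) = 1 /\
  forall a b : A, bcounit (a ** b) = bcounit a * bcounit b.

End Laws.

(* the product (a (x) b)(a' (x) b') = a a' (x) b b' of A (x) B *)
Definition tprod (A B : bialg_sig) (s t : tensor A B) : tensor A B :=
  tlift (fun a b => tlift (fun a' b' => bmul a a' \ox bmul b b') t) s.

Definition is_bialg (A : bialg_sig) : Prop :=
  [/\ is_alg A, is_coalg A, is_counit_multiplicative A,
      bcomul (bone A) = bone A \ox bone A
    & forall a b : A, bcomul (bmul a b) = tprod (bcomul a) (bcomul b)].

Definition is_antipode (A : bialg_sig) (S : A -> A) : Prop :=
  [/\ linear S,
      forall a, sweedler (fun x y => bmul (S x) y) a = bcounit a *: bone A
    & forall a, sweedler (fun x y => bmul x (S y)) a = bcounit a *: bone A].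

Definition is_hopf (A : bialg_sig) : Prop :=
  is_bialg A /\ exists S : A -> A, is_antipode S.

Definition is_hopf_iso (A B : bialg_sig) (f : A -> B) : Prop :=
  [/\ is_hopf A, is_hopf B, linear f & bijective f] /\
  [/\ f (bone A) = bone B,
      forall a b, f (bmul a b) = bmul (f a) (f b),
      forall a, bcomul (f a) = tmap f f (bcomul a)
    & forall a, bcounit (f a) = bcounit a].

Definition is_ideal (A : bialg_sig) (J : set A) : Prop :=
  subspace J /\ forall a x, J x -> J (bmul a x) /\ J (bmul x a).

Definition ideal_gen (A : bialg_sig) (S : set A) : set A :=
  [set x | forall J : set A, is_ideal J -> S `<=` J -> J x].

Definition is_hopf_ideal (A : bialg_sig) (J : set A) : Prop :=
  [/\ is_ideal J,
      forall x, J x ->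
        span [set t | exists a b, (J a \/ J b) /\ t = a \ox b] (bcomul x),
      forall x, J x -> bcounit x = 0
    & forall S, is_antipode S -> forall x, J x -> J (S x)].

(* A / J. The operations are computed on representatives; they do not depend  *)
(* on the choice of the representatives when J is a Hopf ideal of A.          *)
Definition quot_bialg (A : bialg_sig) (J : set A) : bialg_sig := {|
  bsort := quotv J;
  bmul := fun x y => cls J (bmul (rep x) (rep y));
  bone := cls J (bone A);
  bcomul := fun x => tmap (cls J) (cls J) (bcomul (rep x));
  bcounit := fun x => bcounit (rep x) |}.

Definition tensor_bialg (A B : bialg_sig) : bialg_sig := {|
  bsort := tensor A B;
  bmul := @tprod A B;
  bone := bone A \ox bone B;
  bcomul := tlift (fun a b =>
    sweedler (fun a1 a2 =>
      sweedler (fun b1 b2 => (a1 \ox b1) \ox (a2 \ox b2)) b) a);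
  bcounit := tlift (fun a b => bcounit a * bcounit b : k^o) |}.

(* the value of the pairing at (a, x) is tau (a \ox x) *)
Definition is_skew_pairing (A B : bialg_sig) (tau : tensor A B -> k^o) : Prop :=
  [/\ linear tau,
      forall a b x, tau (bmul a b \ox x)
        = sweedler (fun x1 x2 => tau (a \ox x1) * tau (b \ox x2) : k^o) x,
      forall a x y, tau (a \ox bmul x y)
        = sweedler (fun a1 a2 => tau (a1 \ox y) * tau (a2 \ox x) : k^o) a,
      forall x, tau (bone A \ox x) = bcounit x
    & forall a, tau (a \ox bone B) = bcounit a].

Definition pairing_cocycle (A B : bialg_sig) (tau : tensor A B -> k^o) :
    tensor (tensor_bialg A B) (tensor_bialg A B) -> k^o :=
  tlift (fun s t => tlift (fun a x => tlift (fun b y =>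
    bcounit a * tau (b \ox x) * bcounit y : k^o) t) s).

Section Deformation.
Variable H : bialg_sig.
Implicit Types s t : tensor H H -> k^o.

(* convolution of linear forms on the tensor product coalgebra H (x) H *)
Definition conv s t : tensor H H -> k^o :=
  tlift (fun g h => sweedler (fun g1 g2 =>
    sweedler (fun h1 h2 => s (g1 \ox h1) * t (g2 \ox h2) : k^o) h) g).

Definition conv_one : tensor H H -> k^o :=
  tlift (fun g h => bcounit g * bcounit h : k^o).

(* the convolution inverse of s, or the zero map if there is none *)
Definition conv_inv s : tensor H H -> k^o :=
  xget (fun _ => 0)
    [set t | [/\ linear t, conv s t =1 conv_one & conv t s =1 conv_one]].

Definition deformation s : bialg_sig := {|
  bsort := H;
  bmul := fun g h =>
    sweedler3 (fun g1 g2 g3 => sweedler3 (fun h1 h2 h3 =>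
      (s (g1 \ox h1) * conv_inv s (g3 \ox h3)) *: bmul g2 h2) h) g;
  bone := bone H;
  bcomul := @bcomul H;
  bcounit := @bcounit H |}.

End Deformation.

End Bialgebras.

Section Gradings.
Variables (k : fieldType) (I : choiceType) (V : lmodType k).
Variable c : I -> V -> V.

(* A grading of V is given by its homogeneous components: c i v is the        *)
(* component of v in degree i, and V_i = [set v | homog c i v].               *)
Definition homog (i : I) : set V := [set v | c i v = v].

Definition is_grading : Prop :=
  [/\ forall i, linear (c i),
      forall i v, c i (c i v) = c i v,
      forall i j v, i <> j -> c i (c j v) = 0
    & forall v, exists s : seq I, uniq s /\ v = \sum_(i <- s) c i v].

End Gradings.

Section YetterDrinfeld.
Variables (k : fieldType) (G : zmodType).

(* a G-action and the homogeneous components of a G-grading *)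
Record yd_sig (V : lmodType k) := YDSig {
  yact : G -> V -> V;
  ycomp : G -> V -> V }.

Definition is_yd (V : lmodType k) (Y : yd_sig V) : Prop :=
  [/\ forall g, linear (yact Y g),
      forall v, yact Y 0 v = v,
      forall g h v, yact Y (g + h) v = yact Y g (yact Y h v),
      is_grading (ycomp Y)
    & forall g h v, homog (ycomp Y) g v -> homog (ycomp Y) g (yact Y h v)].

Definition yd_morphism (V W : lmodType k) (YV : yd_sig V) (YW : yd_sig W)
    (f : V -> W) : Prop :=
  [/\ linear f,
      forall g v, f (yact YV g v) = yact YW g (f v)
    & forall g v, homog (ycomp YV) g v -> homog (ycomp YW) g (f v)].

Definition yd_tensor (V W : lmodType k) (YV : yd_sig V) (YW : yd_sig W) :
    yd_sig (tensor V W) := {|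
  yact := fun g => tmap (yact YV g) (yact YW g);
  ycomp := fun g => tlift (fun v w =>
    \sum_(h \in [set: G]) ycomp YV h v \ox ycomp YW (g - h) w) |}.

Definition yd_unit : yd_sig k^o := {|
  yact := fun _ a => a;
  ycomp := fun g a => if g == 0 then a else 0 |}.

Definition braiding (V W : lmodType k) (YV : yd_sig V) (YW : yd_sig W) :
    tensor V W -> tensor W V :=
  tlift (fun v w => \sum_(g \in [set: G]) yact YW g w \ox ycomp YV g v).

(* the product (mu (x) mu)(id (x) braiding (x) id) of R (x) R *)
Definition braided_tprod (R : lmodType k) (Y : yd_sig R) (mu : R -> R -> R)
    (s t : tensor R R) : tensor R R :=
  tlift (fun a b => tlift (fun a' b' =>
    tlift (fun a'' b'' => mu a a'' \ox mu b'' b') (braiding Y Y (b \ox a')))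
    t) s.

Definition is_braided_bialg (R : bialg_sig k) (Y : yd_sig R) : Prop :=
  [/\ is_yd Y, is_alg R, is_coalg R & is_counit_multiplicative R] /\
  [/\ yd_morphism (yd_tensor Y Y) Y (tlift (@bmul _ R)),
      yd_morphism yd_unit Y (fun a : k^o => (a : k) *: bone R),
      yd_morphism Y (yd_tensor Y Y) (@bcomul _ R)
    & yd_morphism Y yd_unit (@bcounit _ R)] /\
  [/\ bcomul (bone R) = bone R \ox bone R
    & forall a b : R, bcomul (bmul a b)
        = braided_tprod Y (@bmul _ R) (bcomul a) (bcomul b)].

(* R(n) = [set a | homog nu n a]. The components nu n are required to be      *)
(* morphisms, i.e. the R(n) are subobjects of R.                              *)
Definition is_graded_bialg (R : bialg_sig k) (Y : yd_sig R) (nu : nat -> R -> R)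
    : Prop :=
  [/\ is_grading nu & forall n, yd_morphism Y Y (nu n)] /\
  [/\ homog nu 0%N (bone R),
      forall m n a b, homog nu m a -> homog nu n b ->
        homog nu (m + n)%N (bmul a b),
      forall n a, homog nu n a ->
        homog (fun m => tlift (fun b b' =>
          \sum_(i < m.+1) nu i b \ox nu (m - i)%N b')) n (bcomul a)
    & forall n a, n <> 0%N -> homog nu n a -> bcounit a = 0].

(* R, with the identification iota of V with R(1), is a pre-Nichols algebra   *)
(* of V.                                                                      *)
Definition is_pre_nichols (V : lmodType k) (YV : yd_sig V) (R : bialg_sig k)
    (Y : yd_sig R) (nu : nat -> R -> R) (iota : V -> R) : Prop :=
  [/\ is_braided_bialg Y, is_graded_bialg Y nu
    & forall a, homog nu 0%N a -> exists c : k, a = c *: bone R] /\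
  [/\ yd_morphism YV Y iota, injective iota,
      forall a, homog nu 1%N a <-> exists v, a = iota v
    & forall U : set R, subspace U -> U (bone R) ->
        (forall a b, U a -> U b -> U (bmul a b)) ->
        (forall v, U (iota v)) -> forall a, U a].

Definition bosonization (R : bialg_sig k) (Y : yd_sig R) : bialg_sig k := {|
  bsort := tensor R {malg k[G]};
  bmul := fun s t =>
    tlift (fun a u => tlift (fun b v =>
      mlift (fun g => mlift (fun h =>
        bmul a (yact Y g b) \ox << g + h >>) v) u) t) s;
  bone := bone R \ox << 0 >>;
  bcomul := tlift (fun a => mlift (fun g =>
    sweedler (fun a1 a2 => \sum_(h \in [set: G])
      (a1 \ox << h + g >>) \ox (ycomp Y h a2 \ox << g >>)) a));
  bcounit := tlift (fun a => mlift (fun _ => bcounit a)) |}.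

Definition smash (R : bialg_sig k) (Y : yd_sig R) (a : R) (g : G) :
  bosonization Y := a \ox << g >>.

Definition is_char (chi : G -> k) : Prop :=
  chi 0 = 1 /\ forall g h, chi (g + h) = chi g * chi h.

(* the direct sum of the one-dimensional objects k x of degree gr x and       *)
(* character chi x                                                            *)
Definition yd_diag (X : choiceType) (gr : X -> G) (chi : X -> G -> k) :
    yd_sig {malg k[X]} := {|
  yact := fun h => mlift (fun x => chi x h *: << x >>);
  ycomp := fun h => mlift (fun x => if gr x == h then << x >> else 0) |}.

Section TensorAlgebra.
Variables (X : choiceType) (gr : X -> G) (chi : X -> G -> k).

(* The tensor algebra of {malg k[X]} is the free algebra on X.                *)
Definition yd_tensor_alg : yd_sig {malg k[{fmonom X}]} :=
  yd_diag (fun w : {fmonom X} => \sum_(x <- (w : seq X)) gr x)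
          (fun (w : {fmonom X}) g => \prod_(x <- (w : seq X)) chi x g).

Definition tgen (x : X) : {malg k[{fmonom X}]} := << fmu x >>.

(* The coproduct is the multiplicative map TV -> TV (x) TV, for the braided   *)
(* product, under which the elements of X are primitive.                      *)
Definition tensor_alg : bialg_sig k := {|
  bsort := {malg k[{fmonom X}]};
  bmul := *%R;
  bone := 1;
  bcomul := mlift (fun w : {fmonom X} =>
    foldr (fun x t => braided_tprod yd_tensor_alg *%R
                        (tgen x \ox 1 + 1 \ox tgen x) t)
          (1 \ox 1) (w : seq X));
  bcounit := fun f : {malg k[{fmonom X}]} => f@_mone |}.

End TensorAlgebra.
End YetterDrinfeld.

(* the algebra map from the free algebra on X that sends x to y x *)
Definition tensor_eval (k : fieldType) (X : choiceType) (R : bialg_sig k)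
    (y : X -> R) : {malg k[{fmonom X}]} -> R :=
  mlift (fun w : {fmonom X} => foldr (fun x r => bmul (y x) r) (bone R) w).

Definition defining_ideal (k : fieldType) (X : choiceType) (R : bialg_sig k)
    (iota : {malg k[X]} -> R) : set {malg k[{fmonom X}]} :=
  [set f | tensor_eval (fun x => iota << x >>) f = 0].

(* {malg int[X]} is the free abelian group on X; free_char a is the character *)
(* with value a x at the generator x.                                         *)
Definition free_char (k : fieldType) (X : choiceType) (a : X -> k)
    (z : {malg int[X]}) : k := \prod_(x <- msupp z) a x ^ z@_x.

Section Datum.
Variables (k : fieldType) (G : zmodType) (Xp Xm : choiceType).
Variables (gr : Xp + Xm -> G) (chi : Xp + Xm -> G -> k) (lam : Xp -> Xm -> k).

Definition qq (i j : Xp + Xm) : k := chi j (gr i).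

(* V_+ and V_- in the Yetter-Drinfeld modules over G *)
Definition ydVp : yd_sig G {malg k[Xp]} :=
  yd_diag (fun i => gr (inl i)) (fun i => chi (inl i)).
Definition ydVm : yd_sig G {malg k[Xm]} :=
  yd_diag (fun j => gr (inr j)) (fun j => chi (inr j)).

(* V_- in the Yetter-Drinfeld modules over the free abelian group on Xm *)
Definition ydVm' : yd_sig {malg int[Xm]} {malg k[Xm]} :=
  yd_diag (fun j => << j >>)
          (fun j => free_char (fun l => qq (inr l) (inr j))).

Definition TV_bosonization : bialg_sig k :=
  bosonization (R := tensor_alg gr chi) (yd_tensor_alg gr chi).

Local Notation TV := {malg k[{fmonom (Xp + Xm)%type}]}.
Definition TVsmash (f : TV) (g : G) : TV_bosonization :=
  smash (R := tensor_alg gr chi) (yd_tensor_alg gr chi) f g.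

Local Notation "f # g" := (TVsmash f g) (at level 39).

Definition TVp_to_TV : {malg k[{fmonom Xp}]} -> TV :=
  tensor_eval (R := tensor_alg gr chi) (fun i => tgen k (inl i)).
Definition TVm_to_TV : {malg k[{fmonom Xm}]} -> TV :=
  tensor_eval (R := tensor_alg gr chi) (fun j => tgen k (inr j)).

Section Hlambda.
Variables Ip : set {malg k[{fmonom Xp}]}.
Variables Im : set {malg k[{fmonom Xm}]}.

Definition Hlambda_ideal : set TV_bosonization :=
  ideal_gen
    ([set TVp_to_TV f # 0 | f in Ip] `|` [set TVm_to_TV f # 0 | f in Im] `|`
     [set z | exists (i : Xp) (j : Xm),
        let xi := tgen k (inl i) in let xj := tgen k (inr j) in
        z = (xi * xj - qq (inl i) (inr j) *: (xj * xi)) # 0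
            - lam i j *: (1 # (gr (inl i) + gr (inr j)) - 1 # 0)]).

Definition Hlambda : bialg_sig k := quot_bialg Hlambda_ideal.

End Hlambda.

Section Double.
Variables (Rp Rm : bialg_sig k) (Yp : yd_sig G Rp).
Variable Ym' : yd_sig {malg int[Xm]} Rm.

Definition Hplus : bialg_sig k := bosonization Yp.
Definition Hminus : bialg_sig k := bosonization Ym'.

Definition Hdouble (tau : tensor Hminus Hplus -> k^o) : bialg_sig k :=
  deformation (pairing_cocycle tau).

Definition Q_ideal (tau : tensor Hminus Hplus -> k^o) : set (Hdouble tau) :=
  ideal_gen (A := Hdouble tau) [set z | exists j : Xm,
    z = smash Ym' (bone Rm) << j >> \ox smash Yp (bone Rp) (- gr (inr j))
        - bone (Hdouble tau)].

End Double.
End Datum.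

Arguments TVsmash {k G Xp Xm} gr chi f g.
Arguments Hlambda_ideal {k G Xp Xm} gr chi lam Ip Im.
Arguments Q_ideal {k G Xp Xm} gr {Rp Rm Yp Ym'} tau.

(* Main.v *)
Require Import Defs.
From mathcomp Require Import all_boot all_algebra finmap.
From mathcomp Require Import monalg.
From mathcomp Require Import boolp classical_sets fsbigop.

Import GRing.Theory.
Local Open Scope ring_scope.
Set Implicit Arguments.
Unset Strict Implicit.
Unset Printing Implicit Defensive.

(** Write [T] for TV # kΓ, [D] for the deformed tensor product of H_- and H_+, [J] for the ideal of
    T defining H^λ and [Q] for the ideal of D generated by the z_j - 1, where z_j = g_j' ⊗ g_j^{-1}.

    Relations. H_- ⊗ 1 and 1 ⊗ H_+ are subalgebras of D, and elements of the two are exchanged by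
    one cross relation ([double_comm]). Evaluated on generators ([bos_double]) it says that group
    elements act diagonally and that x_i x_j = q_ij x_j x_i - λ_ij (1 - g_j' g_i). Modulo Q, where
    g_j' = g_j, this is the linking relation of H^λ. The prescribed values therefore extend to an
    algebra map F0 : T -> D with F0(J) in Q ([J_to_Q]), and the induced map F : T -> D/Q is onto,
    because every element of Γ' becomes an element of Γ.

    Injectivity is the heart of the matter ([retraction]). As a vector space D is R_- ⊗ kΓ' ⊗ R_+ ⊗
    kΓ, so a linear map Psi : D -> T/J is defined freely by b ⊗ a ⊗ c ⊗ g |-> M(b) φ(a) K(c) g. Here
    M and K come from the inclusions of I_- and I_+ in J, and φ : Γ' -> Γ sends g_j' to g_j. Psi
    absorbs a left factor z_j and z_j is central, so Psi kills Q. The linking relation puts every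
    element of T/J into the form of a sum of products M(b) K(c) g, and on these Psi undoes F0. Hence
    the kernel of F is exactly J.

    Hopf structure. D is a Hopf algebra, and so is D/Q since z_j is a central grouplike. F respects
    coproduct and counit because it does so on generators ([fb_coalg_hom]), and it intertwines
    antipodes ([fb_antipode]). So J, the kernel of a surjective map F, is a Hopf ideal, and T/J
    inherits its Hopf axioms from D/Q through the bijection ([quotient_iso]).

    That D is a Hopf algebra rests on three facts. The convolution inverse of τ is τ(S ⊗ id), where
    S exists because a connected graded braided bialgebra has an antipode ([braided_antipode],
    [smash_antipode]). Associativity follows from composing left multiplications ([double_mulA]).
    The deformed product is the ordinary one conjugated by τ in a convolution algebra ([conjug]),
    which gives compatibility with the coproduct ([double_sw_mul]). *)

Local Notation span := Defs.span.
Local Notation rep := Defs.rep.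

(** * Linear and multilinear maps *)

(* [k^o] as a constant: the many structures of [k^o] make unification pick
   convertible but syntactically distinct instances of the module [k^o]. *)
Definition klm (k : fieldType) : lmodType k := k^o.

Section Linear.
Context {k : fieldType}.
Implicit Types U V W X Y : lmodType k.

Lemma lin0 V W (f : V -> W) : linear f -> f 0 = 0.
Proof. by move=> hf; have := hf (-1) 0 0; rewrite !scaleN1r !addNr. Qed.

Lemma linD V W (f : V -> W) u v : linear f -> f (u + v) = f u + f v.
Proof. by move=> hf; have := hf 1 u v; rewrite !scale1r. Qed.

Lemma linZ V W (f : V -> W) a u : linear f -> f (a *: u) = a *: f u.
Proof. by move=> hf; have := hf a u 0; rewrite (lin0 hf) !addr0. Qed.

Lemma linN V W (f : V -> W) u : linear f -> f (- u) = - f u.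
Proof. by move=> hf; rewrite -scaleN1r linZ // scaleN1r. Qed.

Lemma linB V W (f : V -> W) u v : linear f -> f (u - v) = f u - f v.
Proof. by move=> hf; rewrite linD // linN. Qed.

Lemma lin_big V W (f : V -> W) I (r : seq I) (P : pred I) F : linear f ->
  f (\sum_(i <- r | P i) F i) = \sum_(i <- r | P i) f (F i).
Proof.
move=> hf; elim: r => [|i r ih]; first by rewrite !big_nil lin0.
by rewrite !big_cons; case: ifP => // _; rewrite linD // ih.
Qed.

Lemma lin_id V : linear (fun v : V => v).
Proof. by []. Qed.

Lemma lin_comp U V W (f : V -> W) (g : U -> V) :
  linear f -> linear g -> linear (fun u => f (g u)).
Proof. by move=> hf hg a u v; rewrite hg hf. Qed.

Lemma lin_zero V W : linear (fun _ : V => 0 : W).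
Proof. by move=> a u v; rewrite scaler0 addr0. Qed.

Lemma lin_add V W (f g : V -> W) :
  linear f -> linear g -> linear (fun u => f u + g u).
Proof. by move=> hf hg a u v; rewrite hf hg scalerDr addrACA. Qed.

Lemma lin_opp V W (f : V -> W) : linear f -> linear (fun u => - f u).
Proof. by move=> hf a u v; rewrite hf scalerN opprD. Qed.

Lemma lin_scaler V W c (f : V -> W) : linear f -> linear (fun u => c *: f u).
Proof. by move=> hf a u v; rewrite hf scalerDr !scalerA mulrC. Qed.

Lemma lin_scalel V W (c : V -> klm k) (w : W) :
  linear c -> linear (fun u => (c u : k) *: w).
Proof. by move=> hc a u v; rewrite hc [LHS]scalerDl -scalerA. Qed.

Lemma lin_mull V (c : V -> klm k) (d : k) :
  linear c -> linear (fun u => (c u : k) * d : klm k).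
Proof. by move=> hc a u v; rewrite hc mulrDl /GRing.scale /= mulrA. Qed.

Lemma lin_mulr V (c : V -> klm k) (d : k) :
  linear c -> linear (fun u => d * (c u : k) : klm k).
Proof. by move=> hc a u v; rewrite hc mulrDr /GRing.scale /= mulrCA. Qed.

Lemma lin_sum V W I (r : seq I) (P : pred I) (F : V -> I -> W) :
  (forall i, linear (fun u => F u i)) ->
  linear (fun u => \sum_(i <- r | P i) F u i).
Proof.
move=> hF a u v; rewrite scaler_sumr -big_split /=.
by apply: eq_bigr => i _; rewrite hF.
Qed.

Lemma lin_bil U V W (B : V -> W -> U) v : bilin B -> linear (B v).
Proof. by case=> hB _; apply: hB. Qed.

Lemma lin_bilc X U V W (B : V -> W -> U) (g : X -> V) w :
  bilin B -> linear g -> linear (fun x => B (g x) w).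
Proof. by case=> _ hB hg a x y; rewrite hg; apply: hB. Qed.

(** The value of [tlift] at [t] is a finite sum over a representative of [t], so linearity in a
    parameter passes through the sum term by term. [tlift_exch] and [tliftD] rest on the same
    fact. *)
Lemma lin_tliftb X U V W (F : X -> V -> W -> U) t :
  (forall v w, linear (fun x => F x v w)) -> linear (fun x => tlift (F x) t).
Proof. by move=> hF; apply: lin_sum => p; apply/lin_scaler/hF. Qed.

Lemma lin_tlifta X U V W (F : V -> W -> U) (t : X -> tensor V W) :
  bilin F -> linear t -> linear (fun x => tlift F (t x)).
Proof. by move=> hF; apply/lin_comp/tlift_linear. Qed.

Lemma lin_mliftb X V (K : choiceType) (F : X -> K -> V) (u : {malg k[K]}) :
  (forall i, linear (fun x => F x i)) -> linear (fun x => mlift (F x) u).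
Proof. by move=> hF; apply: lin_sum => i; apply/lin_scaler/hF. Qed.

Lemma lin_mlifta X V (K : choiceType) (F : K -> V) (u : X -> {malg k[K]}) :
  linear u -> linear (fun x => mlift F (u x)).
Proof. exact/lin_comp/mlift_linear. Qed.

Lemma eq_tlift U V W (f g : V -> W -> U) t :
  (forall v w, f v w = g v w) -> tlift f t = tlift g t.
Proof. by move=> fg; congr tlift; apply/funext => v; apply/funext. Qed.

Lemma tlift_comp U V W X (L : U -> X) (f : V -> W -> U) t :
  linear L -> L (tlift f t) = tlift (fun v w => L (f v w)) t.
Proof.
by move=> hL; rewrite [LHS]lin_big //; apply: eq_bigr => p _; rewrite linZ.
Qed.

Lemma tliftD U V W (f g : V -> W -> U) t :
  tlift (fun v w => f v w + g v w) t = tlift f t + tlift g t.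
Proof.
by rewrite /tlift /mlift -big_split; apply: eq_bigr => p _; rewrite scalerDr.
Qed.

Lemma tlift_exch U V W (V' W' : lmodType k)
    (F : V -> W -> V' -> W' -> U) t t' :
  tlift (fun v w => tlift (F v w) t') t
  = tlift (fun v' w' => tlift (fun v w => F v w v' w') t) t'.
Proof.
rewrite /tlift /mlift; under eq_bigr do rewrite scaler_sumr.
rewrite exchange_big /=; apply: eq_bigr => p _; rewrite scaler_sumr.
by apply: eq_bigr => q _; rewrite !scalerA mulrC.
Qed.

Lemma eq_lin_tens U V W (f g : tensor V W -> U) : linear f -> linear g ->
  (forall v w, f (v \ox w) = g (v \ox w)) -> f =1 g.
Proof.
move=> hf hg fg t.
have : span [set t | exists v w, t = v \ox w]%classic t by rewrite tens_span.
apply: (_ : span _ t -> f t = g t) => /(_ [set t | f t = g t]%classic); apply.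
  by split=> [|a u v /= hu hv]; rewrite /= ?(lin0 hf) ?(lin0 hg) // hf hg hu hv.
by move=> _ [v [w ->]]; apply: fg.
Qed.

Lemma malgZU (K : choiceType) (a : k) (x : K) : << a *g x >> = a *: << x >>.
Proof. by apply/malgP => y; rewrite mcoeffZ !mcoeffU mulr_natr. Qed.

Lemma eq_lin_malg V (K : choiceType) (f g : {malg k[K]} -> V) :
  linear f -> linear g -> (forall x, f << x >> = g << x >>) -> f =1 g.
Proof.
move=> hf hg fg u; rewrite [u]monalgE !lin_big //; apply: eq_bigr => x _.
by rewrite malgZU !linZ // fg.
Qed.

Lemma mliftE W (K : choiceType) (f : K -> W) (u : {malg k[K]}) :
  mlift f u = \sum_(x <- msupp u) u@_x *: f x.
Proof. by []. Qed.

Lemma bilin_tens V W : bilin (@tens k V W).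
Proof. exact: tens_bilin. Qed.

Lemma span_min V (S U : set V) :
  subspace U -> (S `<=` U)%classic -> (span S `<=` U)%classic.
Proof. by move=> hU SU v; apply. Qed.

Lemma span_id V (U : set V) v : subspace U -> span U v -> U v.
Proof. by move=> hU; apply; last by []. Qed.

Lemma subspaceD V (U : set V) u v : subspace U -> U u -> U v -> U (u + v).
Proof. by move=> [_ hU] hu hv; have := hU 1 u v hu hv; rewrite scale1r. Qed.

Lemma subspaceZ V (U : set V) a u : subspace U -> U u -> U (a *: u).
Proof. by move=> [U0 hU] hu; have := hU a u 0 hu U0; rewrite addr0. Qed.

Lemma subspaceB V (U : set V) u v : subspace U -> U u -> U v -> U (u - v).
Proof.
by move=> hU hu hv; apply: subspaceD => //; rewrite -scaleN1r; apply: subspaceZ.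
Qed.

Lemma subspace_eq V W (f g : V -> W) : linear f -> linear g ->
  subspace [set v | f v = g v]%classic.
Proof.
by move=> hf hg; split=> [|a u v /= hu hv]; rewrite /= ?(lin0 hf) ?(lin0 hg) // hf hg hu hv.
Qed.

Lemma cls0P V (S : set V) v : cls S v = 0 <-> span S v.
Proof.
rewrite -(lin0 (cls_linear S)); split; first by move/cls_eqP; rewrite subr0.
by move=> hv; apply/cls_eqP; rewrite subr0.
Qed.

(** A set-theoretic section of [f] is chosen; the inclusion of kernels makes [g] independent of that
    choice, which also yields linearity. *)
Lemma lin_factor V W U (f : V -> W) (g : V -> U) : linear f -> linear g ->
  (forall w, exists v, f v = w) -> (forall v, f v = 0 -> g v = 0) ->
  exists2 h : W -> U, linear h & forall v, h (f v) = g v.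
Proof.
move=> hf hg /choice [s sK] ker.
have hE v : g (s (f v)) = g v.
  by apply/eqP; rewrite -subr_eq0 -linB //; apply/eqP/ker; rewrite linB // sK subrr.
exists (g \o s) => // a u v /=.
by rewrite -[u in LHS]sK -[v in LHS]sK -hf hE hg.
Qed.

End Linear.

(** * Graded vector spaces and sums over homogeneous components *)

Section GradedSum.
Context {k : fieldType} {I : choiceType} {V : lmodType k} {c : I -> V -> V}.

(** The Sweedler sum of the coaction given by a grading: with v |-> v_{-1} ⊗ v_0 the sum of the i ⊗
    v_i, this is [F v_{-1} v_0]. The braiding and the coproduct of a bosonization are of this form.
    When each [F i] is linear the support is finite, so the sum never takes the default value of an
    infinite sum. *)
Definition gsum (W : lmodType k) (F : I -> V -> W) (v : V) : W :=
  \sum_(i \in [set: I]) F i (c i v).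

Hypothesis hc : is_grading c.

Lemma grading_lin i : linear (c i). Proof. by case: hc. Qed.

Lemma grading_homog i v : homog c i (c i v).
Proof. by case: hc => _ h _ _; apply: h. Qed.

Lemma homog_comp i j v : homog c j v -> c i v = if i == j then v else 0.
Proof.
move=> hv; case: eqP => [->//|ne]; rewrite -hv.
by case: hc => _ _ h _; apply: h.
Qed.

Lemma homog_subspace i : subspace (homog c i).
Proof. by have := subspace_eq (grading_lin i) (@lin_id _ V). Qed.

Lemma grading_support v : exists A : {fset I},
  (forall i, i \notin A -> c i v = 0) /\ v = \sum_(i <- A) c i v.
Proof.
case: (hc) => hl _ ho /(_ v) [s [us vE]].
exists [fset i in s]%fset; split=> [i|].
  rewrite !inE => ni; rewrite vE (lin_big _ _ _ (hl i)) big1_seq //= => j js.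
  by apply: ho => ij; move: ni; rewrite ij js.
rewrite [LHS]vE; apply: perm_big; rewrite uniq_perm ?fset_uniq // => i.
by rewrite !inE.
Qed.

Lemma gsum_support (W : lmodType k) (F : I -> V -> W) v (A : {fset I}) :
  (forall i, linear (F i)) -> (forall i, i \notin A -> c i v = 0) ->
  gsum F v = \sum_(i <- A) F i (c i v).
Proof. by move=> hF h; apply: fsbigTE => i /h ->; apply: lin0. Qed.

Lemma gsum_homog (W : lmodType k) (F : I -> V -> W) i v :
  (forall i, linear (F i)) -> homog c i v -> gsum F v = F i v.
Proof.
move=> hF hv; rewrite (gsum_support (A := [fset i]%fset)) //.
  by rewrite big_seq_fset1 hv.
by move=> j; rewrite inE (homog_comp j hv) => /negPf ->.
Qed.

Lemma lin_gsum (W : lmodType k) (F : I -> V -> W) :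
  (forall i, linear (F i)) -> linear (gsum F).
Proof.
move=> hF a u v.
have [A [hA _]] := grading_support u; have [B [hB _]] := grading_support v.
pose D := (A `|` B)%fset.
have hu i : i \notin D -> c i u = 0 by rewrite inE negb_or => /andP[/hA].
have hv i : i \notin D -> c i v = 0 by rewrite inE negb_or => /andP[_ /hB].
have huv i : i \notin D -> c i (a *: u + v) = 0.
  by move=> ni; rewrite grading_lin hu // hv // scaler0 addr0.
rewrite !(gsum_support (A := D)) // scaler_sumr -big_split /=.
by apply: eq_bigr => i _; rewrite grading_lin hF.
Qed.

Lemma lin_gsuma (X W : lmodType k) (F : I -> V -> W) (t : X -> V) :
  (forall i, linear (F i)) -> linear t -> linear (fun x : X => gsum F (t x)).
Proof. by move=> hF; apply/lin_comp/lin_gsum. Qed.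

Lemma lin_gsumb (X : lmodType k) (W : lmodType k) (F : X -> I -> V -> W) v :
  (forall x i, linear (F x i)) -> (forall i v, linear (fun x => F x i v)) ->
  linear (fun x : X => gsum (F x) v).
Proof.
move=> h1 h2 a x y; have [A [hA _]] := grading_support v.
rewrite !(gsum_support (A := A)) // scaler_sumr -big_split /=.
by apply: eq_bigr => i _; rewrite h2.
Qed.

Lemma eq_lin_homog (W : lmodType k) (f g : V -> W) : linear f -> linear g ->
  (forall i v, homog c i v -> f v = g v) -> f =1 g.
Proof.
move=> hf hg fg v; have [A [_ ->]] := grading_support v.
by rewrite !lin_big //; apply: eq_bigr => i _; apply/fg/grading_homog.
Qed.

Lemma gsum_id v : gsum (fun _ v => v) v = v.
Proof.
have h : linear (gsum (fun _ v => v)) by apply: lin_gsum.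
by apply: (eq_lin_homog h (@lin_id _ V)) => i u hu; rewrite (gsum_homog _ hu).
Qed.

End GradedSum.
Arguments gsum {k I V} c {W} F v.

Lemma lin_smashc {k : fieldType} {G : zmodType} {R : bialg_sig k} {Y : yd_sig G R}
    (X : lmodType k) (t : X -> R) g :
  linear t -> linear (fun x => smash Y (t x) g).
Proof. by move=> ht a u v; rewrite ht; apply: (tens_bilin _ _).2. Qed.

Lemma gsum_comp {k : fieldType} {I : choiceType} {V : lmodType k}
    (c : I -> V -> V) (V' W : lmodType k) (L : V' -> W) (F : I -> V -> V') v :
  is_grading c -> linear L -> (forall i, linear (F i)) ->
  L (gsum c F v) = gsum c (fun i x => L (F i x)) v.
Proof.
move=> hc hL hF; have [A [hA _]] := grading_support hc v.
rewrite !(gsum_support (A := A)) ?lin_big // => i.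
exact: lin_comp.
Qed.

Lemma gsum_tlift {k : fieldType} {I : choiceType} {V : lmodType k}
    (c : I -> V -> V) (V' W' W : lmodType k) (F : I -> V -> V' -> W' -> W) v t :
  is_grading c -> (forall i a b, linear (fun x => F i x a b)) ->
  gsum c (fun i x => tlift (F i x) t) v = tlift (fun a b => gsum c (fun i x => F i x a b) v) t.
Proof.
move=> hc hF; have [A [hA _]] := grading_support hc v.
rewrite (gsum_support (A := A)) //; last by move=> i; apply: lin_tliftb.
transitivity (tlift (fun a b => \sum_(i <- A) F i (c i v) a b) t); last first.
  by apply: eq_tlift => a b; rewrite (gsum_support (A := A)).
rewrite /tlift /mlift exchange_big /=; apply: eq_bigr => p _.
by rewrite scaler_sumr.
Qed.

(* Automatic proofs of linearity *)
Create HintDb lin discriminated.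
#[global] Hint Constants Opaque : lin.
#[global] Hint Variables Opaque : lin.
#[global] Hint Resolve bilin_tens cls_linear : lin.

Lemma lin_sweedlera {k : fieldType} (A : bialg_sig k) (X W : lmodType k)
    (f : A -> A -> W) (t : X -> A) :
  linear (@bcomul k A) -> bilin f -> linear t ->
  linear (fun x => sweedler f (t x)).
Proof. by move=> hA hf ht; apply: lin_tlifta => //; apply: lin_comp. Qed.

Lemma lin_sweedlerb {k : fieldType} (A : bialg_sig k) (X W : lmodType k)
    (F : X -> A -> A -> W) a :
  (forall v w, linear (fun x => F x v w)) -> linear (fun x => sweedler (F x) a).
Proof. exact: lin_tliftb. Qed.

Definition trilin {k : fieldType} (U V W X : lmodType k) (f : U -> V -> W -> X) :=
  (forall u, bilin (f u)) /\ forall v w, linear (fun u => f u v w).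

Ltac lin_hyp := solve
  [ match goal with H : _ |- _ => simple apply H end
  | match goal with H := _ : _ |- _ => simple apply H end ].

Ltac lin_leaf :=
  solve [ lin_hyp | eauto 3 with lin nocore
        | lazymatch goal with
          | |- GRing.linear_for _ (?B ?v) => first [ apply: (@lin_bil _ _ _ _ B v)
                  | apply: (@lin_bil _ (klm _) _ _ B v) ]
          end; first [ lin_hyp | eauto 3 with lin nocore ] ].

Ltac lin_app :=
  match goal with
  | |- GRing.linear_for _ (fun x => ?f (@?g x)) =>
      first [ apply: (lin_comp (f := f) (g := g))
            | apply: (@lin_comp _ _ _ (klm _) f g) ]
  | |- GRing.linear_for _ (fun x => ?B (@?g x) ?w) =>
      first [ apply: (lin_bilc (B := B) (g := g))
            | apply: (@lin_bilc _ _ (klm _) _ _ B g) ]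
  end.

(** Recursion on the head of the map. In a product, a scaling or a Sweedler sum, one of the two
    arguments is constant in the variable and linearity is passed to the other; leaves are closed by
    hypotheses and by the hints [lin]. *)
Ltac lin :=
  cbv beta;
  lazymatch goal with
  | |- forall _, _ => intro; lin
  | |- trilin _ => split; lin
  | |- is_grading _ => lin_hyp
  | |- bilin (fun _ => _) => first [ lin_hyp | split; lin ]
  | |- bilin _ => first [ lin_leaf | split; lin ]
  | |- GRing.linear_for _ (fun x => x) => exact: lin_id
  | |- GRing.linear_for _ (fun _ => 0) => exact: lin_zero
  | |- GRing.linear_for _ (fun x => _ + _) => apply: lin_add; lin
  | |- GRing.linear_for _ (fun x => - _) => apply: lin_opp; lin
  | |- GRing.linear_for _ (fun x => _ *: _) =>
      lazymatch goal with
      | |- GRing.linear_for _ (fun x => @GRing.scale ?R ?V (@?f x) (@?g x)) =>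
        first [ lazymatch f with (fun _ => ?c) =>
                  apply: (lin_scaler c (f := g)) end
              | lazymatch g with (fun _ => ?w) =>
                  apply: (lin_scalel w (c := f)) end ]; lin
      end
  | |- GRing.linear_for _ (fun x => GRing.mul _ _) =>
      lazymatch goal with
      | |- GRing.linear_for _ (fun x => GRing.mul (@?f x) (@?g x)) =>
        first [ lazymatch f with (fun _ => ?c) => apply: (lin_mulr c (c := g)) end
              | lazymatch g with (fun _ => ?c) => apply: (lin_mull c (c := f)) end ]
      end; lin
  | |- GRing.linear_for _ (fun x => \big[_/_]_(i <- _ | _) _) =>
      apply: lin_sum; lin
  | |- GRing.linear_for _ (fun x => sweedler3 _ _) => unfold sweedler3; lin
  | |- GRing.linear_for _ (fun x => sweedler _ _) =>
      lazymatch goal with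
      | |- GRing.linear_for _ (fun x => @sweedler _ ?A ?W (@?f x) (@?g x)) =>
        first [ lazymatch f with (fun _ => ?c) => apply: (@lin_sweedlera _ A _ W c g) end
              | lazymatch g with (fun _ => ?c) => apply: (@lin_sweedlerb _ A _ W f c) end ]
      end; lin
  | |- GRing.linear_for _ (fun x => gsum _ _ _) =>
      lazymatch goal with
      | |- GRing.linear_for _ (fun x => @gsum _ _ _ ?c ?W (@?f x) (@?g x)) =>
        first [ lazymatch f with (fun _ => ?F) =>
                  refine (@lin_gsuma _ _ _ c _ _ W F g _ _) end
              | lazymatch g with (fun _ => ?v) =>
                  refine (@lin_gsumb _ _ _ c _ _ W f v _ _) end ]
      end; lin
  | |- GRing.linear_for _ (fun x => smash _ (@?t x) _) =>
      apply: (lin_smashc (t := t)); lin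
  | |- GRing.linear_for _ (gsum ?c ?F) => refine (lin_gsum _ _); lin
  | |- GRing.linear_for _ (fun x => tlift _ _) =>
      lazymatch goal with
      | |- GRing.linear_for _ (fun x => @tlift _ ?V ?W ?U (@?f x) (@?g x)) =>
        first [ lazymatch f with (fun _ => ?c) => apply: (@lin_tlifta _ _ U V W c g) end
              | lazymatch g with (fun _ => ?c) => apply: (@lin_tliftb _ _ U V W f c) end ]
      end; lin
  | |- GRing.linear_for _ (fun x => mlift _ _) =>
      lazymatch goal with
      | |- GRing.linear_for _ (fun x => @mlift _ _ ?W (@?f x) (@?g x)) =>
        first [ lazymatch f with (fun _ => ?c) => apply: (@lin_mlifta _ _ W _ c g) end
              | lazymatch g with (fun _ => ?c) => apply: (@lin_mliftb _ _ W _ f c) end ]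
      end; lin
  | |- GRing.linear_for _ (fun x => _) => first [ lin_hyp | lin_app; lin ]
  | |- GRing.linear_for _ (sweedler ?f) =>
      apply: (@lin_sweedlera _ _ _ _ f (fun x => x)); lin
  | |- GRing.linear_for _ (tlift _) => apply: tlift_linear; lin
  | |- GRing.linear_for _ (mlift _) => apply: mlift_linear
  | |- GRing.linear_for _ _ => lin_leaf
  | |- _ => idtac
  end.

Opaque tens tlift mlift cls Defs.rep quotv tensor.

Local Notation "'\sw_' ( x , y '<-' a ) F" := (sweedler (fun x y => F) a)
  (at level 41, F at level 41, x binder, y binder, a at level 50,
   format "'\sw_' ( x ,  y  '<-'  a )  F") : ring_scope.
Local Notation "'\sw_' ( x , y , z '<-' a ) F" :=
  (sweedler3 (fun x y z => F) a)
  (at level 41, F at level 41, x binder, y binder, z binder, a at level 50,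
   format "'\sw_' ( x ,  y ,  z  '<-'  a )  F") : ring_scope.

(** * Coalgebras in Sweedler notation *)

(* The counit with values in [k] instead of [k^o]: scaling by elements of [k^o]
   involves another (convertible) instance of the structure of ring. *)
Definition eps {k : fieldType} {A : bialg_sig k} (a : A) : k := bcounit a.

Section Coalgebra.
Context {k : fieldType}.

Lemma eq_sw (C : bialg_sig k) (W : lmodType k) (f g : C -> C -> W) c :
  (forall x y, f x y = g x y) -> sweedler f c = sweedler g c.
Proof. exact: eq_tlift. Qed.

Lemma sw_comp (C : bialg_sig k) (V W : lmodType k) (L : V -> W)
  (f : C -> C -> V) c : linear L -> L (sweedler f c) = \sw_(x, y <- c) L (f x y).
Proof. exact: tlift_comp. Qed.

Lemma sw_exch (C D : bialg_sig k) (W : lmodType k) (F : C -> C -> D -> D -> W) c d :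
  (\sw_(x, y <- c) \sw_(u, v <- d) F x y u v)
  = \sw_(u, v <- d) \sw_(x, y <- c) F x y u v.
Proof. exact: tlift_exch. Qed.

Lemma sw_add (C : bialg_sig k) (W : lmodType k) (f g : C -> C -> W) c :
  (\sw_(x, y <- c) (f x y + g x y)) = sweedler f c + sweedler g c.
Proof. exact: tliftD. Qed.

Lemma sw0 (C : bialg_sig k) (W : lmodType k) (c : C) : sweedler (fun _ _ => 0 : W) c = 0.
Proof. by symmetry; apply: (sw_comp (fun _ _ => 0 : W) c (@lin_zero k W W)). Qed.

Lemma sw_tmap (C : bialg_sig k) (V W : lmodType k) (f : C -> V) (g : C -> W) c :
  tmap f g (bcomul c) = \sw_(x, y <- c) f x \ox g y.
Proof. by []. Qed.

Lemma tmap_tens (V V' W W' : lmodType k) (f : V -> V') (g : W -> W') v w :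
  linear f -> linear g -> tmap f g (v \ox w) = f v \ox g w.
Proof. by move=> hf hg; rewrite /tmap tlift_tens; [|lin]. Qed.

Lemma lin_tmap (V V' W W' : lmodType k) (f : V -> V') (g : W -> W') :
  linear f -> linear g -> linear (tmap f g).
Proof. by move=> hf hg; apply: tlift_linear; lin. Qed.

Lemma tassoc_tens (U V W : lmodType k) (u : U) (v : V) (w : W) :
  tassoc (u \ox v \ox w) = u \ox (v \ox w).
Proof. by rewrite /tassoc tlift_tens; [rewrite tlift_tens; [|lin]|lin]. Qed.

Lemma lin_tassoc (U V W : lmodType k) : linear (@tassoc k U V W).
Proof. by apply: tlift_linear; lin. Qed.

Lemma coassoclE (C : bialg_sig k) (c : C) : linear (@bcomul k C) ->
  tassoc (tmap (@bcomul k C) id (bcomul c))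
  = \sw_(d, z <- c) \sw_(x, y <- d) x \ox (y \ox z).
Proof.
move=> hC; rewrite sw_tmap (sw_comp _ _ (@lin_tassoc _ _ _)).
by apply: eq_sw => d z; rewrite /tassoc tlift_tens; [|lin].
Qed.

Lemma tlift_id (V W : lmodType k) (t : tensor V W) :
  tlift (fun v w => v \ox w) t = t.
Proof. by apply: eq_lin_tens t => [||v w]; [lin|lin|rewrite tlift_tens; [|lin]]. Qed.

Lemma coassocrE (C : bialg_sig k) (c : C) :
  tmap id (@bcomul k C) (bcomul c)
  = \sw_(x, d <- c) \sw_(y, z <- d) x \ox (y \ox z).
Proof.
rewrite sw_tmap; apply: eq_sw => x d.
rewrite -(sw_comp (fun y z => y \ox z) d (L := tens x)); last by lin.
by rewrite /sweedler tlift_id.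
Qed.

Lemma coalgI (C : bialg_sig k) :
  linear (@bcomul k C) -> linear (@eps k C : C -> klm k) ->
  (forall c : C, \sw_(d, z <- c) \sw_(x, y <- d) x \ox (y \ox z)
    = \sw_(x, d <- c) \sw_(y, z <- d) x \ox (y \ox z) :> tensor C (tensor C C)) ->
  (forall c : C, \sw_(x, y <- c) (eps (x : C) *: y) = c) ->
  (forall c : C, \sw_(x, y <- c) (eps (y : C) *: x) = c) -> is_coalg C.
Proof. move=> hD he hA hl hr; split; [exact: hD|exact: he| |exact: hl|exact: hr].
by move=> c; rewrite coassoclE; [rewrite coassocrE; apply: hA|]. Qed.

Lemma alg_bilin (A : bialg_sig k) : is_alg A -> bilin (@bmul k A).
Proof. by case. Qed.
Lemma coalg_comul (C : bialg_sig k) : is_coalg C -> linear (@bcomul k C).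
Proof. by case. Qed.
Lemma coalg_counit (C : bialg_sig k) : is_coalg C -> linear (@eps k C : C -> klm k).
Proof. by case. Qed.

End Coalgebra.

#[global] Hint Resolve alg_bilin coalg_comul coalg_counit lin_tmap lin_tassoc : lin.

Section CoalgebraLaws.
Context {k : fieldType} {C : bialg_sig k} (hC : is_coalg C).
Variable W : lmodType k.

Lemma sw_counitl (f : C -> W) c : linear f ->
  (\sw_(x, y <- c) eps x *: f y) = f c.
Proof.
move=> hf; have h : \sw_(x, y <- c) (eps x *: y) = c by case: hC.
rewrite -[in RHS]h (sw_comp _ _ hf); apply: eq_sw => x y.
by rewrite (linZ _ _ hf).
Qed.

Lemma sw_counitr (f : C -> W) c : linear f ->
  (\sw_(x, y <- c) eps y *: f x) = f c.
Proof.
move=> hf; have h : \sw_(x, y <- c) (eps y *: x) = c by case: hC.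
rewrite -[in RHS]h (sw_comp _ _ hf); apply: eq_sw => x y.
by rewrite (linZ _ _ hf).
Qed.

(** Coassociativity is an identity in C ⊗ (C ⊗ C); the linear map [L] induced by the trilinear [f]
    turns it into an identity between values of [f]. *)
Lemma sw_assoc (f : C -> C -> C -> W) c : trilin f ->
  (\sw_(d, z <- c) \sw_(x, y <- d) f x y z) = \sw_(x, y, z <- c) f x y z.
Proof.
move=> [f1 f2]; rewrite /sweedler3.
have hf x : linear (tlift (f x)) by apply: tlift_linear.
pose L : tensor C (tensor C C) -> W := tlift (fun x t => tlift (f x) t).
have hL2 : bilin (fun x t => tlift (f x) t). by lin.
have hL : linear L by rewrite /L; lin.
have LE x y z : L (x \ox (y \ox z)) = f x y z.
  by rewrite /L tlift_tens // tlift_tens.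
case: (hC) => hD _ /(_ c); rewrite (coassoclE _ hD) coassocrE.
move=> /(congr1 L) hA _ _.
transitivity (L (\sw_(d, z <- c) \sw_(x, y <- d) x \ox (y \ox z))).
  rewrite (sw_comp _ _ hL); apply: eq_sw => d z.
  by rewrite (sw_comp _ _ hL); apply: eq_sw => x y; rewrite LE.
rewrite hA (sw_comp _ _ hL); apply: eq_sw => x d.
by rewrite (sw_comp _ _ hL); apply: eq_sw => y z; rewrite LE.
Qed.

Lemma sw3_comp (V : lmodType k) (L : W -> V) (f : C -> C -> C -> W) c : linear L ->
  L (\sw_(x, y, z <- c) f x y z) = \sw_(x, y, z <- c) L (f x y z).
Proof.
move=> hL; rewrite /sweedler3 sw_comp //; apply: eq_sw => x d.
by rewrite sw_comp.
Qed.

Lemma eq_sw3 (f g : C -> C -> C -> W) c :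
  (forall x y z, f x y z = g x y z) -> sweedler3 f c = sweedler3 g c.
Proof. by move=> fg; apply: eq_sw => x d; apply: eq_sw. Qed.

Lemma sw3_counit (f : C -> W) c : linear f ->
  (\sw_(x, y, z <- c) (eps x * eps z) *: f y) = f c.
Proof.
move=> hf; rewrite /sweedler3 -[RHS](sw_counitl c hf).
apply: eq_sw => x d; rewrite -[f d](sw_counitr d hf).
rewrite (sw_comp _ _ (L := fun w => eps x *: w)); last by lin.
by apply: eq_sw => y z; rewrite scalerA.
Qed.

(** Two bracketings of the fourfold coproduct. The right-hand one makes the two middle legs the
    coproduct of one element, so that a cancellation between them can be applied; [sw3_nest] does
    the same for five legs. *)
Lemma sw_nest (F : C -> C -> C -> C -> W) c :
  (forall x y z, linear (F x y z)) ->
  (forall x y t, linear (fun z => F x y z t)) ->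
  (forall x z t, linear (fun y => F x y z t)) ->
  (forall y z t, linear (fun x => F x y z t)) ->
  (\sw_(d, e <- c) \sw_(x, y <- d) \sw_(z, t <- e) F x y z t)
  = \sw_(x, d, t <- c) \sw_(y, z <- d) F x y z t.
Proof.
move=> h4 h3 h2 h1; have hD := coalg_comul hC; rewrite /sweedler3.
pose H x y e := \sw_(z, t <- e) F x y z t.
transitivity (\sw_(d, e <- c) \sw_(x, y <- d) H x y e); first by [].
rewrite sw_assoc; last by rewrite /H; lin.
apply: eq_sw => x d.
by rewrite (sw_assoc (f := F x)); [|lin].
Qed.

Lemma sw3_nest (F : C -> C -> C -> C -> C -> W) c :
  (forall x y z t, linear (F x y z t)) ->
  (forall x y z u, linear (fun t => F x y z t u)) ->
  (forall x y t u, linear (fun z => F x y z t u)) ->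
  (forall x z t u, linear (fun y => F x y z t u)) ->
  (forall y z t u, linear (fun x => F x y z t u)) ->
  (\sw_(x, d, u <- c) \sw_(y, z, t <- d) F x y z t u)
  = \sw_(d, z, e <- c) \sw_(x, y <- d) \sw_(t, u <- e) F x y z t u.
Proof.
move=> h5 h4 h3 h2 h1; have hD := coalg_comul hC; rewrite /sweedler3.
transitivity
  (\sw_(x, d <- c) \sw_(y, e <- d) \sw_(z, f <- e) \sw_(t, u <- f) F x y z t u).
  apply: eq_sw => x d.
  pose H y e u := \sw_(z, t <- e) F x y z t u.
  rewrite -[LHS]/(sweedler (fun e u => \sw_(y, f <- e) H y f u) d).
  rewrite sw_assoc; last by rewrite /H; lin.
  apply: eq_sw => y e; rewrite /H.
  by rewrite (sw_assoc (f := F x y)); [|lin].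
symmetry; pose H x y e := \sw_(z, f <- e) \sw_(t, u <- f) F x y z t u.
transitivity (\sw_(d, e <- c) \sw_(x, y <- d) H x y e).
  by apply: eq_sw => d e; rewrite sw_exch.
by rewrite sw_assoc /H; [|lin].
Qed.

End CoalgebraLaws.

Section TensorCoalgebra.
Context {k : fieldType} {A B : bialg_sig k}.
Hypotheses (hA : is_coalg A) (hB : is_coalg B).
Local Notation AB := (tensor_bialg A B).

Lemma lin_tensor_comul : linear (@bcomul k AB).
Proof. by apply: tlift_linear; lin. Qed.

Lemma lin_tensor_counit : linear (@eps k AB : AB -> klm k).
Proof.
have h : bilin (fun (a : A) (b : B) => eps a * eps b : klm k) by lin.
exact: tlift_linear h.
Qed.

Lemma tensor_counitE (a : A) (b : B) :
  @eps k AB (a \ox b) = eps a * eps b.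
Proof. have h : bilin (fun (a : A) (b : B) => eps a * eps b : klm k) by lin.
exact: tlift_tens h a b. Qed.

Lemma sw_tens (W : lmodType k) (f : AB -> AB -> W) a b : bilin f ->
  @sweedler k AB W f (a \ox b)
  = \sw_(a1, a2 <- a) \sw_(b1, b2 <- b) f (a1 \ox b1) (a2 \ox b2).
Proof.
move=> hf; rewrite /(@sweedler _ AB) /= (tlift_tens (f := fun a b => _)); last by lin.
rewrite sw_comp; last by lin.
apply: eq_sw => a1 a2; rewrite sw_comp; last by lin.
by apply: eq_sw => b1 b2; rewrite tlift_tens.
Qed.

Lemma sw3_tens (W : lmodType k) (f : AB -> AB -> AB -> W) a b :
  trilin f -> @sweedler3 k AB W f (a \ox b)
  = \sw_(a1, a2, a3 <- a) \sw_(b1, b2, b3 <- b)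
      f (a1 \ox b1) (a2 \ox b2) (a3 \ox b3).
Proof.
move=> [f1 f2]; have hD := lin_tensor_comul.
rewrite /sweedler3 sw_tens; last by lin.
apply: eq_sw => a1 d; rewrite [RHS]sw_exch; apply: eq_sw => b1 e.
by rewrite [LHS]sw_tens; [|lin].
Qed.

Lemma tensor_coalg : is_coalg AB.
Proof.
have hD := lin_tensor_comul; have he := lin_tensor_counit.
apply: (coalgI hD he) => t; move: t.
- apply: eq_lin_tens => [||a b]; [lin|lin|].
  rewrite [LHS]sw_tens; last by lin.
  rewrite [RHS]sw_tens; last by lin.
  pose G a1 a2 a3 b1 b2 b3 : tensor AB (tensor AB AB) :=
    (a1 \ox b1) \ox ((a2 \ox b2) \ox (a3 \ox b3)).
  transitivity (\sw_(a1, a2, a3 <- a) \sw_(b1, b2, b3 <- b) G a1 a2 a3 b1 b2 b3).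
    rewrite -(sw_assoc hA) /G; last by lin.
    apply: eq_sw => a' a3.
    transitivity (\sw_(b', b3 <- b) \sw_(a1, a2 <- a') \sw_(b1, b2 <- b')
      G a1 a2 a3 b1 b2 b3).
      by apply: eq_sw => b' b3; rewrite [LHS]sw_tens; [|lin].
    by rewrite [LHS]sw_exch; apply: eq_sw => a1 a2; apply: (sw_assoc hB); rewrite /G; lin.
  rewrite /sweedler3; apply: eq_sw => a1 a'; rewrite [LHS]sw_exch.
  by apply: eq_sw => b1 b'; rewrite [RHS]sw_tens; [|lin].
- apply: eq_lin_tens => [||a b]; [lin|lin|].
  rewrite [LHS]sw_tens; last by lin.
  transitivity (\sw_(a1, a2 <- a) eps a1 *: (a2 \ox b)); last first.
    by apply: (sw_counitl hA (f := fun a => a \ox b)); lin.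
  apply: eq_sw => a1 a2; rewrite -[a2 \ox b](sw_counitl hB); last by lin.
  rewrite [RHS](sw_comp _ _ (L := fun w => _ *: w)); last by lin.
  by apply: eq_sw => b1 b2; rewrite tensor_counitE scalerA.
- apply: eq_lin_tens => [||a b]; [lin|lin|].
  rewrite [LHS]sw_tens; last by lin.
  transitivity (\sw_(a1, a2 <- a) eps a2 *: (a1 \ox b)); last first.
    by apply: (sw_counitr hA (f := fun a => a \ox b)); lin.
  apply: eq_sw => a1 a2; rewrite -[a1 \ox b](sw_counitr hB); last by lin.
  rewrite [RHS](sw_comp _ _ (L := fun w => _ *: w)); last by lin.
  by apply: eq_sw => b1 b2; rewrite tensor_counitE scalerA.
Qed.

End TensorCoalgebra.

#[global] Hint Resolve tensor_coalg : lin.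

Lemma eq_lin_tensb {k : fieldType} (A B : bialg_sig k) (W : lmodType k)
    (f g : tensor_bialg A B -> W) : linear f -> linear g ->
  (forall a b, f (a \ox b) = g (a \ox b)) -> forall t, f t = g t.
Proof. exact: eq_lin_tens. Qed.

(** * Convolution, bialgebras and antipodes *)

Section Convolution.
Context {k : fieldType} {C : bialg_sig k} (hC : is_coalg C).
Variables (A : bialg_sig k) (hA : is_alg A).

(** In the convolution algebra f = f(gh) = (fg)h = h: a left inverse and a right inverse of [g]
    coincide. All later uniqueness arguments (antipodes, inverse pairings) go through this. *)
Lemma conv_unique (f g h : C -> A) : linear f -> linear g -> linear h ->
  (forall c, \sw_(x, y <- c) bmul (f x) (g y) = eps c *: bone A) ->
  (forall c, \sw_(x, y <- c) bmul (g x) (h y) = eps c *: bone A) ->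
  f =1 h.
Proof.
move=> hf hg hh fg gh c; have hm := alg_bilin hA; case: (hA) => _ mA m1 mr1.
transitivity (\sw_(x, y, z <- c) bmul (f x) (bmul (g y) (h z))).
  rewrite -[LHS](sw_counitr hC c hf); apply: eq_sw => x d.
  by rewrite -(sw_comp _ _ (L := bmul (f x))) ?gh; [rewrite (linZ (f := bmul (f x))) ?mr1; [|lin]|lin].
rewrite -(sw_assoc hC); last by lin.
rewrite -[RHS](sw_counitl hC c hh); apply: eq_sw => d z.
transitivity (\sw_(x, y <- d) bmul (bmul (f x) (g y)) (h z)).
  by apply: eq_sw => x y; rewrite mA.
rewrite -(sw_comp _ _ (L := fun u => bmul u (h z))); last by lin.
by rewrite fg (linZ (f := fun u : A => bmul u (h z))); [rewrite m1|lin].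
Qed.

End Convolution.

Section Bialgebra.
Context {k : fieldType} {A : bialg_sig k} (hA : is_bialg A).

Lemma bialg_alg : is_alg A. Proof. by case: hA. Qed.
Lemma bialg_coalg : is_coalg A. Proof. by case: hA. Qed.

Lemma bmulA : associative (@bmul k A). Proof. by case: bialg_alg. Qed.
Lemma bmul1l : left_id (bone A) (@bmul k A). Proof. by case: bialg_alg. Qed.
Lemma bmul1r : right_id (bone A) (@bmul k A). Proof. by case: bialg_alg. Qed.
Lemma eps1 : eps (bone A) = 1. Proof. by case: hA => _ _ []. Qed.
Lemma epsM (a b : A) : eps (bmul a b) = eps a * eps b.
Proof. by case: hA => _ _ []. Qed.

Lemma sw_one (W : lmodType k) (f : A -> A -> W) : bilin f ->
  sweedler f (bone A) = f (bone A) (bone A).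
Proof. by move=> hf; case: hA => _ _ _ h1 _; rewrite /sweedler h1 tlift_tens. Qed.

Lemma sw_mul (W : lmodType k) (f : A -> A -> W) a b : bilin f ->
  sweedler f (bmul a b)
  = \sw_(a1, a2 <- a) \sw_(b1, b2 <- b) f (bmul a1 b1) (bmul a2 b2).
Proof.
move=> hf; have hm := alg_bilin bialg_alg.
case: hA => _ _ _ _ hM; rewrite /sweedler hM /tprod tlift_comp; last by lin.
apply: eq_tlift => a1 a2; rewrite tlift_comp; last by lin.
by apply: eq_tlift => b1 b2; rewrite tlift_tens.
Qed.

Variables (S : A -> A) (hS : is_antipode S).

Lemma lin_antipode : linear S. Proof. by case: hS. Qed.
Lemma sw_antipodel a : \sw_(x, y <- a) bmul (S x) y = eps a *: bone A.
Proof. by case: hS. Qed.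
Lemma sw_antipoder a : \sw_(x, y <- a) bmul x (S y) = eps a *: bone A.
Proof. by case: hS. Qed.

Lemma antipode_unique (S' : A -> A) : is_antipode S' -> S =1 S'.
Proof.
move=> [hS' _ h']; apply: (conv_unique bialg_coalg bialg_alg (g := id) lin_antipode (@lin_id _ _) hS') => c.
- exact: sw_antipodel.
- exact: h'.
Qed.

Lemma antipode1 : S (bone A) = bone A.
Proof.
have hm := alg_bilin bialg_alg; have hS' := lin_antipode.
have := sw_antipodel (bone A).
by rewrite sw_one; [rewrite bmul1r eps1 scale1r|lin].
Qed.

(** In the convolution algebra of linear maps from A ⊗ A to A, both sides are inverse to the
    multiplication: [f] from the left by the antipode axiom at a product, [h] from the right by
    cancelling from the inside out. *)
Lemma antipodeM a b : S (bmul a b) = bmul (S b) (S a).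
Proof.
have hm := alg_bilin bialg_alg; have hS' := lin_antipode.
have hc := bialg_coalg.
have hD := coalg_comul hc; have he := coalg_counit hc.
have hAA := tensor_coalg hc hc.
pose f : tensor_bialg A A -> A := fun t => S (tlift (@bmul k A) t).
pose g : tensor_bialg A A -> A := tlift (@bmul k A).
pose h : tensor_bialg A A -> A := tlift (fun a b => bmul (S b) (S a)).
have fE x y : f (x \ox y) = S (bmul x y) by rewrite /f tlift_tens; [|lin].
have gE x y : g (x \ox y) = bmul x y by rewrite /g tlift_tens; [|lin].
have hE x y : h (x \ox y) = bmul (S y) (S x) by rewrite /h tlift_tens; [|lin].
have hf : linear f by rewrite /f; lin.
have hg : linear g by rewrite /g; lin.
have hh : linear h by rewrite /h; lin.
rewrite -fE -hE; apply: (conv_unique hAA bialg_alg hf hg hh) => {a b}.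
- refine (eq_lin_tensb _ _ _) => [||a b]; [by lin|by lin|].
  rewrite [LHS](sw_tens hc hc); last by lin.
  rewrite (tensor_counitE hc hc) -epsM -sw_antipodel [RHS]sw_mul; last by lin.
  by apply: eq_sw => a1 a2; apply: eq_sw => b1 b2; rewrite fE gE.
- refine (eq_lin_tensb _ _ _) => [||a b]; [by lin|by lin|].
  rewrite [LHS](sw_tens hc hc); last by lin.
  rewrite (tensor_counitE hc hc).
  transitivity (\sw_(a1, a2 <- a) eps b *: bmul a1 (S a2)).
    apply: eq_sw => a1 a2.
    transitivity (\sw_(b1, b2 <- b) bmul a1 (bmul (bmul b1 (S b2)) (S a2))).
      by apply: eq_sw => b1 b2; rewrite gE hE -!bmulA.
    rewrite -(sw_comp (fun b1 b2 => bmul b1 (S b2)) b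
      (L := fun u => bmul a1 (bmul u (S a2)))); last by lin.
    rewrite sw_antipoder (linZ (f := fun u => bmul a1 (bmul u (S a2)))); last by lin.
    by rewrite bmul1l.
  rewrite -(sw_comp _ _ (L := fun u => eps b *: u)); last by lin.
  by rewrite sw_antipoder scalerA mulrC.
Qed.

End Bialgebra.

(** * Ideals, quotients and morphisms of bialgebras *)

Section Ideals.
Context {k : fieldType} {A : bialg_sig k}.

Lemma ideal_gen_ideal (S : set A) : is_ideal (ideal_gen S).
Proof.
split; first split; rewrite /ideal_gen /=.
- by move=> J [[J0 _] _].
- by move=> a u v hu hv J hJ SJ; case: (hJ) => [[_ h] _]; apply: h; [apply: hu|apply: hv].
- by move=> a x hx; split=> J hJ SJ; have [] := hJ.2 a x (hx J hJ SJ).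
Qed.

Lemma ideal_gen_sub (S : set A) x : S x -> ideal_gen S x.
Proof. by move=> Sx J _; apply. Qed.

Lemma ideal_gen_min (S J : set A) x :
  is_ideal J -> (forall y, S y -> J y) -> ideal_gen S x -> J x.
Proof. by move=> hJ SJ; apply. Qed.

Lemma ideal_cls0 (J : set A) x : is_ideal J -> cls J x = 0 <-> J x.
Proof.
move=> [hJ _]; split; first by move/cls0P/span_id; apply.
by move=> Jx; apply/cls0P; apply: Defs.sub_span.
Qed.

Lemma ideal_cls_eq (J : set A) x y : is_ideal J -> cls J x = cls J y <-> J (x - y).
Proof.
move=> hJ; rewrite -(ideal_cls0 _ hJ) linB; last exact: cls_linear.
by split=> [->|/eqP]; [rewrite subrr|rewrite subr_eq0 => /eqP].
Qed.

Lemma quot_mulE (J : set A) (a b : A) : bilin (@bmul k A) -> is_ideal J ->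
  @bmul k (quot_bialg J) (cls J a) (cls J b) = cls J (bmul a b).
Proof.
move=> hm hJ; apply/(ideal_cls_eq _ _ hJ).
have hr c : J (rep (cls J c) - c) by apply/(ideal_cls_eq _ _ hJ); rewrite repK.
set a' := rep (cls J a); set b' := rep (cls J b).
have -> : bmul a' b' - bmul a b = bmul a' (b' - b) + bmul (a' - a) b.
  rewrite (linB (f := bmul a')); last by lin.
  rewrite (linB (f := fun x : A => bmul x b)); last by lin.
  by rewrite addrA subrK.
case: (hJ) => hs hi; apply: subspaceD => //.
  exact: (hi _ _ (hr b)).1.
exact: (hi _ _ (hr a)).2.
Qed.

End Ideals.

Section SurjectiveMorphism.
Context {k : fieldType} {A B : bialg_sig k} (p : A -> B).

Definition alg_hom := [/\ linear p, p (bone A) = bone B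
  & forall a b, p (bmul a b) = bmul (p a) (p b)].
Definition coalg_hom := (forall a, bcomul (p a) = tmap p p (bcomul a)) /\
  forall a, eps (p a) = eps a.

Hypothesis surj : forall b, exists a, p a = b.

Lemma surj_alg : is_alg A -> alg_hom -> is_alg B.
Proof.
move=> [[hm1 hm2] mA m1 mr1] [hp p1 pM].
split=> [|x y z|x|x].
- split=> x c y z; have [[a <-] [b <-] [d <-]] := And3 (surj x) (surj y) (surj z).
    by rewrite -hp -!pM hm1 hp.
  by rewrite -hp -!pM hm2 hp.
- have [[a <-] [b <-] [d <-]] := And3 (surj x) (surj y) (surj z).
  by rewrite -!pM mA.
- by have [a <-] := surj x; rewrite -p1 -pM m1.
- by have [a <-] := surj x; rewrite -p1 -pM mr1.
Qed.

Hypothesis hp : linear p.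

Lemma sw_hom (W : lmodType k) (f : B -> B -> W) a : coalg_hom -> bilin f ->
  sweedler f (p a) = \sw_(x, y <- a) f (p x) (p y).
Proof.
move=> [hD _] hf; rewrite /sweedler hD /tmap tlift_comp; last by lin.
by apply: eq_tlift => x y; rewrite tlift_tens.
Qed.

Lemma surj_coalg : is_coalg A -> coalg_hom -> is_coalg B.
Proof.
move=> hA hB; case: (hB) => hD he.
have lD : linear (@bcomul k B).
  move=> c x y; have [[a <-] [b <-]] := conj (surj x) (surj y).
  have hT : linear (fun a => tmap p p (bcomul a)) by lin.
  by rewrite -hp !hD hT.
have le : linear (@eps k B : B -> klm k).
  move=> c x y; have [[a <-] [b <-]] := conj (surj x) (surj y).
  have hT : linear (@eps k A : A -> klm k) by lin.
  by rewrite -hp !he hT.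
apply: (coalgI lD le) => x; have [a <-] := surj x.
- rewrite [LHS](sw_hom _ hB); last by lin.
  rewrite [RHS](sw_hom _ hB); last by lin.
  transitivity (\sw_(x, y, z <- a) p x \ox (p y \ox p z)).
    rewrite -(sw_assoc hA); last by lin.
    by apply: eq_sw => d z; rewrite [LHS](sw_hom _ hB); [|lin].
  by apply: eq_sw => d z; rewrite [RHS](sw_hom _ hB); [|lin].
- rewrite [LHS](sw_hom _ hB); last by lin.
  rewrite -[RHS](sw_counitl hA (f := p)); last by [].
  by apply: eq_sw => d z; rewrite he.
- rewrite [LHS](sw_hom _ hB); last by lin.
  rewrite -[RHS](sw_counitr hA (f := p)); last by [].
  by apply: eq_sw => d z; rewrite he.
Qed.

(** The axioms descend along a surjection that respects the structure maps. This serves for classes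
    modulo an ideal, and also for transporting the axioms along a bijection onto an algebra not yet
    known to be a bialgebra. *)
Lemma surj_bialg : is_bialg A -> alg_hom -> coalg_hom -> is_bialg B.
Proof.
move=> hA hpa hpc; have hAc := bialg_coalg hA; case: (hpa) => _ p1 pM; case: (hpc) => hD he.
have hBa := surj_alg (bialg_alg hA) hpa; have hBc := surj_coalg hAc hpc.
have hm := alg_bilin hBa.
split; [exact: hBa|exact: hBc| | |].
- split; first by rewrite -p1; apply: etrans (he _) (eps1 hA).
  move=> x y; have [[a <-] [b <-]] := conj (surj x) (surj y).
  by rewrite -pM; apply: etrans (he _) _; rewrite (epsM hA) -!he.
- rewrite -p1 hD; case: hA => _ _ _ -> _.
  by rewrite tmap_tens.
- move=> x y; have [[a <-] [b <-]] := conj (surj x) (surj y).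
  rewrite -pM hD sw_tmap [LHS](sw_mul hA); last by lin.
  rewrite /tprod -[RHS]/(sweedler _ _) [RHS](sw_hom _ hpc); last by lin.
  apply: eq_sw => a1 a2; rewrite -[RHS]/(sweedler _ _) [RHS](sw_hom _ hpc); last by lin.
  by apply: eq_sw => b1 b2; rewrite !pM.
Qed.

Lemma surj_antipode (S : A -> A) : is_bialg A -> alg_hom -> coalg_hom ->
  is_antipode S -> (forall a, p a = 0 -> p (S a) = 0) ->
  exists S' : B -> B, is_antipode S' /\ forall a, S' (p a) = p (S a).
Proof.
move=> hA hpa hpc hS hker; case: (hpa) => _ p1 pM; case: (hpc) => hD he.
have lS := lin_antipode hS.
have hm := alg_bilin (surj_alg (bialg_alg hA) hpa).
have lpS : linear (fun a => p (S a)) by lin.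
have [S' lS' S'E] := lin_factor hp lpS surj hker.
exists S'; split=> //; split=> // x; have [a <-] := surj x.
- rewrite [LHS](sw_hom _ hpc); last by lin.
  rewrite -[bcounit (p a)]/(eps (p a)) he -p1 -(linZ _ _ hp) -(sw_antipodel hS).
  by rewrite (sw_comp _ _ hp); apply: eq_sw => y z; rewrite S'E pM.
- rewrite [LHS](sw_hom _ hpc); last by lin.
  rewrite -[bcounit (p a)]/(eps (p a)) he -p1 -(linZ _ _ hp) -(sw_antipoder hS).
  by rewrite (sw_comp _ _ hp); apply: eq_sw => y z; rewrite S'E pM.
Qed.

(** The kernel of p ⊗ p is ker p ⊗ A + A ⊗ ker p. Modulo that span, the class of [s x \ox s y] does
    not depend on the lifts [s x] and [s y], hence is bilinear in [x] and [y]; so the class map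
    factors through [tmap p p]. *)
Lemma ker_tmap t : tmap p p t = 0 ->
  span [set t | exists a b, (p a = 0 \/ p b = 0) /\ t = a \ox b]%classic t.
Proof.
set K := [set t | _]%classic => ht; apply/cls0P.
have [s sK] := choice surj.
pose B0 (x y : B) := cls K (s x \ox s y).
have ker x y : cls K (s (p x) \ox s (p y)) = cls K (x \ox y).
  have step1 u v w : p u = p v -> cls K (u \ox w) = cls K (v \ox w).
    move=> uv; apply/cls_eqP; apply: Defs.sub_span; exists (u - v), w.
    split; first by left; rewrite linB // uv subrr.
    by rewrite (linB (f := fun u : A => u \ox w)); [|lin].
  have step2 u v w : p u = p v -> cls K (w \ox u) = cls K (w \ox v).
    move=> uv; apply/cls_eqP; apply: Defs.sub_span; exists w, (u - v).
    split; first by right; rewrite linB // uv subrr.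
    by rewrite (linB (f := tens w)); [|lin].
  by rewrite (step1 _ x) ?(step2 _ y).
have hB0 : bilin B0.
  split=> z c x y; have [[a <-] [b <-] [d <-]] := And3 (surj x) (surj y) (surj z).
    rewrite /B0 -hp !ker; have h : linear (fun a => cls K (d \ox a)) by lin.
    exact: h.
  rewrite /B0 -hp !ker; have h : linear (fun a => cls K (a \ox d)) by lin.
  exact: h.
have E : cls K t = tlift B0 (tmap p p t).
  move: (t); apply: eq_lin_tens => [||a b]; [by lin|by lin|].
  by rewrite tmap_tens // tlift_tens // /B0 ker.
by rewrite E ht lin0; [|lin].
Qed.

End SurjectiveMorphism.

Section QuotientBialgebra.
Context {k : fieldType} {A : bialg_sig k} (J : set A).
Hypotheses (hA : is_bialg A) (hJ : is_ideal J).
Local Notation AJ := (quot_bialg J).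
Let hm : bilin (@bmul k A). Proof. exact: alg_bilin (bialg_alg hA). Qed.

Lemma cls_surj (x : quotv J) : exists a, cls J a = x.
Proof. by exists (rep x); apply: repK. Qed.

Lemma cls_alg_hom : @alg_hom k A AJ (cls J).
Proof.
split=> [||a b]; [exact: cls_linear|by []|].
by rewrite quot_mulE.
Qed.

Lemma quot_alg : is_alg AJ.
Proof.
apply: (@surj_alg k A AJ (cls J)); first exact: cls_surj.
  exact: bialg_alg.
exact: cls_alg_hom.
Qed.

(** The coideal condition is phrased as a vanishing in A/J ⊗ A/J, which propagates from generators
    of an ideal more easily than membership in a span; [coideal_span] converts back. *)
Hypothesis hJD : forall x, J x -> tmap (cls J) (cls J) (bcomul x) = 0.
Hypothesis hJe : forall x, J x -> eps x = 0.

Lemma cls_coalg_hom : @coalg_hom k A AJ (cls J).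
Proof.
have hc := bialg_coalg hA.
have hr a : J (rep (cls J a) - a) by apply/(ideal_cls_eq _ _ hJ); rewrite repK.
split=> a.
  apply/eqP; rewrite -subr_eq0 /=.
  have h : linear (fun a => tmap (cls J) (cls J) (bcomul a)) by lin.
  by rewrite -(linB _ _ h) hJD.
apply/eqP; rewrite -subr_eq0; apply/eqP.
have h : linear (@eps k A : A -> klm k) by lin.
by have := hJe (hr a); rewrite (linB _ _ h).
Qed.

Lemma quot_is_bialg : is_bialg AJ.
Proof.
apply: (@surj_bialg k A AJ (cls J)); first exact: cls_surj.
- exact: cls_linear.
- exact: hA.
- exact: cls_alg_hom.
- exact: cls_coalg_hom.
Qed.

End QuotientBialgebra.

Section GeneratedCoideal.
Context {k : fieldType} {A : bialg_sig k} (S : set A) (hA : is_bialg A).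
Local Notation J := (ideal_gen S).

Lemma ideal_gen_coideal :
  (forall x, S x -> tmap (cls J) (cls J) (bcomul x) = 0) ->
  forall x, J x -> tmap (cls J) (cls J) (bcomul x) = 0.
Proof.
have hJ := ideal_gen_ideal S; have hc := bialg_coalg hA.
have hm := alg_bilin (quot_alg hA hJ); have hmA := alg_bilin (bialg_alg hA).
have hb c : linear (@bmul _ (quot_bialg J) c) by exact: hm.1.
have hb' c : linear (fun u => @bmul _ (quot_bialg J) u c) by exact: hm.2.
have h : linear (fun a => tmap (cls J) (cls J) (bcomul a)) by lin.
move=> hS x; refine (@ideal_gen_min _ _ S
  [set x | tmap (cls J) (cls J) (bcomul x) = 0]%classic x _ hS).
split; first exact: (subspace_eq h (@lin_zero _ _ _)).
move=> a y /= hy; rewrite !sw_tmap; split.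
  rewrite (sw_mul hA); last by lin.
  rewrite -[RHS](sw0 _ a); apply: eq_sw => a1 a2.
  (* Multiplication by the classes of [a1] and [a2] is a linear operator on A/J ⊗ A/J, so it maps
     the vanishing image of the coproduct of [y] to zero. *)
  pose L := tmap (@bmul _ (quot_bialg J) (cls J a1)) (@bmul _ (quot_bialg J) (cls J a2)).
  have hL : linear L by exact: lin_tmap (hb _) (hb _).
  rewrite -(lin0 hL) -hy sw_tmap (sw_comp _ _ hL); apply: eq_sw => y1 y2.
  by rewrite /L (tmap_tens _ _ (hb _) (hb _)) !(quot_mulE _ _ hmA hJ).
rewrite (sw_mul hA); last by lin.
rewrite [LHS]sw_exch -[RHS](sw0 _ a); apply: eq_sw => a1 a2.
pose L := tmap (fun u => @bmul _ (quot_bialg J) u (cls J a1))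
  (fun u => @bmul _ (quot_bialg J) u (cls J a2)).
have hL : linear L by exact: lin_tmap (hb' _) (hb' _).
rewrite -(lin0 hL) -hy sw_tmap (sw_comp _ _ hL); apply: eq_sw => y1 y2.
by rewrite /L (tmap_tens _ _ (hb' _) (hb' _)) !(quot_mulE _ _ hmA hJ).
Qed.

Lemma ideal_gen_counit :
  (forall x, S x -> eps x = 0) -> forall x, J x -> eps x = 0.
Proof.
move=> hS x; have hc := bialg_coalg hA.
refine (@ideal_gen_min _ _ S [set x | eps x = 0]%classic x _ hS).
have h : linear (@eps k A : A -> klm k) by lin.
split; first exact: (subspace_eq h (@lin_zero _ _ (klm k))).
by move=> a y hy; split; rewrite /= (epsM hA) hy ?mulr0 ?mul0r.
Qed.

Lemma ideal_gen_antipode (T : A -> A) : is_antipode T ->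
  (forall x, S x -> J (T x)) -> forall x, J x -> J (T x).
Proof.
move=> hT hS x; have hJ := ideal_gen_ideal S; have lT := lin_antipode hT.
refine (@ideal_gen_min _ _ S [set x | J (T x)]%classic x _ hS).
split; last first.
  by move=> a y /= hy; rewrite !(antipodeM hA hT); have [] := hJ.2 (T a) _ hy.
split=> [|a u v /= hu hv]; rewrite /= ?(lin0 lT) ?lT.
  exact: hJ.1.1.
exact: hJ.1.2.
Qed.

End GeneratedCoideal.

Lemma coideal_span {k : fieldType} (A : bialg_sig k) (J : set A) (t : tensor A A) :
  is_ideal J -> tmap (cls J) (cls J) t = 0 ->
  span [set t | exists a b, (J a \/ J b) /\ t = a \ox b]%classic t.
Proof.
move=> hJ ht.
have := @ker_tmap k A (quot_bialg J) (cls J) (@cls_surj k A J) (@cls_linear _ _ J) t ht.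
set K := [set t | _]%classic; set K' := [set t | _]%classic.
suff -> : K = K' by [].
apply/seteqP; split=> _ [a [b [h ->]]]; exists a, b; split=> //.
  by case: h => /ideal_cls0; [left|right]; auto.
by case: h => /ideal_cls0; [left|right]; auto.
Qed.

(** * Bosonization *)

Section SmashProduct.
Context {k : fieldType} {G : zmodType} {R : bialg_sig k} {Y : yd_sig G R}.
Local Notation H := (bosonization Y).
Local Notation "a # g" := (smash Y a g) (at level 39).

Lemma eq_lin_smash (W : lmodType k) (f g : H -> W) : linear f -> linear g ->
  (forall a h, f (a # h) = g (a # h)) -> forall t, f t = g t.
Proof.
move=> hf hg fg; refine (eq_lin_tens hf hg _) => a; refine (eq_lin_malg _ _ _) => //.
- by apply: (lin_comp hf); apply: lin_bil; apply: bilin_tens.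
- by apply: (lin_comp hg); apply: lin_bil; apply: bilin_tens.
- by move=> h; apply: fg.
Qed.

Hypothesis hR : is_alg R.
Hypothesis act_lin : forall g, linear (yact Y g).
Let hm : bilin (@bmul k R). Proof. exact: alg_bilin. Qed.

Lemma smash_bilin : bilin (@bmul k H).
Proof.
split=> x; first by apply: lin_tliftb => a u; lin.
by apply: tlift_linear; lin.
Qed.

Lemma smash_mul a g b h : bmul (a # g) (b # h) = bmul a (yact Y g b) # (g + h).
Proof.
rewrite /= tlift_tens; last by lin.
rewrite tlift_tens; last by lin.
by rewrite !mliftU.
Qed.

Lemma smash_one : bone H = bone R # 0. Proof. by []. Qed.

Hypothesis act0 : forall a, yact Y 0 a = a.
Hypothesis actD : forall g h a, yact Y (g + h) a = yact Y g (yact Y h a).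
Hypothesis actM : forall g a b,
  yact Y g (bmul a b) = bmul (yact Y g a) (yact Y g b).
Hypothesis act1 : forall g, yact Y g (bone R) = bone R.

(** Stated for a module algebra alone, so that it covers both the pre-Nichols algebras and the
    tensor algebra. *)
Lemma smash_alg : is_alg H.
Proof.
have hb := smash_bilin; case: (hR) => _ mA m1 mr1.
split; [exact: hb|move=> x y z|move=> x|move=> x].
- move: x; refine (eq_lin_smash _ _ _) => [||a g]; [by lin|by lin|].
  move: y; refine (eq_lin_smash _ _ _) => [||b h]; [by lin|by lin|].
  move: z; refine (eq_lin_smash _ _ _) => [||c u]; [by lin|by lin|].
  rewrite -> !smash_mul; congr smash; last exact: addrA.
  by rewrite actM actD mA.
- move: x; refine (eq_lin_smash _ _ _) => [||a g]; [by lin|by lin|].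
  rewrite -> smash_one, smash_mul; congr smash; last exact: add0r.
  by rewrite act0 m1.
- move: x; refine (eq_lin_smash _ _ _) => [||a g]; [by lin|by lin|].
  rewrite -> smash_one, smash_mul; congr smash; last exact: addr0.
  by rewrite act1 mr1.
Qed.

End SmashProduct.

Section BraidedProduct.
Context {k : fieldType} {G : zmodType} {R : lmodType k} {Y : yd_sig G R}.
Hypothesis act_lin : forall g, linear (yact Y g).
Hypothesis hg : is_grading (ycomp Y).
Variable mu : R -> R -> R.
Hypothesis hmu : bilin mu.
Local Notation c := (ycomp Y).

Lemma braidingE t :
  braiding Y Y t = tlift (fun v w => gsum c (fun g x => yact Y g w \ox x) v) t.
Proof. by []. Qed.

Lemma lin_braiding : linear (braiding Y Y).
Proof. by apply: tlift_linear; apply: (_ : bilin (fun v w => gsum c (fun g x => yact Y g w \ox x) v)); lin. Qed.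

Lemma braiding_homog d v w : homog c d v -> braiding Y Y (v \ox w) = yact Y d w \ox v.
Proof.
move=> hv; rewrite braidingE tlift_tens; last by lin.
by rewrite (gsum_homog hg _ hv) //; lin.
Qed.

Lemma braided_bilin : bilin (braided_tprod Y mu).
Proof.
have hb := lin_braiding.
split=> x; first by apply: lin_tliftb => a u; lin.
by apply: tlift_linear; lin.
Qed.

Lemma braided_tprodE d a b a' b' : homog c d b ->
  braided_tprod Y mu (a \ox b) (a' \ox b') = mu a (yact Y d a') \ox mu b b'.
Proof.
have hb := lin_braiding => hd; rewrite /braided_tprod tlift_tens; last by lin.
rewrite tlift_tens; last by lin.
by rewrite (braiding_homog _ hd) tlift_tens; [|lin].
Qed.

Lemma eq_lin_tens_homog (W : lmodType k) (f g : tensor R R -> W) :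
  linear f -> linear g ->
  (forall d a b, homog c d b -> f (a \ox b) = g (a \ox b)) -> f =1 g.
Proof.
move=> hf hg' fg; refine (eq_lin_tens hf hg' _) => a; refine (eq_lin_homog hg _ _ _).
- by lin.
- by lin.
- by move=> d b; apply: fg.
Qed.

End BraidedProduct.

Section BosonizationCoproduct.
Context {k : fieldType} {G : zmodType} {R : bialg_sig k} {Y : yd_sig G R}.
Local Notation H := (bosonization Y).
Local Notation c := (ycomp Y).
Local Notation "a # g" := (smash Y a g) (at level 39).
Hypothesis hD : linear (@bcomul k R).
Hypothesis hg : is_grading c.

Lemma bos_comulE (a : R) g :
  @bcomul k H (a # g)
  = \sw_(x, y <- a) gsum c (fun h y => (x # (h + g)) \ox (y # g)) y.
Proof.
transitivity (tlift (fun a : R => @mlift k G _ (fun g =>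
   \sw_(x, y <- a) gsum c (fun h y => (x # (h + g)) \ox (y # g)) y)) (a \ox << g >> : tensor R {malg k[G]})) => //.
rewrite tlift_tens; last by lin.
by rewrite mliftU.
Qed.

Lemma lin_bos_comul : linear (@bcomul k H).
Proof.
suff : linear (tlift (fun a : R => @mlift k G _ (fun g =>
   \sw_(x, y <- a) gsum c (fun h y => (x # (h + g)) \ox (y # g)) y)) : tensor R {malg k[G]} -> tensor H H) by [].
by lin.
Qed.

Lemma sw_bos (W : lmodType k) (f : H -> H -> W) a g : bilin f ->
  sweedler f (a # g)
  = \sw_(x, y <- a) gsum c (fun h y => f (x # (h + g)) (y # g)) y.
Proof.
move=> hf; have hT := tlift_linear hf.
rewrite /(@sweedler _ H) bos_comulE (sw_comp _ _ hT); apply: eq_sw => x y.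
rewrite (gsum_comp _ hg hT); last by lin.
by congr gsum; apply/funext => h; apply/funext => z; rewrite tlift_tens.
Qed.

End BosonizationCoproduct.

Section Bosonization.
Context {k : fieldType} {G : zmodType} {R : bialg_sig k} {Y : yd_sig G R}.
Hypothesis hR : is_braided_bialg Y.
Local Notation H := (bosonization Y).
Local Notation c := (ycomp Y).
Local Notation "a # g" := (smash Y a g) (at level 39).

Lemma bb_alg : is_alg R. Proof. by case: hR => -[]. Qed.
Lemma bb_coalg : is_coalg R. Proof. by case: hR => -[]. Qed.
Lemma bb_grading : is_grading c. Proof. by case: hR => -[[]]. Qed.
Lemma bb_act_lin g : linear (yact Y g). Proof. by case: hR => -[[h]]. Qed.
Lemma bb_act0 a : yact Y 0 a = a. Proof. by case: hR => -[[_ h']]. Qed.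
Lemma bb_actD g h a : yact Y (g + h) a = yact Y g (yact Y h a).
Proof. by case: hR => -[[_ _ h']]. Qed.
Lemma bb_act_homog g d a : homog c d a -> homog c d (yact Y g a).
Proof. by case: hR => -[[_ _ _ _ h]] _ _ _ _; apply: h. Qed.

Let hm := alg_bilin bb_alg.
Let hg := bb_grading.
Let hl := bb_act_lin.
Let hD := coalg_comul bb_coalg.
Let he := coalg_counit bb_coalg.

Lemma bb_actM g a b : yact Y g (bmul a b) = bmul (yact Y g a) (yact Y g b).
Proof.
case: hR => _ [[[_ h _] _ _ _] _]; have : tlift (@bmul k R) (tmap (yact Y g) (yact Y g) (a \ox b))
  = yact Y g (tlift (@bmul k R) (a \ox b)) by exact: h.
rewrite tmap_tens; [|exact: hl|exact: hl].
by rewrite !tlift_tens.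
Qed.

Lemma bb_act1 g : yact Y g (bone R) = bone R.
Proof. by case: hR => _ [[_ [_ h _] _ _] _]; have := h g 1; rewrite /= !scale1r. Qed.

Lemma bb_one_homog : homog c 0 (bone R).
Proof.
case: hR => _ [[_ [_ _ h] _ _] _]; have := h 0 1; rewrite scale1r; apply.
by rewrite /homog /= eqxx.
Qed.

Lemma bb_mul_homog d e a b : homog c d a -> homog c e b -> homog c (d + e) (bmul a b).
Proof.
move=> ha hb; case: hR => _ [[[_ _ h] _ _ _] _].
have := h (d + e) (a \ox b); rewrite tlift_tens //; apply.
rewrite /homog /=.
have hB : bilin (fun v w => gsum c (fun h v => v \ox c (d + e - h) w) v).
  have hc := grading_lin hg; split=> x; last by lin.
  apply: lin_gsumb; [exact: hg| |] => *; lin.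
rewrite -[LHS]/(tlift (fun v w => gsum c (fun h v => v \ox c (d + e - h) w) v) (a \ox b)).
rewrite tlift_tens // (gsum_homog hg _ ha); last by lin.
by rewrite [d + e]addrC addrK hb.
Qed.

Lemma bb_counit_act g a : eps (yact Y g a) = eps a.
Proof. by case: hR => _ [[_ _ _ [_ h _]] _]; apply: h. Qed.

Lemma bb_counit_homog d a : homog c d a -> d != 0 -> eps a = 0.
Proof.
case: hR => _ [[_ _ _ [_ _ h]] _] /h; rewrite /homog /= => {h} + d0.
by rewrite (negPf d0).
Qed.

Lemma bb_comul_act g a : bcomul (yact Y g a) = tmap (yact Y g) (yact Y g) (bcomul a).
Proof. by case: hR => _ [[_ _ [_ h _] _] _]; apply: h. Qed.

Lemma bb_comulM a b :
  bcomul (bmul a b) = braided_tprod Y (@bmul k R) (bcomul a) (bcomul b).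
Proof. by case: hR => _ [_ []]. Qed.

Lemma bb_counitM (a b : R) : eps (bmul a b) = eps a * eps b.
Proof. by case: hR => -[_ _ _ [_ h]] _; apply: h. Qed.

Lemma bb_counit1 : eps (bone R) = 1.
Proof. by case: hR => -[_ _ _ [h _]]. Qed.

Lemma bb_comul1 : bcomul (bone R) = bone R \ox bone R.
Proof. by case: hR => _ [_ []]. Qed.

(** The coproduct is a morphism of graded objects, so the coproduct of an element of degree [h] is a
    sum of tensors whose degrees add up to [h], and it suffices to compare the maps on those. *)
Lemma eq_sw_homog (W : lmodType k) (f f' : R -> R -> W) h a :
  homog c h a -> bilin f -> bilin f' ->
  (forall d x y, homog c (h - d) x -> homog c d y -> f x y = f' x y) ->
  sweedler f a = sweedler f' a.
Proof.
move=> ha hf hf' ff; case: hR => _ [[_ _ [_ _ hh] _] _].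
have hB : bilin (fun v w => gsum c (fun d v => v \ox c (h - d) w) v).
  have hc := grading_lin hg; split=> x; last by lin.
  apply: lin_gsumb; [exact: hg| |] => *; lin.
have E : tlift (fun v w => gsum c (fun d v => v \ox c (h - d) w) v) (bcomul a) = bcomul a.
  exact: hh _ _ ha.
have hc := grading_lin hg.
rewrite /sweedler -E !tlift_comp; [|exact: tlift_linear|exact: tlift_linear].
apply: eq_tlift => v w; rewrite !(gsum_comp _ hg); try by lin; try by apply: tlift_linear.
have [A [hA _]] := grading_support hg v.
rewrite !(gsum_support (A := A)) //; try by lin.
apply: eq_bigr => d _; rewrite !tlift_tens //.
apply: (ff (h - d)); last exact: grading_homog.
by rewrite opprB addrC subrK; apply: grading_homog.
Qed.

Lemma smash_comulE (a : R) g :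
  @bcomul k H (a # g)
  = \sw_(x, y <- a) gsum c (fun h y => (x # (h + g)) \ox (y # g)) y.
Proof. exact: (bos_comulE hD hg). Qed.

Lemma smash_counitE (a : R) g : @eps k H (a # g) = eps a.
Proof.
have h : bilin (fun a : R => @mlift k G (klm k) (fun _ : G => eps a)) by lin.
exact: etrans (tlift_tens h a << g >>) (mliftU _ _).
Qed.

Lemma lin_smash_comul : linear (@bcomul k H).
Proof. exact: (lin_bos_comul hD hg). Qed.

Lemma lin_smash_counit : linear (@eps k H : H -> klm k).
Proof.
have h : bilin (fun a : R => @mlift k G (klm k) (fun _ : G => eps a)) by lin.
exact: tlift_linear h.
Qed.

Lemma sw_smash (W : lmodType k) (f : H -> H -> W) a g : bilin f ->
  sweedler f (a # g)
  = \sw_(x, y <- a) gsum c (fun h y => f (x # (h + g)) (y # g)) y.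
Proof. exact: sw_bos. Qed.

Lemma smash_coalg : is_coalg H.
Proof.
have hDH := lin_smash_comul; have heH := lin_smash_counit.
apply: (coalgI hDH heH).
- refine (eq_lin_smash _ _ _) => [||a g]; [by lin|by lin|].
  rewrite [LHS]sw_smash; last by lin.
  rewrite [RHS]sw_smash; last by lin.
  pose F (x y z : R) := gsum c (fun h z => gsum c (fun h' y =>
    (x # (h' + (h + g))) \ox ((y # (h + g)) \ox (z # g))) y) z.
  have hF : trilin F.
    rewrite /F; split=> [x|y z]; last by lin.
    split=> [y|z]; first by lin.
    apply: lin_gsumb; [exact: hg| |] => *; lin.
  case: (hF) => hF1 hF2.
  transitivity (\sw_(x, y, z <- a) F x y z).
    rewrite -(sw_assoc bb_coalg _ hF); apply: eq_sw => d z.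
    transitivity (gsum c (fun h z => \sw_(x, y <- d) gsum c (fun h' y =>
      (x # (h' + (h + g))) \ox ((y # (h + g)) \ox (z # g))) y) z).
      congr gsum; apply/funext => h; apply/funext => {}z.
      by rewrite [LHS]sw_smash; [|lin].
    rewrite /sweedler gsum_tlift //; by lin.
  apply: eq_sw => x z.
  have hz : linear (fun z => \sw_(y, z <- z) F x y z) by lin.
  move: z; apply: (eq_lin_homog hg) => [||d z hd]; [by exact: hz|by lin|].
  rewrite [RHS](gsum_homog hg _ hd); last by lin.
  rewrite [RHS]sw_smash; last by lin.
  apply: (eq_sw_homog hd) => [||e y u hy hu]; [by lin|by lin|].
  rewrite /F [LHS](gsum_homog hg _ hu); last by lin.
  rewrite [LHS](gsum_homog hg _ hy); last by lin.
  rewrite [RHS](gsum_homog hg _ hu); last by lin.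
  (* The group coordinate of the first leg is the sum of the degrees of the two other legs plus [g]
     under either bracketing; this additivity is all that coassociativity requires beyond that of
     [R]. *)
  have -> : d - e + (e + g) = d + g by rewrite addrA subrK.
  by [].
- refine (eq_lin_smash _ _ _) => [||a g]; [by lin|by lin|].
  rewrite [LHS]sw_smash; last by lin.
  have h1 : linear (fun a => a # g) by lin.
  rewrite -[RHS](sw_counitl bb_coalg a h1); apply: eq_sw => x.
  refine (eq_lin_homog hg _ _ _) => [||d y hy]; [by lin|by lin|].
  by rewrite (gsum_homog hg _ hy); [rewrite smash_counitE|lin].
- refine (eq_lin_smash _ _ _) => [||a g]; [by lin|by lin|].
  rewrite [LHS]sw_smash; last by lin.
  have h1 : linear (fun a => a # g) by lin.
  rewrite -[RHS](sw_counitr bb_coalg a h1); apply: eq_sw => x.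
  refine (eq_lin_homog hg _ _ _) => [||d y hy]; [by lin|by lin|].
  rewrite (gsum_homog hg _ hy); last by lin.
  rewrite smash_counitE; case: (eqVneq d 0) => [->|d0]; first by rewrite add0r.
  rewrite (bb_counit_homog hy d0); exact: etrans (scale0r _) (esym (scale0r _)).
Qed.

Lemma bos_alg : is_alg H.
Proof.
exact: (smash_alg bb_alg hl bb_act0 bb_actD bb_actM bb_act1).
Qed.

Lemma bos_mulE a g b h : bmul (a # g) (b # h) = bmul a (yact Y g b) # (g + h).
Proof. exact: (smash_mul bb_alg hl). Qed.

Let comul_at u : tensor R R -> tensor H H :=
  tlift (fun a b => gsum c (fun h b => (a # (h + u)) \ox (b # u)) b).

Lemma smash_bialg : is_bialg H.
Proof.
have hHb := alg_bilin bos_alg; have hbr := braided_bilin hl hg hm.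
have hDH := lin_smash_comul.
have hP u : linear (comul_at u) by rewrite /comul_at; lin.
have PE u d a b : homog c d b -> comul_at u (a \ox b) = (a # (d + u)) \ox (b # u).
  move=> hb; rewrite /comul_at tlift_tens; last by lin.
  by rewrite (gsum_homog hg _ hb); [|lin].
have CE a g : bcomul (a # g) = comul_at g (bcomul a) by exact: smash_comulE.
(* The braided product of R ⊗ R becomes the ordinary product of H ⊗ H: moving [a'] past [b] of
   degree [d] acts on [a'] by [d], exactly as commuting the group coordinate [d + g] of the first
   leg past [a'] does, once [g] has been accounted for by the action. *)
have PM g h s t :
    comul_at (g + h) (braided_tprod Y (@bmul k R) s (tmap (yact Y g) (yact Y g) t))
    = tprod (comul_at g s : tensor H H) (comul_at h t).
  have hT : bilin (@tprod k H H) by split=> x; rewrite /tprod; lin.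
  move: s; apply: (eq_lin_tens_homog hg) => [||d a b hb]; [by lin|by lin|].
  move: t; apply: (eq_lin_tens_homog hg) => [||e a' b' hb']; [by lin|by lin|].
  rewrite tmap_tens; [|exact: hl|exact: hl].
  rewrite (braided_tprodE hl hg hm _ _ _ hb).
  rewrite (PE _ _ _ _ hb) (PE _ _ _ _ hb').
  rewrite (PE _ _ _ _ (bb_mul_homog hb (bb_act_homog g hb'))).
  rewrite /tprod tlift_tens; last by lin.
  rewrite tlift_tens; last by lin.
  rewrite -> !bos_mulE; rewrite (bb_actD d g a').
  have -> : d + e + (g + h) = d + g + (e + h) by rewrite addrACA.
  by [].
split.
- exact: bos_alg.
- exact: smash_coalg.
- split; first exact: etrans (smash_counitE _ _) bb_counit1.
  move=> x y; rewrite -[LHS]/(eps _) -[RHS]/(eps x * eps y).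
  have h1 := lin_smash_counit.
  move: x; refine (eq_lin_smash (W := klm k) _ _ _) => [||a g]; [by lin|by lin|].
  move: y; refine (eq_lin_smash (W := klm k) _ _ _) => [||b h]; [by lin|by lin|].
  by rewrite -> bos_mulE, !smash_counitE, bb_counitM, bb_counit_act.
- rewrite smash_one CE.
  by rewrite bb_comul1 (PE _ _ _ _ bb_one_homog) (addr0 0).
- move=> x y.
  have hT : bilin (@tprod k H H) by split=> u; rewrite /tprod; lin.
  move: x; refine (eq_lin_smash _ _ _) => [||a g]; [by lin|by lin|].
  move: y; refine (eq_lin_smash _ _ _) => [||b h]; [by lin|by lin|].
  rewrite -> bos_mulE, !CE; rewrite bb_comulM bb_comul_act.
  exact: PM.
Qed.

End Bosonization.

(** * Antipodes of connected graded braided bialgebras and of bosonizations *)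

Section GradedRecursion.
Context {k : fieldType} {V W : lmodType k} {nu : nat -> V -> V}.
Hypothesis hnu : is_grading nu.

(* The recursion only consults lower degrees, so iterating it stabilizes in each
   degree. *)
Lemma graded_fixpoint (T : (V -> W) -> V -> W) (e : V -> W) : linear e ->
  (forall g, linear g -> linear (T g)) ->
  (forall m a g g', homog nu m a -> linear g -> linear g' ->
    (forall i b, (i < m)%N -> homog nu i b -> g b = g' b) -> T g a = T g' a) ->
  exists2 s, linear s & forall a, s a = e a - T s a.
Proof.
move=> he hT hP.
pose r := fix r n : V -> W := if n is n'.+1 then fun a => e a - T (r n') a else fun=> 0.
have hr n : linear (r n).
  elim: n => [|n ih] /=; first exact: lin_zero.
  have := hT _ ih => hTn; lin.
have r_stab n m a : (m < n)%N -> homog nu m a -> r n a = r m.+1 a.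
  have step N i b : (i < N)%N -> homog nu i b -> r N.+1 b = r N b.
    elim: N i b => // N ih i b iN hb; rewrite -[LHS]/(e b - T (r N.+1) b).
    rewrite -[RHS]/(e b - T (r N) b); congr (_ - _); apply: (hP i) => // j d ji hd.
    by apply: (ih j) => //; apply: leq_trans ji _.
  elim: n => // n ih; rewrite ltnS leq_eqVlt => /predU1P[-> //|mn] ha.
  by rewrite (step _ m) // ih.
pose s a := gsum nu (fun m a => r m.+1 a) a.
have hs : linear s by apply: lin_gsum.
have sE m a : homog nu m a -> s a = r m.+1 a by move=> ha; apply: gsum_homog ha.
exists s => // a.
have hTs := hT _ hs.
move: a; apply: (eq_lin_homog hnu) => [||m a ha]; [by []|by lin|].
rewrite (sE _ _ ha) /=; congr (_ - _); apply: (hP m) => // i b im hb.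
by rewrite (sE _ _ hb) (r_stab m i b im hb).
Qed.

End GradedRecursion.

Section Antipode.
Context {k : fieldType} {G : zmodType} {R : bialg_sig k} {Y : yd_sig G R}.
Context {nu : nat -> R -> R}.
Hypotheses (hR : is_braided_bialg Y) (hnu : is_graded_bialg Y nu).
Hypothesis conn : forall a, homog nu 0%N a -> exists c : k, a = c *: bone R.
Local Notation H := (bosonization Y).
Local Notation c := (ycomp Y).
Local Notation "a # g" := (smash Y a g) (at level 39).

Let hm := alg_bilin (bb_alg hR).
Let hg := bb_grading hR.
Let hl := bb_act_lin hR.
Let hD := coalg_comul (bb_coalg hR).
Let he := coalg_counit (bb_coalg hR).

Lemma pn_grading : is_grading nu. Proof. by case: hnu => -[]. Qed.

Lemma eq_sw_graded (W : lmodType k) (f f' : R -> R -> W) n a :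
  homog nu n a -> bilin f -> bilin f' ->
  (forall i x y, (i <= n)%N -> homog nu i x -> homog nu (n - i)%N y -> f x y = f' x y) ->
  sweedler f a = sweedler f' a.
Proof.
move=> ha hf hf' ff; case: hnu => _ [_ _ /(_ n a ha) hh _].
have hn := grading_lin pn_grading.
rewrite /sweedler -hh !tlift_comp; [|exact: tlift_linear|exact: tlift_linear].
apply: eq_tlift => v w; rewrite !lin_big; [|exact: tlift_linear|exact: tlift_linear].
apply: eq_bigr => i _; rewrite !tlift_tens //.
by apply: (ff i); [case: i|apply: grading_homog pn_grading _ _|apply: grading_homog pn_grading _ _].
Qed.

(** Split the identity as [e] + [v] with [e] the unit of convolution. Connectedness makes [v] vanish
    in degree 0, so the equations s = e - v * s and s = e - s * v consult lower degrees only and are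
    solvable by [graded_fixpoint]. Their solutions are a right and a left inverse of the identity,
    hence equal. *)
Lemma braided_antipode : exists s : R -> R, [/\ linear s,
  forall a, \sw_(x, y <- a) bmul (s x) y = eps a *: bone R
  & forall a, \sw_(x, y <- a) bmul x (s y) = eps a *: bone R].
Proof.
have hc := bb_coalg hR; have hA := bb_alg hR; case: (hA) => _ _ m1 mr1.
pose e (a : R) := eps a *: bone R.
have hle : linear e by rewrite /e; lin.
pose v (a : R) := a - e a.
have hv : linear v by rewrite /v; lin.
have v0 x : homog nu 0%N x -> v x = 0.
  move=> /conn[z ->]; rewrite (linZ _ _ hv) /v /e (bb_counit1 hR).
  by rewrite scale1r subrr scaler0.
have [r hr rE] : exists2 s : R -> R, linear s
    & forall a, s a = e a - \sw_(x, y <- a) bmul (v x) (s y).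
  apply: (graded_fixpoint pn_grading hle) => [g hg'|m a g g' ha hg1 hg2 gg]; first by lin.
  apply: (eq_sw_graded ha) => [||i x y im hx hy]; [by lin|by lin|].
  case: i => [|i] in im hx hy *.
    by rewrite (v0 _ hx) !(lin0 (f := fun u => bmul u _)) //; lin.
  by rewrite (gg _ _ _ hy) // ltn_subrL (leq_trans _ im).
have [l hll lE] : exists2 s : R -> R, linear s
    & forall a, s a = e a - \sw_(x, y <- a) bmul (s x) (v y).
  apply: (graded_fixpoint pn_grading hle) => [g hg'|m a g g' ha hg1 hg2 gg]; first by lin.
  apply: (eq_sw_graded ha) => [||i x y im hx hy]; [by lin|by lin|].
  move: im; rewrite leq_eqVlt => /predU1P[im|im].
    move: hy; rewrite im subnn => hy.
    by rewrite (v0 _ hy) !(lin0 (f := bmul _)) //; lin.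
  by rewrite (gg _ _ im hx).
have rr a : \sw_(x, y <- a) bmul x (r y) = eps a *: bone R.
  have E : \sw_(x, y <- a) bmul x (r y)
      = \sw_(x, y <- a) bmul (v x) (r y) + \sw_(x, y <- a) eps x *: r y.
    rewrite -[RHS]big_split; apply: eq_bigr => p _ /=; rewrite -scalerDr.
    congr (_ *: _); rewrite -[in LHS](subrK (e p.1) p.1) (linD (f := fun u => bmul u _)); last by lin.
    congr (_ + _); rewrite /e (linZ (f := fun u => bmul u _)); last by lin.
    by rewrite m1.
  by rewrite E (sw_counitl hc _ hr) rE addrC subrK.
have ll a : \sw_(x, y <- a) bmul (l x) y = eps a *: bone R.
  have E : \sw_(x, y <- a) bmul (l x) y
      = \sw_(x, y <- a) bmul (l x) (v y) + \sw_(x, y <- a) eps y *: l x.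
    rewrite -[RHS]big_split; apply: eq_bigr => p _ /=; rewrite -scalerDr.
    congr (_ *: _); rewrite -[in LHS](subrK (e p.2) p.2) (linD (f := bmul _)); last by lin.
    congr (_ + _); rewrite /e (linZ (f := bmul _)); last by lin.
    by rewrite mr1.
  by rewrite E (sw_counitr hc _ hll) lE addrC subrK.
exists l; split=> // a; rewrite -rr; apply: eq_sw => x y; congr bmul.
exact: (conv_unique hc hA hll (@lin_id _ _) hr).
Qed.

Lemma smash_antipode : exists S : H -> H, is_antipode S.
Proof.
have hB := smash_bialg hR; have hHm := alg_bilin (bialg_alg hB).
have hHc := bialg_coalg hB; have hHD := coalg_comul hHc; have hHe := coalg_counit hHc.
have hc := bb_coalg hR.
have [s [hs sl sr]] := braided_antipode.
(* The classical formula S(a # g) = (1 # (a_{-1} g)^{-1}) (s(a_0) # 1), written on homogeneous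
   [a]. *)
have [S hS SE] : exists2 S : H -> H, linear S & forall d a g, homog c d a ->
    S (a # g) = bmul (bone R # - (d + g)) (s a # 0).
  have h : bilin (fun a : R => @mlift k G H (fun g =>
    gsum c (fun h a => bmul (bone R # - (h + g)) (s a # 0)) a)) by lin.
  exists (tlift (fun a : R => @mlift k G H (fun g =>
    gsum c (fun h a => bmul (bone R # - (h + g)) (s a # 0)) a))).
    exact: tlift_linear h.
  move=> d a g ha; apply: etrans (tlift_tens h a << g >>) _; rewrite mliftU.
  by rewrite (gsum_homog hg _ ha); [|lin].
have bmE := bos_mulE hR.
have [_ _ m1 mr1] := bb_alg hR.
exists S; split; first exact: hS.
- move=> x; rewrite -[bcounit x]/(eps x); move: x.
  refine (eq_lin_smash _ _ _) => [||a g]; [by lin|by lin|].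
  have h1 : linear (fun a => a # g) by lin.
  rewrite [LHS](sw_smash hR); last by lin.
  rewrite (smash_counitE hR); move: a.
  apply: (eq_lin_homog hg) => [||d a ha]; [by lin|by lin|].
  transitivity (\sw_(x, y <- a) bmul (bone R # - (d + g)) (bmul (s x) y # g)).
    apply: (eq_sw_homog hR ha) => [||h x y hx hy]; [by lin|by lin|].
    rewrite (gsum_homog hg _ hy); last by lin.
    rewrite (SE _ _ _ hx) -(bmulA hB).
    rewrite -> (bmE (s x)); rewrite add0r (bb_act0 hR).
    by rewrite addrA subrK.
  have hL : linear (fun u : R => bmul (bone R # - (d + g)) (u # g)) by lin.
  rewrite -(sw_comp _ _ hL) sl (linZ _ _ hL).
  case: (eqVneq d 0) ha => [->|d0] ha.
    congr (_ *: _); rewrite -> bmE; rewrite (bb_act1 hR) m1 add0r addNr.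
    by [].
  rewrite (bb_counit_homog hR ha d0); exact: etrans (scale0r _) (esym (scale0r _)).
- move=> x; rewrite -[bcounit x]/(eps x); move: x.
  refine (eq_lin_smash _ _ _) => [||a g]; [by lin|by lin|].
  have h1 : linear (fun a => a # 0) by lin.
  rewrite [LHS](sw_smash hR); last by lin.
  rewrite (smash_counitE hR).
  transitivity (\sw_(x, y <- a) (bmul x (s y) # 0)).
    apply: eq_sw => x; apply: (eq_lin_homog hg) => [||h y hy]; [by lin|by lin|].
    rewrite (gsum_homog hg _ hy); last by lin.
    rewrite (SE _ _ _ hy) (bmulA hB).
    rewrite -> (bmE x); rewrite (bb_act1 hR) mr1 subrr.
    by rewrite -> bmE; rewrite (bb_act0 hR) addr0.
  by rewrite -(sw_comp _ _ h1) sr (linZ _ _ h1).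
Qed.

End Antipode.

(** * The double of a skew pairing *)

Section TripleSweedler.
Context {k : fieldType}.

Lemma sw3_exch (A B : bialg_sig k) (W : lmodType k)
    (F : A -> A -> A -> B -> B -> B -> W) a b :
  (\sw_(x, y, z <- a) \sw_(u, v, w <- b) F x y z u v w)
  = \sw_(u, v, w <- b) \sw_(x, y, z <- a) F x y z u v w.
Proof.
rewrite /sweedler3.
transitivity (\sw_(x, d <- a) \sw_(u, e <- b) \sw_(v, w <- e) \sw_(y, z <- d) F x y z u v w).
  apply: eq_sw => x d; rewrite [LHS]sw_exch; apply: eq_sw => u e.
  exact: sw_exch.
rewrite [LHS]sw_exch; apply: eq_sw => u e.
exact: sw_exch.
Qed.

Lemma sw3_sw_exch (A B : bialg_sig k) (W : lmodType k)
    (F : A -> A -> A -> B -> B -> W) a b :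
  (\sw_(x, y, z <- a) \sw_(u, v <- b) F x y z u v)
  = \sw_(u, v <- b) \sw_(x, y, z <- a) F x y z u v.
Proof.
rewrite /sweedler3 [RHS]sw_exch; apply: eq_sw => x d.
exact: sw_exch.
Qed.

Lemma sw3_mul (A : bialg_sig k) (W : lmodType k) (f : A -> A -> A -> W) a b :
  is_bialg A -> trilin f ->
  sweedler3 f (bmul a b) = \sw_(x, y, z <- a) \sw_(u, v, w <- b)
    f (bmul x u) (bmul y v) (bmul z w).
Proof.
move=> hA [f1 f2]; have hD := coalg_comul (bialg_coalg hA).
rewrite /sweedler3 (sw_mul hA); last by lin.
apply: eq_sw => x d; rewrite [RHS]sw_exch; apply: eq_sw => u e.
by rewrite (sw_mul hA).
Qed.

Lemma sw3_one (A : bialg_sig k) (W : lmodType k) (f : A -> A -> A -> W) :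
  is_bialg A -> trilin f -> sweedler3 f (bone A) = f (bone A) (bone A) (bone A).
Proof.
move=> hA [f1 f2]; have hD := coalg_comul (bialg_coalg hA).
rewrite /sweedler3 (sw_one hA); last by lin.
by rewrite (sw_one hA).
Qed.

Lemma sw_counit2 (C : bialg_sig k) (W : lmodType k) (c : C) (w : W) : is_coalg C ->
  (\sw_(x, y <- c) eps (x : C) *: (eps (y : C) *: w)) = eps c *: w.
Proof.
by move=> hC; apply: (sw_counitl hC (f := fun c => eps c *: w)); lin.
Qed.

(* [k] with its algebra structure: target of the convolution of linear forms *)
Definition scalar_alg : bialg_sig k := {|
  bsort := klm k;
  bmul := fun x y => (x : k) * y;
  bone := (1 : k);
  bcomul := fun=> 0;
  bcounit := fun=> 0 |}.

Lemma scalar_is_alg : is_alg scalar_alg.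
Proof.
split=> [|x y z|x|x]; [split=> x c y z|exact: mulrA|exact: mul1r|exact: mulr1].
  by rewrite /= [LHS]mulrDr; congr (_ + _); exact: mulrCA.
by rewrite /= [LHS]mulrDl; congr (_ + _); rewrite -mulrA.
Qed.

End TripleSweedler.

(** * Convolution inverses of a skew pairing and of its cocycle *)

Section ConvolutionInverse.
Context {k : fieldType} {H : bialg_sig k} (hH : is_coalg H).
Implicit Types s t : tensor H H -> klm k.

Lemma convE s t u : linear s -> linear t -> conv s t u
  = @sweedler k (tensor_bialg H H) (klm k) (fun x y => (s x : k) * (t y : k)) u.
Proof.
move=> hs ht; have hHH := tensor_coalg hH hH; have hD := coalg_comul hH.
have hDD := coalg_comul hHH.
have hB : bilin (fun g h : H => \sw_(g1, g2 <- g) \sw_(h1, h2 <- h)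
  ((s (g1 \ox h1) : k) * (t (g2 \ox h2) : k) : klm k)) by lin.
have h1 : linear (tlift (fun g h : H => \sw_(g1, g2 <- g) \sw_(h1, h2 <- h)
  ((s (g1 \ox h1) : k) * (t (g2 \ox h2) : k) : klm k))) by exact: tlift_linear.
have hs' : linear (s : tensor_bialg H H -> klm k) by exact: hs.
have ht' : linear (t : tensor_bialg H H -> klm k) by exact: ht.
have hst : bilin (fun x y : tensor_bialg H H => (s x : k) * (t y : k) : klm k).
  by split=> x; [apply: lin_mulr|apply: lin_mull].
have h2 : linear (@sweedler k (tensor_bialg H H) (klm k) (fun x y => (s x : k) * (t y : k))).
  exact: (@lin_sweedlera k (tensor_bialg H H) (tensor_bialg H H) (klm k) _
    (fun x => x) hDD hst (@lin_id _ _)).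
transitivity (tlift (fun g h : H => \sw_(g1, g2 <- g) \sw_(h1, h2 <- h)
  ((s (g1 \ox h1) : k) * (t (g2 \ox h2) : k) : klm k)) u); first by [].
move: u; apply: (eq_lin_tens h1 h2) => g h.
by rewrite [LHS](tlift_tens hB) [RHS](sw_tens hH hH).
Qed.

(** [conv_inv] selects an inverse by choice. Uniqueness of convolution inverses, applied to maps
    into [scalar_alg], identifies the selected one with any explicit inverse. *)
Lemma conv_invE s t : linear s -> linear t ->
  conv s t =1 @conv_one k H -> conv t s =1 @conv_one k H -> conv_inv s = t.
Proof.
move=> hs ht st ts; rewrite /conv_inv.
have [r [hr sr rs]] : exists r : tensor H H -> k^o,
    [set t | [/\ linear t, conv s t =1 @conv_one k H & conv t s =1 @conv_one k H]]%classic r.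
  by exists t.
have uniq1 (r1 r2 : tensor H H -> klm k) : linear r1 -> linear r2 ->
    conv r1 s =1 @conv_one k H -> conv s r2 =1 @conv_one k H -> r1 =1 r2.
  move=> h1 h2 e1 e2.
  have one_eps u : @conv_one k H u = @eps k (tensor_bialg H H) u by [].
  apply: (@conv_unique k (tensor_bialg H H) (tensor_coalg hH hH) scalar_alg
    scalar_is_alg r1 s r2 h1 hs h2) => u.
    by rewrite -[RHS]/(eps u * 1) mulr1 -one_eps -e1 convE.
  by rewrite -[RHS]/(eps u * 1) mulr1 -one_eps -e2 convE.
set P := [set t | _]%classic.
have : P (xget (fun=> 0) P) by apply: xgetPex; exists t.
by move=> [h1 h2 h3]; apply/funext; apply: uniq1.
Qed.

End ConvolutionInverse.

Section SkewPairing.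
Context {k : fieldType} {A B : bialg_sig k} (hA : is_bialg A) (hB : is_bialg B).
Context {tau : tensor A B -> k^o} (htau : is_skew_pairing tau).
Context {S : A -> A} (hS : is_antipode S).

Definition spair (a : A) (x : B) : k := tau (a \ox x).
(* the convolution inverse of the pairing *)
Definition spair_inv (a : A) (x : B) : k := tau (S a \ox x).
Local Notation ta := spair.
Local Notation ti := spair_inv.

Let hmA := alg_bilin (bialg_alg hA).
Let hmB := alg_bilin (bialg_alg hB).
Let hcA := bialg_coalg hA.
Let hcB := bialg_coalg hB.
Let hDA := coalg_comul hcA.
Let hDB := coalg_comul hcB.
Let heA := coalg_counit hcA.
Let heB := coalg_counit hcB.
Let hlS := lin_antipode hS.

Lemma lin_tau : linear (tau : tensor A B -> klm k).
Proof. by case: htau. Qed.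

Lemma spair_bilin : bilin (ta : A -> B -> klm k).
Proof.
have h := lin_tau; split=> x; rewrite /ta.
  by apply: (@lin_comp _ _ _ (klm k) tau (tens x)); lin.
by apply: (@lin_comp _ _ _ (klm k) tau (fun a => a \ox x)); lin.
Qed.

Lemma spair_inv_bilin : bilin (ti : A -> B -> klm k).
Proof.
split=> x; first by apply: (spair_bilin.1 (S x)).
by apply: (@lin_comp _ _ _ (klm k) (fun a => ta a x) S); [apply: spair_bilin.2|].
Qed.

Let hta := spair_bilin.
Let hti := spair_inv_bilin.

Lemma spair1l x : ta (bone A) x = eps x. Proof. by case: htau => _ _ _ h _; exact: h. Qed.
Lemma spair1r a : ta a (bone B) = eps a. Proof. by case: htau => _ _ _ _ h; exact: h. Qed.

Lemma spairMl a b x :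
  ta (bmul a b) x = (\sw_(x1, x2 <- x) (ta a x1 * ta b x2 : klm k)) :> klm k.
Proof. by case: htau => _ h _ _ _; exact: h. Qed.

Lemma spairMr a x y :
  ta a (bmul x y) = (\sw_(a1, a2 <- a) (ta a1 y * ta a2 x : klm k)) :> klm k.
Proof. by case: htau => _ _ h _ _; exact: h. Qed.

Lemma scale_sw (C : bialg_sig k) (W : lmodType k) (f : C -> C -> k) c (w : W) :
  ((\sw_(x, y <- c) (f x y : klm k)) : k) *: w = \sw_(x, y <- c) f x y *: w.
Proof.
by apply: (sw_comp (V := klm k) _ _ (L := fun u : klm k => (u : k) *: w)); lin.
Qed.

Lemma spairMl_scale (W : lmodType k) a b x (w : W) :
  ta (bmul a b) x *: w = \sw_(x1, x2 <- x) (ta a x1 * ta b x2) *: w.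
Proof. by rewrite spairMl scale_sw. Qed.

Lemma spairMr_scale (W : lmodType k) a x y (w : W) :
  ta a (bmul x y) *: w = \sw_(a1, a2 <- a) (ta a1 y * ta a2 x) *: w.
Proof. by rewrite spairMr scale_sw. Qed.

Lemma spair_inv1l x : ti (bone A) x = eps x.
Proof. by rewrite /ti (antipode1 hA hS) -[tau _]/(ta _ _) spair1l. Qed.

Lemma spair_inv1r a : ti a (bone B) = eps a.
Proof.
rewrite -[ti _ _]/(ta (S a) _) spair1r.
have h : linear (fun a => eps (S a) : klm k) by lin.
have hs : (\sw_(a1, a2 <- a) (eps (S a1) * eps a2 : klm k)) = eps a :> klm k.
  transitivity (eps (eps a *: bone A)).
    rewrite -(sw_antipodel hS) (sw_comp (W := klm k) _ _ heA).
    by apply: eq_sw => x y; rewrite (epsM hA).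
  by rewrite (linZ (W := klm k) _ _ heA) (eps1 hA) [LHS]mulr1.
have : eps (S a) = \sw_(a1, a2 <- a) (eps (S a1) * eps a2 : klm k) :> klm k.
  rewrite -[LHS](sw_counitr hcA (W := klm k) a h).
  by apply: eq_sw => x y; exact: mulrC.
by rewrite hs.
Qed.

Lemma spair_invMl_scale (W : lmodType k) a b x (w : W) :
  ti (bmul a b) x *: w = \sw_(x1, x2 <- x) (ti b x1 * ti a x2) *: w.
Proof. by rewrite /ti (antipodeM hA hS) -[tau _]/(ta _ _) spairMl_scale. Qed.

(** Multiplicativity in the first argument contracts the sum to the pairing of a_1 S(a_2) with [x],
    and the antipode axiom finishes; [spairVK] is the mirror case. *)
Lemma spairK a x :
  (\sw_(a1, a2 <- a) \sw_(x1, x2 <- x) (ta a1 x1 * ti a2 x2 : klm k)) = eps a * eps x :> klm k.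
Proof.
transitivity (\sw_(a1, a2 <- a) (ta (bmul a1 (S a2)) x : klm k)).
  by apply: eq_sw => a1 a2; rewrite spairMl.
have hL : linear (fun a => ta a x : klm k) by lin.
rewrite -(sw_comp (W := klm k) _ _ hL) (sw_antipoder hS) (linZ _ _ hL) spair1l.
by [].
Qed.

Lemma spairVK a x :
  (\sw_(a1, a2 <- a) \sw_(x1, x2 <- x) (ti a1 x1 * ta a2 x2 : klm k)) = eps a * eps x :> klm k.
Proof.
transitivity (\sw_(a1, a2 <- a) (ta (bmul (S a1) a2) x : klm k)).
  by apply: eq_sw => a1 a2; rewrite spairMl.
have hL : linear (fun a => ta a x : klm k) by lin.
rewrite -(sw_comp (W := klm k) _ _ hL) (sw_antipodel hS) (linZ _ _ hL) spair1l.
by [].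
Qed.

(* Both sides are convolution inverse to [a, x, y |-> ta a (x y)]. *)
Lemma spair_invMr a x y :
  ti a (bmul x y) = (\sw_(a1, a2 <- a) (ti a1 x * ti a2 y : klm k)) :> klm k.
Proof.
have mul4 (p q r s : k) : (p * q) * (r * s) = (q * r) * (p * s).
  by rewrite [p * q]mulrC mulrACA.
pose C := tensor_bialg A (tensor_bialg B B).
have hBB := tensor_coalg hcB hcB; have hC : is_coalg C := tensor_coalg hcA hBB.
have trE (f : A -> B -> B -> klm k) : trilin f ->
    exists2 g : C -> klm k, linear g & forall a x y, g (a \ox (x \ox y)) = f a x y.
  move=> [f1 f2]; have h : bilin (fun (a : A) (t : tensor B B) => tlift (f a) t) by lin.
  exists (tlift (fun (a : A) (t : tensor B B) => tlift (f a) t)); first exact: tlift_linear.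
  by move=> a' x' y'; rewrite tlift_tens // tlift_tens.
have [f hf fE] := trE (fun a x y => ti a (bmul x y)) ltac:(lin).
have [g hg gE] := trE (fun a x y => ta a (bmul x y)) ltac:(lin).
have [h hh hE] := trE (fun a x y => \sw_(a1, a2 <- a) (ti a1 x * ti a2 y : klm k)) ltac:(lin).
rewrite -fE -hE.
have swC (u v : C -> klm k) (a0 : A) (x0 y0 : B) : linear u -> linear v ->
    @sweedler k C (klm k) (fun c d => (u c : k) * (v d : k)) (a0 \ox (x0 \ox y0))
    = \sw_(a1, a2 <- a0) \sw_(x1, x2 <- x0) \sw_(y1, y2 <- y0)
       ((u (a1 \ox (x1 \ox y1)) : k) * (v (a2 \ox (x2 \ox y2)) : k) : klm k).
  move=> hu hv.
  have hb : bilin (fun c d : C => (u c : k) * (v d : k) : klm k).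
    by split=> z; [apply: lin_mulr|apply: lin_mull].
  rewrite (sw_tens hcA hBB _ _ hb); apply: eq_sw => a1 a2.
  have hu' a' : linear (fun s : tensor_bialg B B => u (a' \ox s)).
    by apply: (lin_comp hu); exact: (tens_bilin A (tensor B B)).1.
  have hv' a' : linear (fun s : tensor_bialg B B => v (a' \ox s)).
    by apply: (lin_comp hv); exact: (tens_bilin A (tensor B B)).1.
  refine (@sw_tens k B B hcB hcB (klm k)
    (fun s t => (u (a1 \ox s) : k) * (v (a2 \ox t) : k)) x0 y0 _).
  by split=> z; [apply: lin_mulr|apply: lin_mull].
have ext (u v : C -> klm k) : linear u -> linear v ->
    (forall a x y, u (a \ox (x \ox y)) = v (a \ox (x \ox y))) -> forall c, u c = v c.
  move=> hu hv uv; refine (eq_lin_tensb hu hv _) => a' s.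
  have hu' : linear (fun s : tensor_bialg B B => u (a' \ox s)).
    by apply: (lin_comp hu); exact: (tens_bilin A (tensor B B)).1.
  have hv' : linear (fun s : tensor_bialg B B => v (a' \ox s)).
    by apply: (lin_comp hv); exact: (tens_bilin A (tensor B B)).1.
  by move: s; refine (eq_lin_tensb hu' hv' _) => x' y'.
have hDC := coalg_comul hC; have heC := coalg_counit hC.
have linC (u v : C -> klm k) : linear u -> linear v ->
    linear (@sweedler k C (klm k) (fun c d => (u c : k) * (v d : k))).
  move=> hu hv.
  have hb : bilin (fun c d : C => (u c : k) * (v d : k) : klm k).
    by split=> z; [apply: lin_mulr|apply: lin_mull].
  exact: (@lin_sweedlera k C C (klm k) _ (fun x => x) hDC hb (@lin_id _ _)).
have epsC (a0 : A) (x0 y0 : B) : @eps k C (a0 \ox (x0 \ox y0)) = eps a0 * (eps x0 * eps y0).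
  by rewrite (tensor_counitE hcA hBB) (tensor_counitE hcB hcB).
suff E : f =1 h by [].
apply: (@conv_unique k C hC scalar_alg scalar_is_alg f g h hf hg hh) => c.
- transitivity (eps c : klm k); last by rewrite -[RHS]/(eps c * 1) mulr1.
  move: c; refine (ext _ _ (linC _ _ hf hg) heC _) => a' x' y'.
  rewrite (swC _ _ _ _ _ hf hg) epsC -(epsM hB) -spairVK; apply: eq_sw => a1 a2.
  rewrite [RHS](sw_mul hB); last by lin.
  by apply: eq_sw => x1 x2; apply: eq_sw => y1 y2; rewrite fE gE.
- transitivity (eps c : klm k); last by rewrite -[RHS]/(eps c * 1) mulr1.
  move: c; refine (ext _ _ (linC _ _ hg hh) heC _) => {a x y} a x y.
  rewrite (swC _ _ _ _ _ hg hh) epsC.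
  pose F x1 x2 y1 y2 b1 b2 c1 c2 : klm k :=
    (ta b1 y1 * ta b2 x1) * (ti c1 x2 * ti c2 y2).
  transitivity (\sw_(a1, a2 <- a) \sw_(x1, x2 <- x) \sw_(y1, y2 <- y)
     \sw_(b1, b2 <- a1) \sw_(c1, c2 <- a2) F x1 x2 y1 y2 b1 b2 c1 c2).
    apply: eq_sw => a1 a2; apply: eq_sw => x1 x2; apply: eq_sw => y1 y2.
    rewrite gE hE -[LHS]/(_ *: _) [LHS]spairMr_scale; apply: eq_sw => b1 b2.
    by rewrite (sw_comp (W := klm k) _ _ (L := fun u : klm k => _ *: u)); [|lin].
  transitivity (\sw_(y1, y2 <- y) \sw_(x1, x2 <- x) \sw_(a1, a2 <- a)
     \sw_(b1, b2 <- a1) \sw_(c1, c2 <- a2) F x1 x2 y1 y2 b1 b2 c1 c2).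
    rewrite [LHS]sw_exch [RHS]sw_exch; apply: eq_sw => x1 x2; exact: sw_exch.
  transitivity (\sw_(y1, y2 <- y) \sw_(a1, a2 <- a) (eps x * (ta a1 y1 * ti a2 y2) : klm k)).
    apply: eq_sw => y1 y2.
    (* Grouping the four legs of [a] as b1 ⊗ (b2 ⊗ c1) ⊗ c2 brings [ta b2 x1] next to [ti c1 x2];
       these cancel by [spairK] and leave [ta b1 y1] and [ti c2 y2], which cancel in turn. *)
    transitivity (\sw_(x1, x2 <- x) \sw_(b1, d, c2 <- a) \sw_(b2, c1 <- d)
       F x1 x2 y1 y2 b1 b2 c1 c2).
      by apply: eq_sw => x1 x2; apply: (sw_nest hcA) => *; rewrite /F; lin.
    rewrite -[LHS]sw3_sw_exch /sweedler3; apply: eq_sw => b1 e.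
    have hti' : linear (fun e => eps x * (ta b1 y1 * ti e y2) : klm k) by lin.
    rewrite -[RHS](sw_counitl hcA _ hti'); apply: eq_sw => d c2.
    rewrite [LHS]sw_exch.
    transitivity ((eps d * eps x) *: (ta b1 y1 * ti c2 y2 : klm k)); last first.
      exact: esym (scalerA (eps d) (eps x) (ta b1 y1 * ti c2 y2 : klm k)).
    rewrite -spairK scale_sw; apply: eq_sw => b2 c1; rewrite scale_sw.
    apply: eq_sw => x1 x2; exact: mul4.
  rewrite [LHS]sw_exch.
  transitivity (eps x *: (\sw_(a1, a2 <- a) \sw_(y1, y2 <- y) (ta a1 y1 * ti a2 y2 : klm k))).
    rewrite (sw_comp (W := klm k) _ _ (L := fun u : klm k => _ *: u)); last by lin.
    apply: eq_sw => a1 a2.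
    by rewrite (sw_comp (W := klm k) _ _ (L := fun u : klm k => _ *: u)); last by lin.
  by rewrite spairK; exact: mulrCA.
Qed.

Lemma spair_invMr_scale (W : lmodType k) a x y (w : W) :
  ti a (bmul x y) *: w = \sw_(a1, a2 <- a) (ti a1 x * ti a2 y) *: w.
Proof. by rewrite spair_invMr scale_sw. Qed.

End SkewPairing.

Section PairingCocycle.
Context {k : fieldType} {A B : bialg_sig k} (hA : is_coalg A) (hB : is_coalg B).
Local Notation H := (tensor_bialg A B).

Let heA := coalg_counit hA.
Let heB := coalg_counit hB.
Let hDA := coalg_comul hA.
Let hDB := coalg_comul hB.

Lemma sw3_counit' (C : bialg_sig k) (W : lmodType k) (f : C -> W) c : is_coalg C ->
  linear f -> (\sw_(x, y, z <- c) eps x *: (eps z *: f y)) = f c.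
Proof.
move=> hC hf; rewrite -[RHS](sw3_counit hC c hf).
by apply: eq_sw3 => x y z; rewrite scalerA.
Qed.

Section Pairing.
Variables (p : tensor A B -> klm k) (hp : linear p).

Let hP1 (a : A) (x : B) : bilin (fun (b : A) (y : B) =>
  (eps a * (p (b \ox x) : k)) * eps y : klm k).
Proof.
have h : linear (fun b : A => p (b \ox x)) by apply: (lin_comp hp); lin.
by split=> z; [apply: lin_mulr|apply: lin_mull; apply: lin_mulr].
Qed.

Let P (s t : H) : klm k := tlift (fun (a : A) (x : B) => tlift (fun (b : A) (y : B) =>
  (eps a * (p (b \ox x) : k)) * eps y : klm k) t) s.

Let hP2 (t : tensor A B) : bilin (fun (a : A) (x : B) => tlift (fun (b : A) (y : B) =>
  (eps a * (p (b \ox x) : k)) * eps y : klm k) t).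
Proof.
split=> z; apply: lin_tliftb => b y; apply: lin_mull.
  apply: lin_mulr; apply: (lin_comp hp); lin.
by apply: lin_mull; lin.
Qed.

Let hP : bilin P.
Proof.
split=> t; last exact: (tlift_linear (hP2 _)).
by apply: lin_tliftb => a x; exact: (tlift_linear (hP1 _ _)).
Qed.

Lemma lin_pairing_cocycle : linear (pairing_cocycle p : _ -> klm k).
Proof. exact: (tlift_linear hP). Qed.

Lemma pairing_cocycleE (a : A) (x : B) (b : A) (y : B) :
  pairing_cocycle p ((a \ox x : H) \ox (b \ox y : H))
  = eps a *: (eps y *: p (b \ox x)) :> klm k.
Proof.
apply: etrans (tlift_tens hP _ _) _.
apply: etrans (tlift_tens (hP2 _) _ _) _.
apply: etrans (tlift_tens (hP1 _ _) _ _) _.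
rewrite -[LHS]/((eps a * (p (b \ox x) : k)) * eps y) -mulrA; congr (_ * _).
exact: mulrC.
Qed.

End Pairing.

(** The two outer variables enter such a cocycle through counits only, so their coproducts collapse
    and the convolution of cocycles reduces to that of the pairings. Used for τ and τ(S ⊗ id) in
    both orders. *)
Lemma pairing_cocycle_conv (p q : tensor A B -> klm k) :
  linear p -> linear q ->
  (forall a x, \sw_(a1, a2 <- a) \sw_(x1, x2 <- x)
     ((p (a1 \ox x1) : k) * (q (a2 \ox x2) : k) : klm k) = eps a * eps x :> klm k) ->
  conv (pairing_cocycle p) (pairing_cocycle q) =1 @conv_one k H.
Proof.
move=> hp hq pq u.
have hH := tensor_coalg hA hB; have hD := coalg_comul hH; have he := coalg_counit hH.
have lp := lin_pairing_cocycle hp; have lq := lin_pairing_cocycle hq.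
have hB1 : bilin (fun g h : H => \sw_(g1, g2 <- g) \sw_(h1, h2 <- h)
  ((pairing_cocycle p (g1 \ox h1) : k) * (pairing_cocycle q (g2 \ox h2) : k) : klm k)).
  have lp1 g : linear (fun h : H => pairing_cocycle p (g \ox h) : klm k).
    by apply: (lin_comp lp); exact: (tens_bilin H H).1.
  have lp2 g : linear (fun h : H => pairing_cocycle p (h \ox g) : klm k).
    by apply: (lin_comp lp); exact: (tens_bilin H H).2.
  have lq1 g : linear (fun h : H => pairing_cocycle q (g \ox h) : klm k).
    by apply: (lin_comp lq); exact: (tens_bilin H H).1.
  have lq2 g : linear (fun h : H => pairing_cocycle q (h \ox g) : klm k).
    by apply: (lin_comp lq); exact: (tens_bilin H H).2.
  split=> z; [apply: lin_sweedlerb => v w|];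
    apply: (@lin_sweedlera k H H (klm k) _ (fun x => x) hD _ (@lin_id _ _)).
    by split=> v'; [apply: lin_mulr|apply: lin_mull].
  by split=> v'; apply: lin_sweedlerb => ? ?; [apply: lin_mulr|apply: lin_mull].
have h1 : linear (tlift (fun g h : H => \sw_(g1, g2 <- g) \sw_(h1, h2 <- h)
  ((pairing_cocycle p (g1 \ox h1) : k) * (pairing_cocycle q (g2 \ox h2) : k) : klm k))).
  exact: tlift_linear.
have hee : bilin (fun g h : H => eps g * eps h : klm k) by lin.
have h2 : linear (@conv_one k H : _ -> klm k) by exact: (tlift_linear hee).
refine (eq_lin_tens h1 h2 _ u) => {u}; refine (_ : forall g h : H, _) => g h.
have hbl : bilin (fun g h : H => tlift (fun g h : H => \sw_(g1, g2 <- g) \sw_(h1, h2 <- h)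
  ((pairing_cocycle p (g1 \ox h1) : k) * (pairing_cocycle q (g2 \ox h2) : k) : klm k))
  (g \ox h)).
  by split=> z; apply: (lin_comp h1); [exact: (tens_bilin H H).1|exact: (tens_bilin H H).2].
have hbr : bilin (fun g h : H => (conv_one (g \ox h) : klm k)).
  by split=> z; apply: (lin_comp h2); [exact: (tens_bilin H H).1|exact: (tens_bilin H H).2].
move: g; refine (eq_lin_tensb (hbl.2 h) (hbr.2 h) _) => a x.
move: h; refine (eq_lin_tensb (hbl.1 (a \ox x)) (hbr.1 (a \ox x)) _) => b y.
have -> : conv_one ((a \ox x : H) \ox (b \ox y : H))
    = eps a *: (eps y *: (eps b * eps x : klm k)) :> klm k.
  apply: etrans (tlift_tens hee _ _) _.
  rewrite !(tensor_counitE hA hB) -[RHS]/(eps a * (eps y * (eps b * eps x))).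
  by rewrite -!mulrA; congr (_ * _); rewrite mulrC -mulrA mulrCA.
apply: etrans (tlift_tens hB1 _ _) _.
rewrite -(pq b x) -(sw_counit2 a _ hA).
have lp1 g : linear (fun h : H => pairing_cocycle p (g \ox h) : klm k).
  by apply: (lin_comp lp); exact: (tens_bilin H H).1.
have lp2 g : linear (fun h : H => pairing_cocycle p (h \ox g) : klm k).
  by apply: (lin_comp lp); exact: (tens_bilin H H).2.
have lq1 g : linear (fun h : H => pairing_cocycle q (g \ox h) : klm k).
  by apply: (lin_comp lq); exact: (tens_bilin H H).1.
have lq2 g : linear (fun h : H => pairing_cocycle q (h \ox g) : klm k).
  by apply: (lin_comp lq); exact: (tens_bilin H H).2.
rewrite (@sw_tens k A B hA hB (klm k) (fun g1 g2 : H => \sw_(h1, h2 <- (b \ox y : H))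
  ((pairing_cocycle p (g1 \ox h1) : k) * (pairing_cocycle q (g2 \ox h2) : k) : klm k))); last first.
  by split=> v'; apply: lin_sweedlerb => ? ?; [apply: lin_mulr|apply: lin_mull].
apply: eq_sw => a1 a2.
transitivity (\sw_(x1, x2 <- x) \sw_(b1, b2 <- b) \sw_(y1, y2 <- y)
   eps a1 *: (eps a2 *: (eps y1 *: (eps y2 *:
    ((p (b1 \ox x1) : k) * (q (b2 \ox x2) : k) : klm k))))).
  apply: eq_sw => x1 x2.
  rewrite (@sw_tens k A B hA hB (klm k) (fun h1 h2 : H =>
    ((pairing_cocycle p ((a1 \ox x1 : H) \ox h1) : k)
    * (pairing_cocycle q ((a2 \ox x2 : H) \ox h2) : k) : klm k))); last first.
    by split=> v'; [apply: lin_mulr|apply: lin_mull].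
  apply: eq_sw => b1 b2; apply: eq_sw => y1 y2.
  rewrite (pairing_cocycleE hp) (pairing_cocycleE hq) /GRing.scale /=.
  by rewrite -mulrA; congr (_ * _); rewrite mulrCA; congr (_ * _); rewrite mulrACA -mulrA.
pose L (w : klm k) : klm k := eps a1 *: (eps a2 *: (eps y *: w)).
have hL : linear L by rewrite /L; lin.
rewrite [LHS]sw_exch -[RHS]/(L _) (sw_comp _ _ hL); apply: eq_sw => b1 b2.
rewrite (sw_comp _ _ hL); apply: eq_sw => x1 x2; rewrite /L.
pose L' (w : klm k) : klm k := eps a1 *: (eps a2 *: w).
have hL' : linear L' by rewrite /L'; lin.
by rewrite -(sw_counit2 y _ hB) -[RHS]/(L' _) (sw_comp _ _ hL').
Qed.

End PairingCocycle.

Section DoubleProduct.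
Context {k : fieldType} {A B : bialg_sig k} (hA : is_bialg A) (hB : is_bialg B).
Context {tau : tensor A B -> k^o} (htau : is_skew_pairing tau).
Context {S : A -> A} (hS : is_antipode S).
Local Notation H := (tensor_bialg A B).
Local Notation D := (deformation (pairing_cocycle tau)).
Local Notation ta := (spair (tau := tau)).
Local Notation ti := (spair_inv (tau := tau) (S := S)).

Let hmA := alg_bilin (bialg_alg hA).
Let hmB := alg_bilin (bialg_alg hB).
Let hcA := bialg_coalg hA.
Let hcB := bialg_coalg hB.
Let hDA := coalg_comul hcA.
Let hDB := coalg_comul hcB.
Let heA := coalg_counit hcA.
Let heB := coalg_counit hcB.
Let hlS := lin_antipode hS.

Let tau' (u : tensor A B) : klm k := tau (tmap S id u).
Let tau'E (a : A) (x : B) : tau' (a \ox x) = ti a x.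
Proof. by rewrite /tau' tmap_tens; [|lin|lin]. Qed.
Let htau' : linear tau'.
Proof. by apply: (lin_comp (lin_tau htau)); apply: lin_tmap => //; lin. Qed.

Lemma double_conv_inv : conv_inv (pairing_cocycle tau) = pairing_cocycle tau'.
Proof.
have hH := tensor_coalg hcA hcB.
apply: (conv_invE hH).
- exact: (lin_pairing_cocycle hcA hcB (lin_tau htau)).
- exact: (lin_pairing_cocycle hcA hcB htau').
- apply: (pairing_cocycle_conv hcA hcB (lin_tau htau) htau') => a x.
  rewrite -(spairK htau hS); apply: eq_sw => a1 a2; apply: eq_sw => x1 x2.
  by rewrite tau'E.
- apply: (pairing_cocycle_conv hcA hcB htau' (lin_tau htau)) => a x.
  rewrite -(spairVK htau hS); apply: eq_sw => a1 a2; apply: eq_sw => x1 x2.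
  by rewrite tau'E.
Qed.

(** Since σ sees [a] and [y] through the counit alone, their threefold coproducts collapse and only
    the inner factors [b] and [x] remain split. *)
Lemma deformation_mulE (a : A) (x : B) (b : A) (y : B) :
  @bmul k D (a \ox x) (b \ox y)
  = \sw_(b1, b2, b3 <- b) \sw_(x1, x2, x3 <- x)
      (ta b1 x1 * ti b3 x3) *: (bmul a b2 \ox bmul x2 y).
Proof.
have hH := tensor_coalg hcA hcB; have hD := coalg_comul hH.
have lp := lin_pairing_cocycle hcA hcB (lin_tau htau).
have lq := lin_pairing_cocycle hcA hcB htau'.
have lp1 (g : H) : linear (fun h : H => pairing_cocycle tau (g \ox h) : klm k).
  by apply: (lin_comp lp); exact: (tens_bilin H H).1.
have lp2 (g : H) : linear (fun h : H => pairing_cocycle tau (h \ox g) : klm k).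
  by apply: (lin_comp lp); exact: (tens_bilin H H).2.
have lq1 (g : H) : linear (fun h : H => pairing_cocycle tau' (g \ox h) : klm k).
  by apply: (lin_comp lq); exact: (tens_bilin H H).1.
have lq2 (g : H) : linear (fun h : H => pairing_cocycle tau' (h \ox g) : klm k).
  by apply: (lin_comp lq); exact: (tens_bilin H H).2.
have hm : bilin (@bmul k H) by split=> t; rewrite /= /tprod; lin.
have mul6 (u v w x' y' z : k) : (u * v * w) * (x' * y' * z) = u * x' * v * y' * (w * z).
  by rewrite (mulrACA (u * v)) (mulrACA u) !mulrA.
pose F (g1 g2 g3 h1 h2 h3 : H) : H :=
  ((pairing_cocycle tau (g1 \ox h1) : k) * (pairing_cocycle tau' (g3 \ox h3) : k)) *: bmul g2 h2.
have mE (a1 b1 : A) (x1 y1 : B) : @bmul k H (a1 \ox x1) (b1 \ox y1)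
    = bmul a1 b1 \ox bmul x1 y1.
  rewrite /= /tprod tlift_tens; last by lin.
  by rewrite tlift_tens; [|lin].
transitivity (@sweedler3 k H H (fun g1 g2 g3 => @sweedler3 k H H (fun h1 h2 h3 =>
    F g1 g2 g3 h1 h2 h3) (b \ox y)) (a \ox x)).
  by rewrite /= double_conv_inv.
have hF6 g1 g2 g3 h1 h2 : linear (F g1 g2 g3 h1 h2).
  rewrite /F; apply: (lin_scalel (c := fun h3 : H => _)); exact: lin_mulr.
have hF5 g1 g2 g3 h1 h3 : linear (fun h2 => F g1 g2 g3 h1 h2 h3).
  by rewrite /F; apply: lin_scaler; exact: hm.1.
have hF4 g1 g2 g3 h2 h3 : linear (fun h1 => F g1 g2 g3 h1 h2 h3).
  rewrite /F; apply: (lin_scalel (c := fun h1 : H => _)); exact: lin_mull.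
have hF3 g1 g2 h1 h2 h3 : linear (fun g3 => F g1 g2 g3 h1 h2 h3).
  rewrite /F; apply: (lin_scalel (c := fun h3 : H => _)); exact: lin_mulr.
have hF2 g1 g3 h1 h2 h3 : linear (fun g2 => F g1 g2 g3 h1 h2 h3).
  by rewrite /F; apply: lin_scaler; exact: hm.2.
have hF1 g2 g3 h1 h2 h3 : linear (fun g1 => F g1 g2 g3 h1 h2 h3).
  rewrite /F; apply: (lin_scalel (c := fun h1 : H => _)); exact: lin_mull.
rewrite (sw3_tens hcA hcB); last first.
  split=> [g1|g2 g3]; last by lin.
  by split=> g2; lin.
pose G a2 b1 b2 b3 x1 x2 x3 y2 : H := (ta b1 x1 * ti b3 x3) *: (bmul a2 b2 \ox bmul x2 y2).
have hab : bilin (fun a b : A => bmul a b) by [].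
transitivity (\sw_(a1, a2, a3 <- a) \sw_(x1, x2, x3 <- x) \sw_(b1, b2, b3 <- b)
   \sw_(y1, y2, y3 <- y) (eps a1 *: (eps a3 *: (eps y1 *: (eps y3 *:
     G a2 b1 b2 b3 x1 x2 x3 y2))))).
  apply: eq_sw3 => a1 a2 a3; apply: eq_sw3 => x1 x2 x3.
  rewrite (sw3_tens hcA hcB); last first.
    split=> [h1|h2 h3]; last exact: hF4.
    by split=> h2; [exact: hF6|exact: hF5].
  apply: eq_sw3 => b1 b2 b3; apply: eq_sw3 => y1 y2 y3.
  rewrite /F (pairing_cocycleE hcA hcB (lin_tau htau)) (pairing_cocycleE hcA hcB htau') mE.
  rewrite tau'E /G !scalerA; congr (_ *: _); rewrite -[tau _]/(ta _ _) /GRing.scale /=.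
  exact: mul6.
rewrite [RHS]sw3_exch.
have hG : linear (fun a2 => \sw_(x1, x2, x3 <- x) \sw_(b1, b2, b3 <- b)
    G a2 b1 b2 b3 x1 x2 x3 y) by rewrite /G; lin.
rewrite -[RHS](sw3_counit' a hcA hG); apply: eq_sw3 => a1 a2 a3.
pose L (w : H) : H := eps a1 *: (eps a3 *: w).
have hL : linear L by rewrite /L; lin.
rewrite -[RHS]/(L _) (sw3_comp _ _ hL); apply: eq_sw3 => x1 x2 x3.
rewrite (sw3_comp _ _ hL); apply: eq_sw3 => b1 b2 b3.
have hG' : linear (fun y => G a2 b1 b2 b3 x1 x2 x3 y) by rewrite /G; lin.
by rewrite -(sw3_counit' y hcB hG') (sw3_comp _ _ hL).
Qed.

End DoubleProduct.

(** * Conjugation by a linear form in a convolution algebra *)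

Section Conjugation.
Context {k : fieldType} {C : bialg_sig k} (hC : is_coalg C).
Variables T I : C -> klm k.
Hypotheses (hT : linear T) (hI : linear I).
Hypothesis IT : forall c, \sw_(x, y <- c) ((I x : k) * (T y : k) : klm k) = eps c :> klm k.
Let hD := coalg_comul hC.
Let he := coalg_counit hC.

(** The convolution product T * f * I. By hypothesis I * T is the counit, so for [I] inverse to [T]
    this is conjugation. *)
Definition conjug (W : lmodType k) (f : C -> W) (c : C) : W :=
  \sw_(x, y, z <- c) ((T x : k) * (I z : k)) *: f y.

Lemma lin_conjug (W : lmodType k) (f : C -> W) : linear f -> linear (conjug f).
Proof. by move=> hf; rewrite /conjug; lin. Qed.

Lemma conjug_comp (V W : lmodType k) (L : V -> W) (f : C -> V) c : linear L ->
  L (conjug f c) = conjug (fun c => L (f c)) c.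
Proof.
move=> hL; rewrite /conjug (sw3_comp _ _ hL); apply: eq_sw3 => x y z.
by rewrite (linZ _ _ hL).
Qed.

(** Multiplying T * f * I by [T] on the right cancels I * T. This removes the inverse form from the
    product formula and yields the cross relation. *)
Lemma conjug_comm (W : lmodType k) (f : C -> W) c : linear f ->
  (\sw_(p, q <- c) (T q : k) *: conjug f p) = \sw_(x, y <- c) (T x : k) *: f y.
Proof.
move=> hf.
transitivity (\sw_(p, q <- c) \sw_(x, e <- p) \sw_(y, z <- e)
    ((I z : k) * (T q : k)) *: ((T x : k) *: f y)).
  apply: eq_sw => p q; rewrite /conjug /sweedler3.
  rewrite (sw_comp _ _ (L := fun w => (T q : k) *: w)); last by lin.
  apply: eq_sw => x e; rewrite (sw_comp _ _ (L := fun w => (T q : k) *: w)); last by lin.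
  apply: eq_sw => y z; rewrite !scalerA; congr (_ *: _).
  by rewrite mulrCA [RHS]mulrC; congr (_ * _); exact: mulrC.
rewrite (sw_assoc hC (f := fun x e q => \sw_(y, z <- e)
    ((I z : k) * (T q : k)) *: ((T x : k) *: f y))); last by lin.
apply: eq_sw => x d.
rewrite (sw_assoc hC (f := fun y z q =>
    ((I z : k) * (T q : k)) *: ((T x : k) *: f y))); last by lin.
have hg : linear (fun y => (T x : k) *: f y) by lin.
rewrite -[RHS](sw_counitr hC d hg); apply: eq_sw => y h.
by rewrite -scale_sw IT.
Qed.

(** Conjugating both legs of a coproduct produces the factors T, I, T, I along the legs; the inner I
    * T cancels and the outer pair conjugates the whole. *)
Lemma conjug_comul (W : lmodType k) (f : C -> C -> W) c : bilin f ->
  (\sw_(p, q <- c) conjug (fun u => conjug (f u) q) p)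
  = conjug (fun d => \sw_(x, y <- d) f x y) c.
Proof.
move=> hf.
pose F x y z u v w : W :=
  ((I z : k) * (T u : k)) *: (((T x : k) * (I w : k)) *: f y v).
transitivity (\sw_(p, q <- c) \sw_(x, e <- p) \sw_(u, g <- q)
    \sw_(y, z <- e) \sw_(v, w <- g) F x y z u v w).
  apply: eq_sw => p q; rewrite /conjug /sweedler3; apply: eq_sw => x e.
  rewrite [RHS]sw_exch; apply: eq_sw => y z.
  rewrite (sw_comp _ _ (L := fun w => _ *: w)); last by lin.
  apply: eq_sw => u g.
  rewrite (sw_comp _ _ (L := fun w => _ *: w)); last by lin.
  apply: eq_sw => v w; rewrite /F !scalerA; congr (_ *: _).
  by rewrite [X in X * _ = _]mulrC [LHS]mulrACA.
rewrite (sw_nest hC (F := fun x e u g => \sw_(y, z <- e) \sw_(v, w <- g) F x y z u v w));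
  try by move=> *; rewrite /F; lin.
transitivity (\sw_(x, r <- c) \sw_(y, g <- r) \sw_(v, w <- g)
    ((T x : k) * (I w : k)) *: f y v).
  rewrite /sweedler3; apply: eq_sw => x r; apply: eq_sw => d g.
  rewrite (sw_assoc hC (f := fun y z u => \sw_(v, w <- g) F x y z u v w)); last first.
    by rewrite /F; lin.
  have hg : linear (fun y => \sw_(v, w <- g) ((T x : k) * (I w : k)) *: f y v) by lin.
  rewrite -[RHS](sw_counitr hC d hg) /sweedler3; apply: eq_sw => y h.
  by rewrite -IT scale_sw; apply: eq_sw => z u; rewrite (sw_comp _ _ (L := fun w => _ *: w)); [|lin].
rewrite /conjug /sweedler3; apply: eq_sw => x r.
transitivity (\sw_(d, z <- r) \sw_(y, v <- d) ((T x : k) * (I z : k)) *: f y v).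
  by rewrite (sw_assoc hC (f := fun y v z => ((T x : k) * (I z : k)) *: f y v)); [|lin].
by apply: eq_sw => d z; rewrite (sw_comp _ _ (L := fun w => _ *: w)); [|lin].
Qed.

Lemma conjug_counit (W : lmodType k) (w : W) c :
  (forall c, \sw_(x, y <- c) ((T x : k) * (I y : k) : klm k) = eps c :> klm k) ->
  conjug (fun c => eps c *: w) c = eps c *: w.
Proof.
move=> TI; rewrite -TI scale_sw /conjug /sweedler3; apply: eq_sw => x d.
have hf : linear (fun d => ((T x : k) * (I d : k)) *: w) by lin.
rewrite -[RHS](sw_counitl hC d hf); apply: eq_sw => y z.
by rewrite !scalerA mulrC.
Qed.

End Conjugation.

(* Interface of the deformed product: the theory of the double only uses these
   facts, and the type of its elements stays abstract. *)
Record is_double {k : fieldType} {A B D : bialg_sig k} (dt : A -> B -> D)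
    (ta ti : A -> B -> k) : Prop := IsDouble {
  dt_bilin : bilin dt;
  dt_lift : forall (W : lmodType k) (f : A -> B -> W), bilin f ->
    exists2 h : D -> W, linear h & forall a x, h (dt a x) = f a x;
  eq_lin_dt : forall (W : lmodType k) (f g : D -> W), linear f -> linear g ->
    (forall a x, f (dt a x) = g (dt a x)) -> forall d, f d = g d;
  dt_coalg : is_coalg D;
  sw_dt : forall (W : lmodType k) (f : D -> D -> W) a x, bilin f ->
    sweedler f (dt a x)
    = \sw_(a1, a2 <- a) \sw_(x1, x2 <- x) f (dt a1 x1) (dt a2 x2);
  dt_eps : forall a x, eps (dt a x) = eps a * eps x;
  dt_one : bone D = dt (bone A) (bone B);
  dt_mul_bilin : bilin (@bmul k D);
  dt_mul : forall a x b y, bmul (dt a x) (dt b y)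
    = \sw_(b1, b2, b3 <- b) \sw_(x1, x2, x3 <- x)
       (ta b1 x1 * ti b3 x3) *: dt (bmul a b2) (bmul x2 y) }.

Lemma deformation_is_double {k : fieldType} {A B : bialg_sig k}
    (hA : is_bialg A) (hB : is_bialg B) (tau : tensor A B -> k^o)
    (htau : is_skew_pairing tau) (S : A -> A) (hS : is_antipode S) :
  @is_double k A B (deformation (pairing_cocycle tau)) (@tens k A B)
    (spair (tau := tau)) (spair_inv (tau := tau) (S := S)).
Proof.
have hcA := bialg_coalg hA; have hcB := bialg_coalg hB.
have hmA := alg_bilin (bialg_alg hA); have hmB := alg_bilin (bialg_alg hB).
have hDA := coalg_comul hcA; have hDB := coalg_comul hcB.
have hta := spair_bilin htau; have hti := spair_inv_bilin htau hS.
split.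
- exact: tens_bilin.
- move=> W f hf; exists (tlift f); first exact: tlift_linear.
  by move=> a x; rewrite tlift_tens.
- by move=> W f g hf hg fg; exact: (eq_lin_tens hf hg).
- exact: (tensor_coalg hcA hcB).
- by move=> W f a x hf; exact: (sw_tens hcA hcB).
- exact: (tensor_counitE hcA hcB).
- by [].
- have hH := tensor_coalg hcA hcB; have hDH := coalg_comul hH.
  have hm : bilin (@bmul k (tensor_bialg A B)) by split=> t; rewrite /= /tprod; lin.
  set D := deformation _.
  suff h : bilin (fun g h : tensor_bialg A B => @bmul k D g h) by [].
  have hs := lin_pairing_cocycle hcA hcB (lin_tau htau).
  have E (g h : tensor_bialg A B) : @bmul k D g h
    = @sweedler3 k (tensor_bialg A B) _ (fun g1 g2 g3 =>
      @sweedler3 k (tensor_bialg A B) (tensor_bialg A B) (fun h1 h2 h3 =>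
       ((pairing_cocycle tau (g1 \ox h1) : k)
        * (conv_inv (pairing_cocycle tau) (g3 \ox h3) : k)) *: bmul g2 h2) h) g by [].
  have [q hq qE] : exists2 q : _ -> klm k, linear q & conv_inv (pairing_cocycle tau) = q.
    have ht : linear (tmap S (id : B -> B)) := lin_tmap (lin_antipode hS) (@lin_id _ B).
    have := lin_pairing_cocycle hcA hcB (lin_comp (lin_tau htau) ht).
    by eexists; [|exact: (double_conv_inv hA hB htau hS)].
  rewrite qE in E.
  have lq1 (g : tensor_bialg A B) : linear (fun h : tensor_bialg A B => q (g \ox h) : klm k).
    by apply: (lin_comp hq); exact: (tens_bilin (tensor_bialg A B) (tensor_bialg A B)).1.
  have lq2 (g : tensor_bialg A B) : linear (fun h : tensor_bialg A B => q (h \ox g) : klm k).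
    by apply: (lin_comp hq); exact: (tens_bilin (tensor_bialg A B) (tensor_bialg A B)).2.
  have ls1 (g : tensor_bialg A B) :
      linear (fun h : tensor_bialg A B => pairing_cocycle tau (g \ox h) : klm k).
    by apply: (lin_comp hs); exact: (tens_bilin (tensor_bialg A B) (tensor_bialg A B)).1.
  have ls2 (g : tensor_bialg A B) :
      linear (fun h : tensor_bialg A B => pairing_cocycle tau (h \ox g) : klm k).
    by apply: (lin_comp hs); exact: (tens_bilin (tensor_bialg A B) (tensor_bialg A B)).2.
  pose F (g1 g2 g3 h1 h2 h3 : tensor_bialg A B) : tensor_bialg A B :=
    ((pairing_cocycle tau (g1 \ox h1) : k) * (q (g3 \ox h3) : k)) *: bmul g2 h2.
  have hF6 g1 g2 g3 h1 h2 : linear (F g1 g2 g3 h1 h2).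
    rewrite /F; apply: (lin_scalel (c := fun h3 : tensor_bialg A B => _)); exact: lin_mulr.
  have hF5 g1 g2 g3 h1 h3 : linear (fun h2 => F g1 g2 g3 h1 h2 h3).
    by rewrite /F; apply: lin_scaler; exact: hm.1.
  have hF4 g1 g2 g3 h2 h3 : linear (fun h1 => F g1 g2 g3 h1 h2 h3).
    rewrite /F; apply: (lin_scalel (c := fun h1 : tensor_bialg A B => _)); exact: lin_mull.
  have hF3 g1 g2 h1 h2 h3 : linear (fun g3 => F g1 g2 g3 h1 h2 h3).
    rewrite /F; apply: (lin_scalel (c := fun h3 : tensor_bialg A B => _)); exact: lin_mulr.
  have hF2 g1 g3 h1 h2 h3 : linear (fun g2 => F g1 g2 g3 h1 h2 h3).
    by rewrite /F; apply: lin_scaler; exact: hm.2.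
  have hF1 g2 g3 h1 h2 h3 : linear (fun g1 => F g1 g2 g3 h1 h2 h3).
    rewrite /F; apply: (lin_scalel (c := fun h1 : tensor_bialg A B => _)); exact: lin_mull.
  have hF : bilin (fun g h : tensor_bialg A B => @sweedler3 k (tensor_bialg A B) _
    (fun g1 g2 g3 => @sweedler3 k (tensor_bialg A B) _ (fun h1 h2 h3 => F g1 g2 g3 h1 h2 h3) h) g).
    by split=> z; lin.
  by split=> z a u v; rewrite !E; [exact: (hF.1 z)|exact: (hF.2 z)].
- exact: (deformation_mulE hA hB htau hS).
Qed.

(** * The Hopf algebra structure of the double *)

Section Double.
Context {k : fieldType} {A B D : bialg_sig k} (hA : is_bialg A) (hB : is_bialg B).
Context {tau : tensor A B -> k^o} (htau : is_skew_pairing tau).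
Context {SA : A -> A} (hSA : is_antipode SA).
Context {SB : B -> B} (hSB : is_antipode SB).
Local Notation ta := (spair (tau := tau)).
Local Notation ti := (spair_inv (tau := tau) (S := SA)).
Context {dt : A -> B -> D} (hd : is_double dt ta ti).
Local Notation u := (bone A).
Local Notation u' := (bone B).

Let hmA := alg_bilin (bialg_alg hA).
Let hmB := alg_bilin (bialg_alg hB).
Let hcA := bialg_coalg hA.
Let hcB := bialg_coalg hB.
Let hDA := coalg_comul hcA.
Let hDB := coalg_comul hcB.
Let heA := coalg_counit hcA.
Let heB := coalg_counit hcB.
Let hlA := lin_antipode hSA.
Let hlB := lin_antipode hSB.
Let hta := spair_bilin htau.
Let hti := spair_inv_bilin htau hSA.
Let hdt := dt_bilin hd.
Let hm := dt_mul_bilin hd.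
Let hcD := dt_coalg hd.
Let hDD := coalg_comul hcD.
Let heD := coalg_counit hcD.

Lemma dt_mull a b y : bmul (dt a u') (dt b y) = dt (bmul a b) y.
Proof.
rewrite (dt_mul hd).
transitivity (\sw_(b1, b2, b3 <- b) (eps b1 * eps b3) *: dt (bmul a b2) y).
  apply: eq_sw3 => b1 b2 b3; rewrite (sw3_one hB); last by lin.
  by rewrite (spair1r htau) (spair_inv1r hA htau hSA) (bmul1l hB).
by apply: (sw3_counit hcA (f := fun b => dt (bmul a b) y)); lin.
Qed.

Lemma dt_mulr a x y : bmul (dt a x) (dt u y) = dt a (bmul x y).
Proof.
rewrite (dt_mul hd) (sw3_one hA); last by lin.
transitivity (\sw_(x1, x2, x3 <- x) (eps x1 * eps x3) *: dt a (bmul x2 y)).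
  apply: eq_sw3 => x1 x2 x3.
  by rewrite (spair1l htau) (spair_inv1l hA htau hSA) (bmul1r hA).
by apply: (sw3_counit hcB (f := fun x => dt a (bmul x y))); lin.
Qed.

Lemma dt_split a x : dt a x = bmul (dt a u') (dt u x).
Proof. by rewrite dt_mull (bmul1r hA). Qed.

(** Associativity is obtained from left multiplication operators rather than from the cocycle
    identity: left multiplication by a ⊗ x is the composite of those by a ⊗ 1 and 1 ⊗ x. It remains
    to compose operators of each kind ([actA], [actB]) and to exchange them ([actAB]). *)
Let act_split a x m : bmul (dt a x) m = bmul (dt a u') (bmul (dt u x) m).
Proof.
move: m; refine (eq_lin_dt hd _ _ _) => [||b y]; [by lin|by lin|].
rewrite !(dt_mul hd) (sw3_comp _ _ (L := bmul (dt a u'))); last by lin.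
apply: eq_sw3 => b1 b2 b3; rewrite (sw3_comp _ _ (L := bmul (dt a u'))); last by lin.
apply: eq_sw3 => x1 x2 x3; rewrite (linZ (f := bmul (dt a u'))); last by lin.
by rewrite dt_mull (bmul1l hA).
Qed.

Let actA a b m : bmul (dt (bmul a b) u') m = bmul (dt a u') (bmul (dt b u') m).
Proof.
move: m; refine (eq_lin_dt hd _ _ _) => [||c y]; [by lin|by lin|].
by rewrite !dt_mull (bmulA hA).
Qed.

(** This is multiplicativity of the pairing and of its inverse in the second argument. Both reverse
    the legs in a compatible way, so that the fivefold coproduct of [b] can be bracketed according
    to either order of multiplication. *)
Let actB x x' m : bmul (dt u (bmul x x')) m = bmul (dt u x) (bmul (dt u x') m).
Proof.
move: m; refine (eq_lin_dt hd _ _ _) => [||b y]; [by lin|by lin|].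
pose F b1 b2 b3 b4 b5 x1 x2 x3 y1 y2 y3 : D :=
  (ta b1 y1 * ti b5 y3) *: ((ta b2 x1 * ti b4 x3) *: dt (bmul u b3) (bmul x2 (bmul y2 y))).
transitivity (\sw_(x1, x2, x3 <- x) \sw_(y1, y2, y3 <- x') \sw_(d, b3, e <- b)
   \sw_(b1, b2 <- d) \sw_(b4, b5 <- e) F b1 b2 b3 b4 b5 x1 x2 x3 y1 y2 y3).
  rewrite (dt_mul hd) [LHS]sw3_exch (sw3_mul _ _ hB); last by lin.
  apply: eq_sw3 => x1 x2 x3; apply: eq_sw3 => y1 y2 y3; apply: eq_sw3 => d b3 e.
  rewrite -scalerA (spairMr_scale htau); apply: eq_sw => b1 b2.
  rewrite (spair_invMr_scale hA hB htau hSA).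
  rewrite (sw_comp _ _ (L := fun w => _ *: w)); last by lin.
  apply: eq_sw => b4 b5; rewrite /F -(bmulA hB) !scalerA; congr (_ *: _).
  by rewrite [RHS]mulrACA; congr (_ * _); rewrite mulrC.
transitivity (\sw_(b1, d, b5 <- b) \sw_(y1, y2, y3 <- x')
   \sw_(b2, b3, b4 <- d) \sw_(x1, x2, x3 <- x) F b1 b2 b3 b4 b5 x1 x2 x3 y1 y2 y3).
  rewrite [LHS]sw3_exch [RHS]sw3_exch; apply: eq_sw3 => y1 y2 y3.
  rewrite (sw3_nest hcA (F := fun b1 b2 b3 b4 b5 => \sw_(x1, x2, x3 <- x)
    F b1 b2 b3 b4 b5 x1 x2 x3 y1 y2 y3)); try by move=> *; rewrite /F; lin.
  rewrite [LHS]sw3_exch; apply: eq_sw3 => d b3 e.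
  rewrite [LHS]sw3_sw_exch; apply: eq_sw => b1 b2; exact: sw3_sw_exch.
rewrite (dt_mul hd) (sw3_comp _ _ (L := bmul (dt u x))); last by lin.
apply: eq_sw3 => b1 d b5; rewrite (sw3_comp _ _ (L := bmul (dt u x))); last by lin.
apply: eq_sw3 => y1 y2 y3; rewrite (linZ (f := bmul (dt u x))); last by lin.
rewrite (dt_mul hd) (bmul1l hA) (sw3_comp _ _ (L := fun w => _ *: w)); last by lin.
apply: eq_sw3 => b2 b3 b4; rewrite (sw3_comp _ _ (L := fun w => _ *: w)); last by lin.
by [].
Qed.

(* (1 (x) x)((a (x) 1) m), with [a] moved to the left of [x] *)
Let actAB x a m : bmul (dt u x) (bmul (dt a u') m)
  = \sw_(a1, a2, a3 <- a) \sw_(x1, x2, x3 <- x)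
     (ta a1 x1 * ti a3 x3) *: bmul (dt a2 u') (bmul (dt u x2) m).
Proof.
move: m; refine (eq_lin_dt hd _ _ _) => [||b y]; [by lin|by lin|].
pose F a1 a2 a3 b1 b2 b3 x1 x2 x3 x4 x5 : D :=
  (ta a1 x1 * ti a3 x5) *: ((ta b1 x2 * ti b3 x4) *: dt (bmul a2 b2) (bmul x3 y)).
transitivity (\sw_(a1, a2, a3 <- a) \sw_(b1, b2, b3 <- b) \sw_(e, x3, f <- x)
   \sw_(x1, x2 <- e) \sw_(x4, x5 <- f) F a1 a2 a3 b1 b2 b3 x1 x2 x3 x4 x5).
  rewrite dt_mull (dt_mul hd) (sw3_mul _ _ hA); last by lin.
  apply: eq_sw3 => a1 a2 a3; apply: eq_sw3 => b1 b2 b3; apply: eq_sw3 => e x3 f.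
  rewrite -scalerA (spairMl_scale htau); apply: eq_sw => x1 x2.
  rewrite (spair_invMl_scale hA htau hSA).
  rewrite (sw_comp _ _ (L := fun w => _ *: w)); last by lin.
  apply: eq_sw => x4 x5; rewrite /F (bmul1l hA) !scalerA; congr (_ *: _).
  by rewrite [RHS]mulrACA; congr (_ * _); rewrite mulrC.
apply: eq_sw3 => a1 a2 a3.
transitivity (\sw_(x1, e, x5 <- x) \sw_(x2, x3, x4 <- e) \sw_(b1, b2, b3 <- b)
  F a1 a2 a3 b1 b2 b3 x1 x2 x3 x4 x5).
  rewrite (sw3_nest hcB (F := fun x1 x2 x3 x4 x5 => \sw_(b1, b2, b3 <- b)
    F a1 a2 a3 b1 b2 b3 x1 x2 x3 x4 x5)); try by move=> *; rewrite /F; lin.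
  rewrite [LHS]sw3_exch; apply: eq_sw3 => e x3 f.
  rewrite [LHS]sw3_sw_exch; apply: eq_sw => x1 x2; exact: sw3_sw_exch.
apply: eq_sw3 => x1 e x5; rewrite [LHS]sw3_exch (dt_mul hd).
pose L (w : D) : D := (ta a1 x1 * ti a3 x5) *: bmul (dt a2 u') w.
have hL : linear L by rewrite /L; lin.
rewrite -[RHS]/(L _) (sw3_comp _ _ hL); apply: eq_sw3 => b1 b2 b3.
rewrite (sw3_comp _ _ hL); apply: eq_sw3 => x2 x3 x4.
rewrite (linZ _ _ hL) /L dt_mull (bmul1l hA) /F !scalerA; congr (_ *: _); exact: mulrC.
Qed.

(** Once both factors are split, exchanging [x] and [b] by [actAB] introduces the same scalars as
    the definition of the product, and [actA], [actB] merge the remaining operators. *)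
Lemma double_mulA : associative (@bmul k D).
Proof.
suff h (d e m : D) : bmul (bmul d e) m = bmul d (bmul e m) by exact: (fun d e m => esym (h d e m)).
move: d; refine (eq_lin_dt hd _ _ _) => [||a x]; [by lin|by lin|].
move: e; refine (eq_lin_dt hd _ _ _) => [||b y]; [by lin|by lin|].
rewrite [RHS]act_split [X in _ = bmul _ (bmul _ X)]act_split actAB.
rewrite (dt_mul hd) (sw3_comp _ _ (L := fun d => bmul d m)); last by lin.
rewrite (sw3_comp _ _ (L := bmul (dt a u'))); last by lin.
apply: eq_sw3 => b1 b2 b3; rewrite (sw3_comp _ _ (L := fun d => bmul d m)); last by lin.
rewrite (sw3_comp _ _ (L := bmul (dt a u'))); last by lin.
apply: eq_sw3 => x1 x2 x3; rewrite (linZ (f := fun d => bmul d m)); last by lin.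
rewrite (linZ (f := bmul (dt a u'))); last by lin.
by rewrite act_split actA actB.
Qed.

Lemma double_alg : is_alg D.
Proof.
split; [exact: hm|exact: double_mulA| |].
  refine (eq_lin_dt hd _ _ _) => [||a x]; [by lin|by lin|].
  by rewrite (dt_one hd) dt_mull (bmul1l hA).
refine (eq_lin_dt hd _ _ _) => [||a x]; [by lin|by lin|].
by rewrite (dt_one hd) dt_mulr (bmul1r hB).
Qed.

End Double.

Section DoubleHopf.
Context {k : fieldType} {A B D : bialg_sig k} (hA : is_bialg A) (hB : is_bialg B).
Context {tau : tensor A B -> k^o} (htau : is_skew_pairing tau).
Context {SA : A -> A} (hSA : is_antipode SA).
Context {SB : B -> B} (hSB : is_antipode SB).
Local Notation ta := (spair (tau := tau)).
Local Notation ti := (spair_inv (tau := tau) (S := SA)).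
Context {dt : A -> B -> D} (hd : is_double dt ta ti).
Local Notation u := (bone A).
Local Notation u' := (bone B).
Local Notation C := (tensor_bialg A B).

Let hmA := alg_bilin (bialg_alg hA).
Let hmB := alg_bilin (bialg_alg hB).
Let hcA := bialg_coalg hA.
Let hcB := bialg_coalg hB.
Let hDA := coalg_comul hcA.
Let hDB := coalg_comul hcB.
Let heA := coalg_counit hcA.
Let heB := coalg_counit hcB.
Let hlA := lin_antipode hSA.
Let hlB := lin_antipode hSB.
Let hta := spair_bilin htau.
Let hti := spair_inv_bilin htau hSA.
Let hdt := dt_bilin hd.
Let hm := dt_mul_bilin hd.
Let hcD := dt_coalg hd.
Let hDD := coalg_comul hcD.
Let heD := coalg_counit hcD.
Let hC : is_coalg C := tensor_coalg hcA hcB.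

Let T (c : C) : klm k := tau c.
Let I (c : C) : klm k := tlift (fun a x => ti a x : klm k) c.
Let TE a x : T (a \ox x) = ta a x. Proof. by []. Qed.
Let IE a x : I (a \ox x) = ti a x. Proof. exact: (tlift_tens hti). Qed.
Let hT : linear T. Proof. exact: lin_tau htau. Qed.
Let hI : linear I. Proof. exact: (tlift_linear hti). Qed.

Let TIb : bilin (fun x y : C => (T x : k) * (I y : k) : klm k).
Proof. by split=> z; [apply: lin_mulr|apply: lin_mull]. Qed.
Let ITb : bilin (fun x y : C => (I x : k) * (T y : k) : klm k).
Proof. by split=> z; [apply: lin_mulr|apply: lin_mull]. Qed.

Let IT (c : C) : \sw_(x, y <- c) ((I x : k) * (T y : k) : klm k) = eps c :> klm k.
Proof.
have hD := coalg_comul hC; have he := coalg_counit hC.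
move: c; refine (eq_lin_tensb _ he _) => [|a x].
  exact: (@lin_sweedlera k C C (klm k) _ (fun x => x) hD ITb (@lin_id _ _)).
rewrite (sw_tens hcA hcB _ _ ITb) (tensor_counitE hcA hcB) -(spairVK htau hSA).
by apply: eq_sw => a1 a2; apply: eq_sw => x1 x2; rewrite IE.
Qed.

Let TI (c : C) : \sw_(x, y <- c) ((T x : k) * (I y : k) : klm k) = eps c :> klm k.
Proof.
have hD := coalg_comul hC; have he := coalg_counit hC.
move: c; refine (eq_lin_tensb _ he _) => [|a x].
  exact: (@lin_sweedlera k C C (klm k) _ (fun x => x) hD TIb (@lin_id _ _)).
rewrite (sw_tens hcA hcB _ _ TIb) (tensor_counitE hcA hcB) -(spairK htau hSA).
by apply: eq_sw => a1 a2; apply: eq_sw => x1 x2; rewrite IE.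
Qed.

Let mu a y (c : C) : D := tlift (fun b x => dt (bmul a b) (bmul x y)) c.
Let mub a y : bilin (fun b x => dt (bmul a b) (bmul x y)). Proof. by lin. Qed.
Let muE a y b x : mu a y (b \ox x) = dt (bmul a b) (bmul x y).
Proof. exact: (tlift_tens (mub a y)). Qed.
Let hmu a y : linear (mu a y). Proof. exact: (tlift_linear (mub a y)). Qed.

(** The deformed product is the undeformed one, viewed as a function of the inner pair b ⊗ x,
    conjugated by the pairing. *)
Let mul_conjug a x b y : bmul (dt a x) (dt b y) = conjug T I (mu a y) (b \ox x).
Proof.
have h := hmu a y.
rewrite (dt_mul hd) /conjug (sw3_tens hcA hcB); last by lin.
apply: eq_sw3 => b1 b2 b3; apply: eq_sw3 => x1 x2 x3.
by rewrite muE IE TE.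
Qed.

Let conjug_sw (E : bialg_sig k) (W : lmodType k) (F : E -> E -> C -> W) e c :
  conjug T I (fun c => \sw_(x, y <- e) F x y c) c = \sw_(x, y <- e) conjug T I (F x y) c.
Proof.
rewrite /conjug -[RHS]sw3_sw_exch; apply: eq_sw3 => x y z.
by rewrite (sw_comp _ _ (L := fun w => _ *: w)); [|lin].
Qed.

(** The undeformed product is compatible with coproducts, and [conjug_comul] carries the conjugation
    through the coproduct of b ⊗ x. The legs of [a] and [y] are only spectators. *)
Lemma double_sw_mul (W : lmodType k) (f : D -> D -> W) d e : bilin f ->
  sweedler f (bmul d e)
  = \sw_(d1, d2 <- d) \sw_(e1, e2 <- e) f (bmul d1 e1) (bmul d2 e2).
Proof.
move=> hf.
move: d; refine (eq_lin_dt hd _ _ _) => [||a x]; [by lin|by lin|].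
move: e; refine (eq_lin_dt hd _ _ _) => [||b y]; [by lin|by lin|].
have hfD : linear (sweedler f) by lin.
have hDC := coalg_comul hC.
have hfm a1 a2 y1 y2 : bilin (fun c1 c2 : C => f (mu a1 y1 c1) (mu a2 y2 c2)).
  have h1 := hmu a1 y1; have h2 := hmu a2 y2; by lin.
rewrite mul_conjug (conjug_comp _ _ _ _ hfD).
transitivity (conjug T I (fun c : C => \sw_(a1, a2 <- a) \sw_(y1, y2 <- y)
    \sw_(c1, c2 <- c) f (mu a1 y1 c1) (mu a2 y2 c2)) (b \ox x)).
  congr (conjug _ _ _ _); apply/funext; refine (eq_lin_tensb _ _ _) => [||b' x'].
  - by have h := hmu a y; lin.
  - by lin.
  rewrite muE (sw_dt hd _ _ hf) (sw_mul hA); last by lin.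
  apply: eq_sw => a1 a2.
  transitivity (\sw_(y1, y2 <- y) \sw_(b1, b2 <- b') \sw_(x1, x2 <- x')
     f (dt (bmul a1 b1) (bmul x1 y1)) (dt (bmul a2 b2) (bmul x2 y2))).
    rewrite [RHS]sw_exch; apply: eq_sw => b1 b2; rewrite [RHS]sw_exch.
    by rewrite (sw_mul hB); last by lin.
  apply: eq_sw => y1 y2; rewrite (sw_tens hcA hcB _ _ (hfm _ _ _ _)).
  by apply: eq_sw => b1 b2; apply: eq_sw => x1 x2; rewrite !muE.
rewrite (@conjug_sw _ _ (fun a1 a2 c => \sw_(y1, y2 <- y)
  \sw_(c1, c2 <- c) f (mu a1 y1 c1) (mu a2 y2 c2))).
rewrite (sw_dt hd); last by lin.
apply: eq_sw => a1 a2.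
rewrite (@conjug_sw _ _ (fun y1 y2 c => \sw_(c1, c2 <- c) f (mu a1 y1 c1) (mu a2 y2 c2))).
transitivity (\sw_(y1, y2 <- y) \sw_(b1, b2 <- b) \sw_(x1, x2 <- x)
  f (bmul (dt a1 x1) (dt b1 y1)) (bmul (dt a2 x2) (dt b2 y2))); last first.
  transitivity (\sw_(x1, x2 <- x) \sw_(b1, b2 <- b) \sw_(y1, y2 <- y)
   f (bmul (dt a1 x1) (dt b1 y1)) (bmul (dt a2 x2) (dt b2 y2))).
    rewrite [LHS]sw_exch [RHS]sw_exch; apply: eq_sw => b1 b2; exact: sw_exch.
  by apply: eq_sw => x1 x2; rewrite (sw_dt hd); last by lin.
apply: eq_sw => y1 y2.
rewrite -(conjug_comul hC hT hI IT _ (hfm _ _ _ _)) (sw_tens hcA hcB); last first.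
  have h1 := hmu a1 y1; have h2 := hmu a2 y2; rewrite /conjug; by lin.
apply: eq_sw => b1 b2; apply: eq_sw => x1 x2; rewrite !mul_conjug.
rewrite (conjug_comp _ _ (L := fun w => f w _)); last by lin.
congr (conjug _ _ _ _); apply/funext => c.
by rewrite (conjug_comp _ _ (L := f _)); last by lin.
Qed.

Lemma double_bialg : is_bialg D.
Proof.
have hDa := double_alg hA hB htau hSA hd.
have comulE (d : D) : bcomul d = \sw_(x, y <- d) x \ox y by exact: esym (tlift_id _).
split; [exact: hDa|exact: hcD|split| |].
- by rewrite (dt_one hd) -[LHS]/(eps _) (dt_eps hd) (eps1 hA) (eps1 hB) mulr1.
- move=> d e; suff h : (eps (bmul d e) : klm k) = (eps d * eps e : k) :> klm k by exact: h.
  move: d; refine (eq_lin_dt hd _ _ _) => [||a x]; [by lin|by lin|].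
  move: e; refine (eq_lin_dt hd _ _ _) => [||b y]; [by lin|by lin|].
  rewrite mul_conjug (conjug_comp _ _ _ _ heD).
  transitivity (conjug T I (fun c : C => eps c *: (eps a * eps y : klm k)) (b \ox x)).
    congr (conjug _ _ _ _); apply/funext; refine (eq_lin_tensb _ _ _) => [||b' x'].
    + by have h := hmu a y; lin.
    + exact: (lin_scalel _ (coalg_counit hC)).
    rewrite muE (dt_eps hd) (epsM hA) (epsM hB) (tensor_counitE hcA hcB).
    have mul4 (p q r s : k) : (p * q) * (r * s) = (q * r) * (p * s).
      by rewrite [p * q]mulrC mulrACA.
    exact: mul4.
  rewrite (conjug_counit hC hI (eps a * eps y : klm k) (b \ox x) TI) (tensor_counitE hcA hcB) !(dt_eps hd).
  rewrite -[LHS]/((eps b * eps x) * (eps a * eps y)) [LHS]mulrACA.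
  by rewrite [RHS]mulrACA [eps b * _]mulrC.
- rewrite (dt_one hd) comulE (sw_dt hd); last by lin.
  rewrite (sw_one hA); last by lin.
  by rewrite (sw_one hB); [|lin].
- move=> d e; rewrite comulE double_sw_mul; last by lin.
  by [].
Qed.

Let mulA := double_mulA hA hB htau hSA hd.

(** As a ⊗ x = (a ⊗ 1)(1 ⊗ x), the antipode has to be (1 ⊗ S x)(S a ⊗ 1). Associativity brings the
    two factors from [A] together in one axiom and the two from [B] in the other, and each axiom
    collapses from the inside. *)
Lemma double_antipode : exists S : D -> D, is_antipode S.
Proof.
have [S hS SE] := dt_lift hd (f := fun a x => bmul (dt u (SB x)) (dt (SA a) u')) ltac:(lin).
exists S; split; [exact: hS| |].
- refine (eq_lin_dt hd _ _ _) => [||a x]; [by lin|by lin|].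
  rewrite -[bcounit _]/(eps _) (sw_dt hd); last by lin.
  transitivity (\sw_(x1, x2 <- x) \sw_(a1, a2 <- a)
     bmul (dt u (SB x1)) (bmul (dt (bmul (SA a1) a2) u') (dt u x2))).
    rewrite [RHS]sw_exch; apply: eq_sw => a1 a2; apply: eq_sw => x1 x2.
    rewrite SE -(dt_mull hA hB htau hSA hd) -[RHS](congr1 (bmul _) (mulA _ _ _)).
    by rewrite -(dt_split hA hB htau hSA hd) [RHS]mulA.
  transitivity (\sw_(x1, x2 <- x) eps a *: dt u (bmul (SB x1) x2)).
    apply: eq_sw => x1 x2.
    pose L a' := bmul (dt u (SB x1)) (bmul (dt a' u') (dt u x2)).
    have hL : linear L by rewrite /L; lin.
    rewrite -[LHS](sw_comp _ _ hL) (sw_antipodel hSA) (linZ _ _ hL) /L.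
    by rewrite (dt_mull hA hB htau hSA hd) (bmul1l hA) (dt_mulr hA hB htau hSA hd).
  pose L x' := eps a *: dt u x'.
  have hL : linear L by rewrite /L; lin.
  rewrite -[LHS](sw_comp _ _ hL) (sw_antipodel hSB) (linZ _ _ hL) /L.
  by rewrite (dt_eps hd) (dt_one hd) scalerA mulrC.
- refine (eq_lin_dt hd _ _ _) => [||a x]; [by lin|by lin|].
  rewrite -[bcounit _]/(eps _) (sw_dt hd); last by lin.
  transitivity (\sw_(a1, a2 <- a) \sw_(x1, x2 <- x)
     bmul (dt a1 (bmul x1 (SB x2))) (dt (SA a2) u')).
    apply: eq_sw => a1 a2; apply: eq_sw => x1 x2.
    by rewrite SE -(dt_mulr hA hB htau hSA hd) [LHS]mulA.
  transitivity (\sw_(a1, a2 <- a) eps x *: dt (bmul a1 (SA a2)) u').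
    apply: eq_sw => a1 a2.
    pose L x' := bmul (dt a1 x') (dt (SA a2) u').
    have hL : linear L by rewrite /L; lin.
    rewrite -[LHS](sw_comp _ _ hL) (sw_antipoder hSB) (linZ _ _ hL) /L.
    by rewrite (dt_mull hA hB htau hSA hd).
  pose L a' := eps x *: dt a' u'.
  have hL : linear L by rewrite /L; lin.
  rewrite -[LHS](sw_comp _ _ hL) (sw_antipoder hSA) (linZ _ _ hL) /L.
  by rewrite (dt_eps hd) (dt_one hd) scalerA.
Qed.

(** The commutation rule of the two subalgebras, free of the inverse pairing: [conjug_comm] with
    trivial outer factors. All relations between generators of the double are read off from it. *)
Lemma double_comm b x :
  (\sw_(b1, b2 <- b) \sw_(x1, x2 <- x) ta b2 x2 *: bmul (dt u x1) (dt b1 u'))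
  = \sw_(b1, b2 <- b) \sw_(x1, x2 <- x) ta b1 x1 *: dt b2 x2.
Proof.
have h := hmu u u'.
have hTs := conjug_comm hC hT hI IT (b \ox x) h.
rewrite (sw_tens hcA hcB) in hTs; last by rewrite /conjug; lin.
rewrite (sw_tens hcA hcB) in hTs; last by lin.
transitivity (\sw_(b1, b2 <- b) \sw_(x1, x2 <- x)
  (T (b2 \ox x2) : k) *: conjug T I (mu u u') (b1 \ox x1)).
  by apply: eq_sw => b1 b2; apply: eq_sw => x1 x2; rewrite mul_conjug.
rewrite hTs; apply: eq_sw => b1 b2; apply: eq_sw => x1 x2.
by rewrite muE (bmul1l hA) (bmul1r hB).
Qed.

End DoubleHopf.

(** * Free algebras and tensor algebras *)

Section Words.
Context {k : fieldType} {X : choiceType}.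
Local Notation TX := {malg k[{fmonom X}]}.

Definition word (s : seq X) : TX := << FMonom s >>.

Lemma word1 : 1 = word [::].
Proof. by rewrite /word -fmoneE. Qed.

Lemma wordU x : tgen k x = word [:: x].
Proof. by rewrite /tgen fmuE. Qed.

Lemma wordM s t : word s * word t = word (s ++ t).
Proof.
rewrite malgME !msuppU oner_eq0 !big_seq_fset1 !mcoeffUU mulr1.
by congr (<< _ >>); apply: val_inj => /=; rewrite fmM.
Qed.

Lemma mlift_word (W : lmodType k) (f : {fmonom X} -> W) s :
  mlift f (word s) = f (FMonom s).
Proof. exact: mliftU. Qed.

Lemma eq_lin_word (W : lmodType k) (f g : TX -> W) : linear f -> linear g ->
  (forall s, f (word s) = g (word s)) -> f =1 g.
Proof. by move=> hf hg fg; apply: (eq_lin_malg hf hg) => -[s]; apply: fg. Qed.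

Lemma word_bilin : bilin ( *%R : TX -> TX -> TX).
Proof.
have hl (g : TX) : linear (fun f : TX => f * g).
  by move=> a u v; rewrite mulrDl scalerAl.
split=> [f a u v|]; last exact: hl.
have E x g : << x >> * g = mlift (fun y => << mmul x y >>) g :> TX.
  rewrite malgM_def fgmulUg mliftE; apply: eq_bigr => y _.
  by rewrite mul1r malgZU.
have hh : linear (fun f : TX => f * (a *: u + v)) := hl _.
have hh' : linear (fun f : TX => a *: (f * u) + f * v).
  exact: lin_add (lin_scaler a (hl u)) (hl v).
move: f; refine (eq_lin_malg hh hh' _) => x.
rewrite (E x (a *: u + v)) (E x u) (E x v); exact: mlift_linear.
Qed.

End Words.

Section Evaluation.
Context {k : fieldType} {X : choiceType} {R : bialg_sig k} (hR : is_alg R).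
Variable y : X -> R.
Local Notation ev := (tensor_eval y).

Let hm := alg_bilin hR.

Lemma lin_eval : linear ev. Proof. exact: mlift_linear. Qed.

Lemma eval_word s : ev (word s) = foldr (fun x r => bmul (y x) r) (bone R) s.
Proof. exact: mliftU. Qed.

Lemma eval1 : ev 1 = bone R. Proof. by rewrite word1 eval_word. Qed.

Lemma eval_gen x : ev (tgen k x) = y x.
Proof. by rewrite wordU eval_word /=; case: hR. Qed.

Lemma evalM f g : ev (f * g) = bmul (ev f) (ev g).
Proof.
have hl := lin_eval; have hw := @word_bilin k X.
have [_ mA m1 _] := hR.
move: f; refine (eq_lin_word (lin_comp hl (hw.2 g)) _ _) => [|s]; [by lin|].
move: g; refine (eq_lin_word (lin_comp hl (hw.1 (word s))) _ _) => [|t]; [by lin|].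
rewrite wordM !eval_word; elim: s => [|x s ih] /=; first by rewrite m1.
by rewrite ih mA.
Qed.

Lemma eval_hom (B : bialg_sig k) (p : R -> B) : alg_hom p ->
  forall f, p (ev f) = tensor_eval (fun x => p (y x)) f.
Proof.
move=> [hp p1 pM]; have hl := lin_eval.
refine (eq_lin_word _ _ _) => [||s]; [by lin|exact: mlift_linear|].
by rewrite eval_word [RHS]mliftU /=; elim: s => //= x s <-; rewrite pM.
Qed.

End Evaluation.

Section Diagonal.
Context {k : fieldType} {G : zmodType} {X : choiceType}.
Variables (gr : X -> G) (chi : X -> G -> k).

Lemma diag_actU g x : yact (yd_diag gr chi) g << x >> = chi x g *: << x >>.
Proof. exact: mliftU. Qed.

Lemma diag_compU g x :
  ycomp (yd_diag gr chi) g << x >> = if gr x == g then << x >> else 0.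
Proof. exact: mliftU. Qed.

Lemma diag_homog x : homog (ycomp (yd_diag gr chi)) (gr x) << x >>.
Proof. by rewrite /homog /= mliftU eqxx. Qed.

Lemma diag_grading : is_grading (ycomp (yd_diag gr chi)).
Proof.
have hl g : linear (ycomp (yd_diag gr chi) g) by exact: mlift_linear.
split=> [//|g v|g h v gh|v].
- move: v; refine (eq_lin_malg _ _ _) => [||x]; [by lin|by lin|].
  by rewrite !diag_compU; case: eqP => [<-|_]; rewrite ?diag_compU ?eqxx // (lin0 (hl _)).
- have h0 : linear (fun v : {malg k[X]} => 0 : {malg k[X]}) by lin.
  move: v; refine (eq_lin_malg _ h0 _) => [|x]; [by lin|].
  rewrite diag_compU; case: eqP => [xh|_]; last exact: lin0 (hl _).
  by rewrite diag_compU; case: eqP => // xg; case: gh; rewrite -xg.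
- pose s := undup [seq gr x | x <- msupp v].
  exists s; split; first exact: undup_uniq.
  transitivity (\sum_(x <- msupp v) \sum_(g <- s) v@_x *: (if gr x == g then << x >> else 0)).
    rewrite [LHS]monalgE big_seq [RHS]big_seq; apply: eq_bigr => x xv.
    rewrite -scaler_sumr malgZU; congr (_ *: _).
    rewrite (big_rem (gr x)) /=; last by rewrite mem_undup; apply: map_f.
    rewrite eqxx big1_seq ?addr0 // => g /andP[_]; rewrite (rem_filter _ (undup_uniq _)).
    by rewrite mem_filter /= => /andP[/negPf]; rewrite eq_sym => ->.
  rewrite exchange_big; apply: eq_bigr => g _.
  rewrite [v in RHS]monalgE (lin_big _ _ _ (hl g)); apply: eq_bigr => x _.
  by rewrite [X in _ = ycomp _ _ X]malgZU (linZ _ _ (hl g)) diag_compU.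
Qed.

End Diagonal.

Section TensorAlgebra.
Context {k : fieldType} {G : zmodType} {X : choiceType}.
Variables (gr : X -> G) (chi : X -> G -> k).
Hypothesis hchi : forall x, is_char (chi x).
Local Notation TA := (tensor_alg gr chi).
Local Notation Y := (yd_tensor_alg gr chi).
Local Notation T := (bosonization (R := TA) Y).
Local Notation "f # g" := (smash (R := TA) Y f g) (at level 39).
Local Notation c := (ycomp Y).

Lemma tensor_alg_alg : is_alg TA.
Proof.
split; [exact: word_bilin|exact: mulrA|exact: mul1r|exact: mulr1].
Qed.

Lemma tact_word g s : yact Y g (word s) = (\prod_(x <- s) chi x g) *: word s.
Proof. exact: diag_actU. Qed.

Lemma lin_tact g : linear (yact Y g). Proof. exact: mlift_linear. Qed.

Lemma tact0 f : yact Y 0 f = f.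
Proof.
have hl := lin_tact 0.
move: f; refine (eq_lin_word _ _ _) => [||s]; [by lin|by lin|].
by rewrite tact_word big1 ?scale1r // => x _; case: (hchi x).
Qed.

Lemma tactD g h f : yact Y (g + h) f = yact Y g (yact Y h f).
Proof.
have hl := lin_tact.
move: f; refine (eq_lin_word _ _ _) => [||s]; [exact: (hl (g + h))|exact: (lin_comp (hl g) (hl h))|].
rewrite !tact_word (linZ _ _ (hl g)) tact_word scalerA -big_split /=; congr (_ *: _).
by apply: eq_bigr => x _; case: (hchi x) => _ ->; rewrite mulrC.
Qed.

Lemma tactM g (a b : TA) :
  yact Y g (@bmul k TA a b) = @bmul k TA (yact Y g a) (yact Y g b).
Proof.
have hl := lin_tact; have hw := @word_bilin k X.
suff h (f h : {malg k[{fmonom X}]}) : yact Y g (f * h) = yact Y g f * yact Y g h by exact: h.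
move: f; refine (eq_lin_word (lin_comp (hl g) (hw.2 h)) (lin_comp (hw.2 _) (hl g)) _) => s.
move: h; refine (eq_lin_word (lin_comp (hl g) (hw.1 _)) (lin_comp (hw.1 _) (hl g)) _) => t.
rewrite wordM !tact_word big_cat /= (linZ _ _ (hw.1 _)).
rewrite (linZ (f := fun f => f * word t) _ _ (hw.2 _)) scalerA wordM.
by congr (_ *: _); exact: mulrC.
Qed.

Lemma tact1 g : yact Y g (bone TA) = bone TA.
Proof.
suff h : yact Y g (1 : {malg k[{fmonom X}]}) = 1 by exact: h.
by rewrite word1 tact_word big_nil scale1r.
Qed.

Lemma tbos_alg : is_alg T.
Proof.
apply: smash_alg; [exact: tensor_alg_alg|exact: lin_tact|exact: tact0|exact: tactD
  |exact: tactM|exact: tact1].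
Qed.

Lemma tbos_mul a g b h : bmul (a # g) (b # h) = ((a : TA) * yact Y g b) # (g + h).
Proof. exact: (smash_mul tensor_alg_alg lin_tact). Qed.

Lemma word_homog s : homog c (\sum_(x <- s) gr x) (word s).
Proof. exact: (diag_homog _ _ (FMonom s)). Qed.

Let hg : is_grading c := diag_grading _ _.

Lemma lin_tcomul : linear (@bcomul k TA). Proof. exact: mlift_linear. Qed.

Lemma tcomul_word x s : @bcomul k TA (word (x :: s))
  = braided_tprod Y *%R (tgen k x \ox 1 + 1 \ox tgen k x) (@bcomul k TA (word s)).
Proof.
by rewrite (mliftU _ _ : @bcomul k TA (word s) = _) [LHS](mliftU _ _).
Qed.

Lemma tcomul1 : @bcomul k TA 1 = 1 \ox 1.
Proof. by rewrite {1}word1; exact: mliftU. Qed.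

Lemma tgen_homog x : homog c (gr x) (tgen k x).
Proof. by have := word_homog [:: x]; rewrite big_seq1 wordU. Qed.

Lemma tone_homog : homog c 0 (1 : {malg k[{fmonom X}]}).
Proof. by have := word_homog [::]; rewrite big_nil -word1. Qed.

Lemma tgen_smash x s g : bmul (tgen k x # 0) (word s # g) = word (x :: s) # g.
Proof. by rewrite tbos_mul tact0 wordU [_ * _]wordM add0r. Qed.

Lemma tgen_mul_homog x d f :
  homog c d f -> homog c (gr x + d) (tgen k x * f).
Proof.
have hl e : linear (c e) := grading_lin hg e.
have hw := @word_bilin k X.
have E f' : c (gr x + d) (tgen k x * f') = tgen k x * c d f'.
  move: f'; refine (eq_lin_word (lin_comp (hl _) (hw.1 _)) (lin_comp (hw.1 _) (hl _)) _) => s.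
  rewrite wordU wordM (homog_comp hg _ (word_homog _)) (homog_comp hg _ (word_homog _)).
  rewrite big_cat big_seq1 (inj_eq (addrI _)).
  by case: eqP => _; [rewrite wordM|rewrite (lin0 (hw.1 _))].
move=> hf; apply: etrans (E f) _; congr (_ * _); exact: hf.
Qed.

Let hT := smash_bilin tensor_alg_alg lin_tact.
Lemma lin_tbos_comul : linear (@bcomul k T).
Proof. exact: (lin_bos_comul lin_tcomul hg). Qed.
Let hDT := lin_tbos_comul.

Let counit_bilin : bilin (fun (a : {malg k[{fmonom X}]}) (u : {malg k[G]}) =>
  mlift (fun=> a@_mone : klm k) u).
Proof.
have h : linear (fun a : {malg k[{fmonom X}]} => a@_mone : klm k).
  by move=> a u v; rewrite mcoeffD mcoeffZ.
by lin.
Qed.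

Lemma lin_tbos_counit : linear (@eps k T : T -> klm k).
Proof. exact: (tlift_linear counit_bilin). Qed.

Lemma tbos_counitE (a : {malg k[{fmonom X}]}) g : @eps k T (a # g) = a@_mone.
Proof. by apply: etrans (tlift_tens counit_bilin _ _) _; exact: mliftU. Qed.

Lemma tbos_sw_grp (W : lmodType k) (f : T -> T -> W) g : bilin f ->
  sweedler f (1 # g) = f (1 # g) (1 # g).
Proof.
move=> hf.
have hs h : linear (fun a : TA => a # h) := @lin_smashc k G TA Y TA (fun a => a) h (@lin_id _ _).
pose F (a b : {malg k[{fmonom X}]}) := gsum c (fun d y => f (a # (d + g)) (y # g)) b.
have hF : bilin F.
  split=> [a'|b].
    by refine (lin_gsum hg _) => d; exact: (lin_comp (hf.1 _) (hs g)).
  refine (@lin_gsumb _ _ _ c hg TA W (fun a d y => f (a # (d + g)) (y # g)) b _ _) => [a' d|d y].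
    exact: (lin_comp (hf.1 _) (hs g)).
  exact: (lin_bilc _ hf (hs _)).
apply: etrans (sw_bos lin_tcomul hg 1 g hf) _.
apply: etrans (congr1 (tlift F) tcomul1) _; apply: etrans (tlift_tens hF _ _) _.
have hF' d : linear (fun y : {malg k[{fmonom X}]} => f (1 # (d + g)) (y # g)).
  exact: (lin_comp (hf.1 _) (hs g)).
apply: etrans (gsum_homog hg hF' tone_homog) _.
exact: (congr1 (fun h => f (1 # h) (1 # g)) (add0r g)).
Qed.

(** The coproduct of a generator is x ⊗ 1 + g_x ⊗ x. Multiplicativity is needed only with a
    generator as left factor, which matches the recursion on words defining the coproduct of the
    tensor algebra; inductions over words then need nothing more. *)
Lemma tbos_sw_gen (W : lmodType k) (f : T -> T -> W) x (z : T) : bilin f ->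
  sweedler f (bmul (tgen k x # 0) z)
  = \sw_(z1, z2 <- z) (f (bmul (tgen k x # 0) z1) z2
      + f (bmul (1 # gr x) z1) (bmul (tgen k x # 0) z2)).
Proof.
move=> hf.
pose f' z1 z2 := f (bmul (tgen k x # 0) z1) z2
      + f (bmul (1 # gr x) z1) (bmul (tgen k x # 0) z2).
have hf' : bilin f' by rewrite /f'; lin.
have h1 : linear (fun z : T => sweedler f (bmul (tgen k x # 0) z)).
  exact: (@lin_sweedlera k T T W f (fun z => bmul (tgen k x # 0) z) hDT hf (hT.1 _)).
have h2 : linear (fun z : T => sweedler f' z).
  exact: (@lin_sweedlera k T T W f' (fun z => z) hDT hf' (@lin_id _ _)).
move: z; refine (eq_lin_smash h1 h2 _) => a g.
pose F (h : T -> T -> W) a b := gsum c (fun d y => h (a # (d + g)) (y # g)) b.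
have hs h : linear (fun a : TA => a # h) := @lin_smashc k G TA Y TA (fun a => a) h (@lin_id _ _).
have hF h : bilin h -> bilin (F h).
  move=> hh; split=> [a'|b].
    by refine (lin_gsum hg _) => d; exact: (lin_comp (hh.1 _) (hs g)).
  refine (@lin_gsumb _ _ _ c hg TA W (fun a d y => h (a # (d + g)) (y # g)) b _ _) => [a' d|d y]; first exact: (lin_comp (hh.1 _) (hs g)).
  exact: (lin_bilc _ hh (hs _)).
have hf1 : linear (fun a : TA => sweedler f (bmul (tgen k x # 0) (a # g))).
  exact: (lin_comp h1 (hs g)).
have hf2 : linear (fun a : TA => sweedler f' (a # g)) := lin_comp h2 (hs g).
move: a; refine (eq_lin_word hf1 hf2 _) => s.
rewrite tgen_smash (sw_bos lin_tcomul hg _ _ hf) (sw_bos lin_tcomul hg _ _ hf').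
rewrite -[LHS]/(tlift (F f) (@bcomul k TA (word (x :: s)))) tcomul_word.
rewrite -[RHS]/(tlift (F f') (@bcomul k TA (word s))).
move: (@bcomul k TA (word s)) => t.
have hbr := braided_bilin lin_tact hg (@word_bilin k X).
have hb1 : linear (fun t : tensor TA TA => tlift (F f)
   (braided_tprod Y *%R (tgen k x \ox 1 + 1 \ox tgen k x) t)).
  exact: (lin_comp (tlift_linear (hF _ hf)) (hbr.1 _)).
have hb2 : linear (tlift (F f')) := tlift_linear (hF _ hf').
have FE h d a' b : bilin h -> homog c d b -> F h a' b = h (a' # (d + g)) (b # g).
  move=> hh hb; refine (gsum_homog hg _ hb) => d'.
  exact: (lin_comp (hh.1 _) (hs g)).
move: t; refine (eq_lin_tens_homog hg hb1 hb2 _) => d a b hb.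
rewrite (linD (f := fun t => braided_tprod Y *%R t (a \ox b)) _ _ (hbr.2 _)).
have e1 : braided_tprod Y *%R (tgen k x \ox 1) (a \ox b)
    = (tgen k x * yact Y 0 a) \ox (1 * b).
  exact: (braided_tprodE lin_tact hg (@word_bilin k X) _ _ _ tone_homog).
have e2 : braided_tprod Y *%R (1 \ox tgen k x) (a \ox b)
    = (1 * yact Y (gr x) a) \ox (tgen k x * b).
  exact: (braided_tprodE lin_tact hg (@word_bilin k X) _ _ _ (tgen_homog x)).
rewrite -> e1, e2; rewrite {e1 e2}.
have t1 (u v : {malg k[{fmonom X}]}) : tlift (F f) (u \ox v) = F f u v.
  exact: (tlift_tens (hF _ hf)).
have t2 (u v : {malg k[{fmonom X}]}) : tlift (F f') (u \ox v) = F f' u v.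
  exact: (tlift_tens (hF _ hf')).
apply: etrans (linD _ _ (tlift_linear (hF _ hf))) _.
rewrite -> t1, t1, t2.
have E1 : F f (tgen k x * yact Y 0 a) (1 * b) = f ((tgen k x * a) # (d + g)) (b # g).
  rewrite -> (tact0 a), (mul1r b); exact: FE.
have E2 : F f (1 * yact Y (gr x) a) (tgen k x * b)
    = f (yact Y (gr x) a # (gr x + (d + g))) ((tgen k x * b) # g).
  rewrite -> (mul1r (yact Y (gr x) a)).
  apply: etrans (FE _ _ _ _ hf (tgen_mul_homog x hb)) _.
  exact: (congr1 (fun h => f (yact Y (gr x) a # h) ((tgen k x * b) # g))
    (esym (addrA (gr x) d g))).
rewrite -> E1, E2, (FE f' d a b hf' hb); rewrite /f'.
have M1 (u : {malg k[{fmonom X}]}) h :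
  bmul (tgen k x # 0) (u # h) = (tgen k x * u) # h.
  by rewrite tbos_mul (tact0 u) add0r.
have M2 h : bmul (1 # gr x) (a # h) = yact Y (gr x) a # (gr x + h).
  exact: etrans (tbos_mul _ _ _ _) (congr1 (fun u => u # (gr x + h)) (mul1r (yact Y (gr x) a))).
rewrite -> (M1 a (d + g)), (M1 b g), (M2 (d + g)).
reflexivity.
Qed.

End TensorAlgebra.

(* Interface of the bosonization of a tensor algebra: [gen x] is the generator
   [x # 1], [grp g] is [1 # g] and [wd s g] is [s # g] for a word [s]. *)
Record is_free_bos {k : fieldType} {G : zmodType} {X : choiceType}
    (gr : X -> G) (chi : X -> G -> k) (T : bialg_sig k)
    (gen : X -> T) (grp : G -> T) (wd : seq X -> G -> T) : Prop := IsFreeBos {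
  fb_alg : is_alg T;
  fb_comul : linear (@bcomul k T);
  fb_counit : linear (@eps k T : T -> klm k);
  eq_lin_fb : forall (W : lmodType k) (f h : T -> W), linear f -> linear h ->
    (forall s g, f (wd s g) = h (wd s g)) -> forall z, f z = h z;
  fb_lift : forall (B : bialg_sig k) (y : X -> B) (c : G -> B), is_alg B ->
    c 0 = bone B -> (forall g h, c (g + h) = bmul (c g) (c h)) ->
    (forall g x, bmul (c g) (y x) = chi x g *: bmul (y x) (c g)) ->
    exists F : T -> B, [/\ alg_hom F, forall x, F (gen x) = y x
      & forall g, F (grp g) = c g];
  fb_nil : forall g, wd [::] g = grp g;
  fb_cons : forall x s g, wd (x :: s) g = bmul (gen x) (wd s g);
  fb_one : bone T = grp 0;
  fb_grpD : forall g h, grp (g + h) = bmul (grp g) (grp h);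
  fb_grp_wd : forall g s h, exists a : k, bmul (grp g) (wd s h) = a *: wd s (g + h);
  fb_grp_gen : forall g x, bmul (grp g) (gen x) = chi x g *: bmul (gen x) (grp g);
  fb_sw_gen : forall (W : lmodType k) (f : T -> T -> W) x (z : T), bilin f ->
    sweedler f (bmul (gen x) z)
    = \sw_(z1, z2 <- z) (f (bmul (gen x) z1) z2
        + f (bmul (grp (gr x)) z1) (bmul (gen x) z2));
  fb_sw_grp : forall (W : lmodType k) (f : T -> T -> W) g, bilin f ->
    sweedler f (grp g) = f (grp g) (grp g);
  fb_eps : forall s g, eps (wd s g) = (s == [::])%:R }.

Section TensorBosonization.
Context {k : fieldType} {G : zmodType} {X : choiceType}.
Variables (gr : X -> G) (chi : X -> G -> k).
Hypothesis hchi : forall x, is_char (chi x).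
Local Notation TA := (tensor_alg gr chi).
Local Notation Y := (yd_tensor_alg gr chi).
Local Notation T := (bosonization (R := TA) Y).
Local Notation "f # g" := (smash (R := TA) Y f g) (at level 39).
Local Notation TX := {malg k[{fmonom X}]}.

Let hT := @smash_bilin k G TA Y (tensor_alg_alg gr chi) (lin_tact gr chi).
Let hs g : linear (fun a : TX => a # g) := @lin_smashc k G TA Y TX (fun a => a) g (@lin_id _ _).

Lemma eq_lin_tbos (W : lmodType k) (f h : T -> W) : linear f -> linear h ->
  (forall s g, f (word s # g) = h (word s # g)) -> forall z, f z = h z.
Proof.
move=> hf hh fh; refine (eq_lin_smash hf hh _) => a g; move: a.
exact: (eq_lin_word (lin_comp hf (hs g)) (lin_comp hh (hs g))).
Qed.

(** The map is a # g |-> ev(a) c(g). The relation between [c] and [y] extends along words to c(g)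
    ev(b) = ev(g . b) c(g), which is the multiplication rule of the smash product. *)
Lemma tbos_lift (B : bialg_sig k) (y : X -> B) (c : G -> B) : is_alg B ->
  c 0 = bone B -> (forall g h, c (g + h) = bmul (c g) (c h)) ->
  (forall g x, bmul (c g) (y x) = chi x g *: bmul (y x) (c g)) ->
  exists F : T -> B, [/\ alg_hom F, forall x, F (tgen k x # 0) = y x
    & forall g, F (1 # g) = c g].
Proof.
move=> hB c0 cD cy; have hm := alg_bilin hB; have [_ mA m1 mr1] := hB.
have hev := lin_eval y.
have hb : bilin (fun (a : TX) (u : {malg k[G]}) =>
    mlift (fun g => bmul (tensor_eval y a) (c g)) u) by lin.
have hF := tlift_linear hb.
exists (tlift (fun (a : TX) (u : {malg k[G]}) =>
    mlift (fun g => bmul (tensor_eval y a) (c g)) u)).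
set F := tlift _ in hF *.
have FE a g : F (a # g) = bmul (tensor_eval y a) (c g).
  by apply: etrans (tlift_tens hb _ _) _; exact: mliftU.
have cev g : forall b, bmul (c g) (tensor_eval y b)
    = bmul (tensor_eval y (yact Y g b)) (c g).
  refine (eq_lin_word (lin_comp (hm.1 _) hev)
    (lin_comp (hm.2 _) (lin_comp hev (lin_tact gr chi g))) _) => s.
  rewrite tact_word (linZ _ _ hev) (linZ (f := fun b => bmul b _) _ _ (hm.2 _)).
  rewrite eval_word; elim: s => [|x s ih] /=; first by rewrite big_nil scale1r mr1 m1.
  rewrite mA cy (linZ (f := fun b => bmul b _) _ _ (hm.2 _)) -mA ih.
  by rewrite (linZ _ _ (hm.1 _)) scalerA big_cons mA.
split; last first.
- by move=> g; rewrite FE (eval1 y) m1.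
- by move=> x; rewrite FE (eval_gen hB y) c0 mr1.
split; [exact: hF| |].
  by apply: etrans (FE _ _) _; rewrite (eval1 y) c0 m1.
move=> z w; move: z; refine (eq_lin_smash _ _ _) => [||a g].
- exact: (lin_comp hF (hT.2 w)).
- exact: (lin_comp (hm.2 _) hF).
move: w; refine (eq_lin_smash _ _ _) => [||b h].
- exact: (lin_comp hF (hT.1 _)).
- exact: (lin_comp (hm.1 _) hF).
rewrite -> (@tbos_mul k G X gr chi a g b h), (FE _ (g + h)), (FE a g), (FE b h).
apply: etrans (congr1 (fun u => bmul u (c (g + h))) (evalM hB y a (yact Y g b))) _.
rewrite -> cD.
by rewrite -!mA; congr (bmul _ _); rewrite mA -cev mA.
Qed.

Lemma tbos_free : is_free_bos gr chi (T := T) (fun x => tgen k x # 0)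
  (fun g => 1 # g) (fun s g => word s # g).
Proof.
split.
- exact: tbos_alg.
- exact: lin_tbos_comul.
- exact: lin_tbos_counit.
- exact: eq_lin_tbos.
- exact: tbos_lift.
- by move=> g; rewrite -word1.
- by move=> x s g; rewrite (@tgen_smash k G X gr chi hchi).
- by [].
- move=> g h; apply: etrans _ (esym (@tbos_mul k G X gr chi _ _ _ _)).
  have -> : yact Y g (1 : TX) = 1 by exact: tact1.
  by rewrite mul1r.
- move=> g s h; exists (\prod_(x <- s) chi x g).
  apply: etrans (@tbos_mul k G X gr chi _ _ _ _) _; rewrite tact_word.
  have -> : (1 : TX) * (\prod_(x <- s) chi x g *: word s) = \prod_(x <- s) chi x g *: word s.
    exact: mul1r.
  exact: (linZ _ _ (hs _)).
- move=> g x.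
  have a1 : (1 : TX) * yact Y g (tgen k x) = chi x g *: tgen k x.
    by rewrite wordU [LHS]mul1r tact_word big_seq1.
  have a2 : tgen k x * yact Y 0 1 = tgen k x.
    by have -> : yact Y 0 (1 : TX) = 1; [exact: tact1|rewrite mulr1].
  apply: etrans (@tbos_mul k G X gr chi _ _ _ _) _.
  apply: etrans (congr2 (smash (R := TA) Y) a1 (addr0 g)) _.
  apply: etrans (linZ _ _ (hs _)) _; congr (_ *: _); apply: esym.
  apply: etrans (@tbos_mul k G X gr chi _ _ _ _) _.
  exact: (congr2 (smash (R := TA) Y) a2 (add0r g)).
- exact: tbos_sw_gen.
- exact: tbos_sw_grp.
- move=> s g; apply: etrans (@tbos_counitE k G X gr chi (word s) g) _.
  rewrite mcoeffU1; congr (_%:R); rewrite -[mone]/(fmone X) fmoneE.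
  by rewrite -val_eqE.
Qed.

End TensorBosonization.

(** * Homomorphisms out of the bosonized tensor algebra *)

Section FreeBosonization.
Context {k : fieldType} {G : zmodType} {X : choiceType}.
Context {gr : X -> G} {chi : X -> G -> k} {T : bialg_sig k}.
Context {gen : X -> T} {grp : G -> T} {wd : seq X -> G -> T}.
Hypothesis hT : is_free_bos gr chi gen grp wd.

Let hm := alg_bilin (fb_alg hT).
Let hD := fb_comul hT.
Let he := fb_counit hT.

(** In the coproduct of a word the only term whose left leg has full length is [wd s g \ox grp g];
    each recursion step puts the new generator either on the left leg or on the right one, and the
    latter terms have shorter left legs up to a scalar. *)
Lemma fb_lead (W : lmodType k) (f : T -> T -> W) s g : bilin f ->
  (forall t h z, (size t < size s)%N -> f (wd t h) z = 0) ->
  sweedler f (wd s g) = f (wd s g) (grp g).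
Proof.
elim: s f => [|x s ih] f hf f0; first by rewrite !(fb_nil hT) (fb_sw_grp hT).
pose f' z1 z2 := f (bmul (gen x) z1) z2 + f (bmul (grp (gr x)) z1) (bmul (gen x) z2).
have hf' : bilin f' by rewrite /f'; lin.
have f2 t h z : (size t <= size s)%N -> f (bmul (grp (gr x)) (wd t h)) z = 0.
  move=> ts; have [a ->] := fb_grp_wd hT (gr x) t h.
  by rewrite (linZ (f := fun u => f u z)) ?f0 ?scaler0 //; exact: hf.2.
rewrite !(fb_cons hT) (fb_sw_gen hT) // -/(sweedler f' _) ih //.
  by rewrite /f' f2 // addr0.
by move=> t h z ts; rewrite /f' f2 ?addr0 -?(fb_cons hT) ?f0 // ltnW.
Qed.

Section Morphism.
Context {B : bialg_sig k} (hB : is_bialg B) {F : T -> B} (hF : alg_hom F).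
Let hmB := alg_bilin (bialg_alg hB).
Let hcB := bialg_coalg hB.
Let hDB := coalg_comul hcB.
Let heB := coalg_counit hcB.
Let hl : linear F. Proof. by case: hF. Qed.

Lemma tlift_tmap (W : lmodType k) (f : B -> B -> W) t : bilin f ->
  tlift f (tmap F F t) = tlift (fun x y => f (F x) (F y)) t.
Proof.
move=> hf; rewrite /tmap (tlift_comp _ _ (tlift_linear hf)).
by apply: eq_tlift => x y; rewrite tlift_tens.
Qed.

(** Induction on words: the coproduct is multiplicative in [B], and in [T] it obeys the same
    recursion when a generator is prepended. *)
Lemma fb_coalg_hom :
  (forall g, bcomul (F (grp g)) = F (grp g) \ox F (grp g)) ->
  (forall g, eps (F (grp g)) = 1) ->
  (forall x, bcomul (F (gen x))
     = F (gen x) \ox bone B + F (grp (gr x)) \ox F (gen x)) ->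
  (forall x, eps (F (gen x)) = 0) -> coalg_hom F.
Proof.
case: hF => _ F1 FM hgrp egrp hgen egen; split.
  have h2 : linear (fun z => tmap F F (bcomul z)).
    exact: (lin_comp (lin_tmap hl hl) hD).
  refine (eq_lin_fb hT (lin_comp hDB hl) h2 _) => s g; elim: s => [|x s ih].
    by rewrite (fb_nil hT) sw_tmap (fb_sw_grp hT) ?hgrp //; lin.
  rewrite (fb_cons hT) FM sw_tmap (fb_sw_gen hT); last by lin.
  rewrite -[LHS]tlift_id.
  rewrite -[LHS]/(sweedler (fun v w => v \ox w) _) (sw_mul hB); last by lin.
  rewrite /sweedler hgen; set z := wd s g in ih *.
  pose h u v := tlift (fun a b => bmul u a \ox bmul v b) (bcomul (F z)).
  have hh : bilin h by rewrite /h; lin.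
  rewrite -[LHS]/(tlift h _) (linD _ _ (tlift_linear hh)) !(tlift_tens hh) /h ih.
  rewrite !tlift_tmap; [|by lin|by lin].
  rewrite -[LHS]tliftD.
  by apply: eq_tlift => a b; rewrite !FM (bmul1l hB).
have hz : linear (fun z : T => eps (F z) : klm k) by lin.
refine (eq_lin_fb hT hz he _) => s g; rewrite (fb_eps hT); case: s => [|x s].
  by rewrite (fb_nil hT) egrp.
by rewrite (fb_cons hT) FM (epsM hB) egen mul0r.
Qed.

Hypothesis hFc : coalg_hom F.
Context {S : T -> T} (hS : is_antipode S) {S' : B -> B} (hS' : is_antipode S').

(** With d = F S - S' F, the convolution product of [d] with [F] vanishes. By induction on the
    length of a word, [d] is zero on shorter words, so by [fb_lead] only the leading term
    [d (wd s g)] times [F (grp g)] is left; the second factor is invertible. *)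
Lemma fb_antipode z : F (S z) = S' (F z).
Proof.
case: hF => _ F1 FM; case: hFc => FD Fe.
have hlS := lin_antipode hS; have hlS' := lin_antipode hS'.
have [_ mA m1 mr1] := bialg_alg hB.
pose d z := F (S z) - S' (F z).
have hd : linear d by rewrite /d; lin.
pose f z1 z2 := bmul (d z1) (F z2).
have hf : bilin f by rewrite /f; lin.
have f0 u : sweedler f u = 0.
  transitivity (\sw_(x, y <- u) F (bmul (S x) y) - \sw_(x, y <- u) bmul (S' (F x)) (F y)).
    rewrite (sw_comp _ _ (L := fun w => - w)); last by lin.
    rewrite -sw_add; apply: eq_sw => x y.
    by rewrite /f /d (linB (f := fun u => bmul u (F y))) ?FM //; exact: hmB.2.
  rewrite -(sw_comp _ _ hl) (sw_antipodel hS) -(sw_hom (p := F) (f := fun x y => bmul (S' x) y)).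
  - by rewrite (sw_antipodel hS') (linZ _ _ hl) F1 Fe subrr.
  - exact: hFc.
  - by lin.
suff h u : d u = 0 by apply/eqP; rewrite -subr_eq0 -[_ - _]/(d z) h.
move: u; refine (eq_lin_fb hT hd (@lin_zero _ _ _) _) => s.
have [n] := ubnP (size s); elim: n s => // n ih s /ltnSE sn g.
have := f0 (wd s g); rewrite (fb_lead _ hf) => [|t h v ts]; last first.
  by rewrite /f ih ?(lin0 (f := fun u => bmul u _)) //; [exact: hmB.2|exact: leq_trans ts sn].
rewrite /f => /(congr1 (fun u => bmul u (F (grp (- g))))).
rewrite -mA -FM -(fb_grpD hT) subrr -(fb_one hT) F1 mr1 => ->.
by rewrite (lin0 (f := fun u => bmul u _)) //; exact: hmB.2.
Qed.

End Morphism.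
End FreeBosonization.

Lemma malg_int_ind (X : choiceType) (U : {malg int[X]} -> Prop) :
  U 0 -> (forall a b, U a -> U b -> U (a + b)) -> (forall a, U a -> U (- a)) ->
  (forall x, U << x >>) -> forall a, U a.
Proof.
move=> U0 UD UN UX a; rewrite [a]monalgE.
apply: (big_ind U) => // x _; move: (a@_x) => {a} z.
have Un n : U << n%:Z *g x >>.
  elim: n => [|n ih]; first by rewrite monalgU0.
  by rewrite -addn1 PoszD monalgUD; apply: UD.
by case: z => n; [exact: Un|rewrite NegzE monalgUN; apply: UN].
Qed.

(** * Pre-Nichols algebras *)

Section PreNichols.
Context {k : fieldType} {G : zmodType} {X : choiceType}.
Context {gr : X -> G} {chi : X -> G -> k}.
Context {R : bialg_sig k} {Y : yd_sig G R} {nu : nat -> R -> R}.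
Context {iota : {malg k[X]} -> R}.
Hypothesis hPN : is_pre_nichols (yd_diag gr chi) Y nu iota.
Local Notation c := (ycomp Y).
Local Notation y := (fun x => iota << x >>).
Local Notation ev := (tensor_eval y).

Lemma pn_bb : is_braided_bialg Y. Proof. by case: hPN => -[]. Qed.
Lemma pn_graded : is_graded_bialg Y nu. Proof. by case: hPN => -[]. Qed.
Lemma pn_conn a : homog nu 0%N a -> exists c : k, a = c *: bone R.
Proof. by case: hPN => -[_ _ h] _; exact: h. Qed.
Lemma lin_iota : linear iota. Proof. by case: hPN => _ [[h _ _]]. Qed.

Lemma pn_act g x : yact Y g (iota << x >>) = chi x g *: iota << x >>.
Proof.
case: hPN => _ [[hl h _] _ _ _].
by rewrite -h diag_actU (linZ _ _ hl).
Qed.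

Lemma pn_homog x : homog c (gr x) (iota << x >>).
Proof. by case: hPN => _ [[_ _ h] _ _ _]; apply/h/diag_homog. Qed.

Let hm := alg_bilin (bb_alg pn_bb).
Let hc := bb_coalg pn_bb.
Let hD := coalg_comul hc.
Let he := coalg_counit hc.

Lemma pn_nu1 x : homog nu 1%N (iota << x >>).
Proof. by case: hPN => _ [_ _ h _]; apply/h; exists << x >>. Qed.

Lemma pn_eps x : eps (iota << x >>) = 0.
Proof. by case: pn_graded => _ [_ _ _ h]; apply: (h 1%N) => //; exact: pn_nu1. Qed.

(** In total degree 1 only bidegrees (0,1) and (1,0) occur. Their degree-0 legs are scalar multiples
    of the unit, hence determined by the counit. *)
Lemma pn_comul x : bcomul (iota << x >>)
  = iota << x >> \ox bone R + bone R \ox iota << x >>.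
Proof.
rewrite -[LHS]tlift_id -[LHS]/(sweedler (fun v w => v \ox w) _).
transitivity (\sw_(v, w <- iota << x >>)
  (eps w *: (v \ox bone R) + eps v *: (bone R \ox w))).
  apply: (eq_sw_graded pn_graded (pn_nu1 x)) => [||i v w]; [by lin|by lin|].
  have ea a : eps (a *: bone R) = a.
    by rewrite (linZ _ _ he) -[LHS]/(a * eps (bone R)) (bb_counit1 pn_bb) mulr1.
  have e0 u : homog nu 1%N u -> eps u = 0.
    by move=> hu; case: pn_graded => _ [_ _ _ h]; apply: (h 1%N).
  case: i => [|[|//]] _ hv hw.
    have [a ->] := pn_conn hv; rewrite ea (e0 _ hw).
    by rewrite scale0r add0r; apply: (linZ (f := fun v => v \ox w)); lin.
  have [a ->] := pn_conn hw; rewrite ea (e0 _ hv).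
  by rewrite scale0r addr0; apply: (linZ (f := fun w => v \ox w)); lin.
apply: etrans (sw_add _ _ _) _; congr (_ + _).
  by apply: (sw_counitr hc (f := fun v => v \ox bone R)); lin.
by apply: (sw_counitl hc (f := fun v => bone R \ox v)); lin.
Qed.

(** Generation by R(1), as an induction principle by left multiplication. It follows from generation
    as an algebra: the elements whose left multiplication preserves [U] form a subalgebra. *)
Lemma pn_ind (U : set R) : subspace U -> U (bone R) ->
  (forall x a, U a -> U (bmul (iota << x >>) a)) -> forall a, U a.
Proof.
move=> hU U1 UM a.
have [_ mA m1 mr1] := bb_alg pn_bb.
pose V := [set f | forall b, U b -> U (bmul f b)]%classic.
suff : V a by move=> /(_ _ U1); rewrite mr1.
case: hPN => _ [[hl _ _] _ _ gen]; apply: (gen V).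
- split=> [b _|z u v hu hv b hb].
    by rewrite (lin0 (f := fun u => bmul u b) (hm.2 b)); exact: hU.1.
  by rewrite [bmul _ _](hm.2 b z u v); apply: hU.2; [exact: hu|exact: hv].
- by move=> b hb; rewrite m1.
- by move=> u v hu hv b hb; rewrite -mA; apply/hu/hv.
- move=> v b hb; rewrite [v]monalgE (lin_big _ _ _ hl) (lin_big (f := fun u => bmul u b) _ _ _ (hm.2 b)).
  elim/big_ind: _ => [|u w hu hw|x _]; first exact: hU.1.
    exact: (subspaceD hU).
  rewrite malgZU (linZ _ _ hl) (linZ (f := fun u => bmul u b) _ _ (hm.2 b)).
  by apply: (subspaceZ _ hU); exact: UM.
Qed.

Lemma pn_surj a : exists f, ev f = a.
Proof.
have hl := lin_eval y; have hR := bb_alg pn_bb.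
have h : subspace [set a | exists f, ev f = a]%classic.
  split=> [|b u v [f <-] [g <-]]; first by exists 0; rewrite (lin0 hl).
  by exists (b *: f + g); rewrite hl.
apply: (pn_ind h) => [|x b [f <-]]; first by exists 1; exact: eval1.
by exists (tgen k x * f); rewrite (evalM hR) (eval_gen hR).
Qed.

End PreNichols.

(** * Pairings of bosonizations and the relations in their double *)

Section BosonizationForms.
Context {k : fieldType} {G : zmodType} {R : bialg_sig k} {Y : yd_sig G R}.
Hypothesis hR : is_braided_bialg Y.
Local Notation H := (bosonization Y).
Local Notation c := (ycomp Y).
Local Notation "a # g" := (smash Y a g) (at level 39).

Let hg := bb_grading hR.
Let hcR := bb_coalg hR.
Let hD := coalg_comul hcR.
Let he := coalg_counit hcR.
Let hH := smash_bialg hR.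
Let hcH := bialg_coalg hH.
Let heH := coalg_counit hcH.
Let hs g : linear (fun a : R => a # g) := @lin_smashc k G R Y R (fun a => a) g (@lin_id _ _).

Lemma bos_sw_grp (W : lmodType k) (f : H -> H -> W) g : bilin f ->
  sweedler f (bone R # g) = f (bone R # g) (bone R # g).
Proof.
move=> hf; rewrite (sw_smash hR _ _ hf) /sweedler (bb_comul1 hR).
rewrite tlift_tens; last by lin.
by rewrite (gsum_homog hg _ (bb_one_homog hR)) ?add0r; [|lin].
Qed.

Lemma bos_grpD g h : bmul (bone R # g) (bone R # h) = bone R # (g + h).
Proof. by rewrite (bos_mulE hR) (bb_act1 hR) ?(let: And4 _ _ h _ := bb_alg hR in h). Qed.

Lemma bos_split a g : bmul (a # 0) (bone R # g) = a # g.
Proof. by rewrite (bos_mulE hR) (bb_act1 hR) add0r ?(let: And4 _ _ _ h := bb_alg hR in h). Qed.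

Lemma bos_sw_prim (W : lmodType k) (f : H -> H -> W) x d g : bilin f ->
  homog c d x -> bcomul x = x \ox bone R + bone R \ox x ->
  sweedler f (x # g) = f (x # g) (bone R # g) + f (bone R # (d + g)) (x # g).
Proof.
move=> hf hx Dx; rewrite (sw_smash hR _ _ hf) /sweedler Dx.
set F := fun u v => _.
have hF : bilin F by rewrite /F; lin.
rewrite (linD _ _ (tlift_linear hF)) !(tlift_tens hF) /F.
rewrite (gsum_homog hg _ (bb_one_homog hR)) ?add0r; last by lin.
by rewrite (gsum_homog hg _ hx); last by lin.
Qed.

Lemma bos_sw_prim0 (W : lmodType k) (f : H -> H -> W) x d : bilin f ->
  homog c d x -> bcomul x = x \ox bone R + bone R \ox x ->
  sweedler f (x # 0) = f (x # 0) (bone R # 0) + f (bone R # d) (x # 0).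
Proof.
move=> hf hx Dx; apply: etrans (bos_sw_prim 0 hf hx Dx) _.
exact: (congr1 (fun d => _ + f (bone R # d) (x # 0)) (addr0 d)).
Qed.

Variables (p : H -> klm k) (hp : linear p) (rho : G -> k).
Hypothesis pE : forall a g, p (a # g) = eps a * rho g.

(** A form eps ⊗ rho kills everything on its leg but the group coordinate. On the right leg this
    coordinate is [u]; on the left leg ([bos_form_l]) it is [u] shifted by the degree of the right
    leg, which accounts for the extra factor [rho d]. *)
Lemma bos_form_r (W : lmodType k) (L : H -> W) a u : linear L ->
  (\sw_(x, y <- a # u) (p y : k) *: L x) = rho u *: L (a # u).
Proof.
move=> hL; rewrite -(sw_counitr hcH (a # u) hL).
rewrite (sw_comp _ _ (L := fun w => rho u *: w)); last by lin.
rewrite (sw_smash hR); last by lin.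
rewrite [RHS](sw_smash hR); last by lin.
apply: eq_sw => x y; congr (gsum _ _ _); apply/funext => h; apply/funext => z.
by rewrite pE (smash_counitE hR) scalerA mulrC.
Qed.

Lemma bos_form_l (W : lmodType k) (L : H -> W) a d u : linear L ->
  (forall g h, rho (g + h) = rho g * rho h) -> homog c d a ->
  (\sw_(x, y <- a # u) (p x : k) *: L y) = (rho d * rho u) *: L (a # u).
Proof.
move=> hL rD ha; rewrite (sw_smash hR); last by lin.
pose F (b : R) : W := gsum c (fun h y => rho (h + u) *: L (y # u)) b.
have hF : linear F by rewrite /F; lin.
transitivity (F a); last first.
  by rewrite /F (gsum_homog hg _ ha) ?rD //; lin.
rewrite -[RHS](sw_counitl hcR _ hF); apply: eq_sw => x y.
rewrite /F (gsum_comp _ hg (L := fun w => eps x *: w)); [|by lin|by lin].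
congr (gsum _ _ _); apply/funext => h; apply/funext => z.
by rewrite pE scalerA.
Qed.

End BosonizationForms.

Section BosonizationPairing.
Context {k : fieldType} {Ga Gb : zmodType} {Xa Xb : choiceType}.
Context {gra : Xa -> Ga} {chia : Xa -> Ga -> k} {grb : Xb -> Gb} {chib : Xb -> Gb -> k}.
Context {Ra Rb : bialg_sig k} {Ya : yd_sig Ga Ra} {Yb : yd_sig Gb Rb}.
Context {nua : nat -> Ra -> Ra} {nub : nat -> Rb -> Rb}.
Context {ia : {malg k[Xa]} -> Ra} {ib : {malg k[Xb]} -> Rb}.
Hypothesis hPa : is_pre_nichols (yd_diag gra chia) Ya nua ia.
Hypothesis hPb : is_pre_nichols (yd_diag grb chib) Yb nub ib.
Local Notation A := (bosonization Ya).
Local Notation B := (bosonization Yb).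
Context {tau : tensor A B -> k^o} (htau : is_skew_pairing tau).
Local Notation ta := (spair (tau := tau)).
Local Notation "a #a g" := (smash Ya a g) (at level 39).
Local Notation "a #b g" := (smash Yb a g) (at level 39).

Let ha := pn_bb hPa.
Let hb := pn_bb hPb.
Let hA := smash_bialg ha.
Let hB := smash_bialg hb.
Let hta := spair_bilin htau.
Let hsa g : linear (fun a : Ra => a #a g) := @lin_smashc k Ga Ra Ya Ra (fun a => a) g (@lin_id _ _).
Let hsb g : linear (fun a : Rb => a #b g) := @lin_smashc k Gb Rb Yb Rb (fun a => a) g (@lin_id _ _).
Let hea := coalg_counit (bb_coalg ha).
Let heb := coalg_counit (bb_coalg hb).

Let hfB (a a' : A) : bilin (fun x y : B => ta a x * ta a' y : klm k).
Proof. by split=> z; [apply: lin_mulr|apply: lin_mull]; lin. Qed.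
Let hfA (x x' : B) : bilin (fun a a' : A => ta a x * ta a' x' : klm k).
Proof. by split=> z; [apply: lin_mulr|apply: lin_mull]; lin. Qed.

Lemma pair_mul_grp a a' g :
  ta (bmul a a') (bone Rb #b g) = ta a (bone Rb #b g) * ta a' (bone Rb #b g).
Proof. exact: etrans (spairMl htau _ _ _) (bos_sw_grp hb _ (hfB _ _)). Qed.

Lemma pair_grp_mul a x x' :
  ta (bone Ra #a a) (bmul x x') = ta (bone Ra #a a) x' * ta (bone Ra #a a) x.
Proof. exact: etrans (spairMr htau _ _ _) (bos_sw_grp ha _ (hfA _ _)). Qed.

Definition grp_pair (a : Ga) (g : Gb) : k := ta (bone Ra #a a) (bone Rb #b g).
Local Notation beta := grp_pair.

Lemma grp_pairDl a a' g : beta (a + a') g = beta a g * beta a' g.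
Proof.
rewrite /beta; rewrite <- (bos_grpD ha a a'); exact: pair_mul_grp.
Qed.

Lemma grp_pairDr a g g' : beta a (g + g') = beta a g * beta a g'.
Proof.
rewrite /beta; rewrite <- (bos_grpD hb g g').
exact: etrans (pair_grp_mul _ _ _) (mulrC _ _).
Qed.

Lemma grp_pair0l g : beta 0 g = 1.
Proof. exact: etrans (spair1l htau _) (etrans (smash_counitE hb _ _) (bb_counit1 hb)). Qed.

Lemma grp_pair0r a : beta a 0 = 1.
Proof. exact: etrans (spair1r htau _) (etrans (smash_counitE ha _ _) (bb_counit1 ha)). Qed.

(** Pairing against a grouplike is multiplicative in the other argument, so it is fixed by the
    generators, where it vanishes on R(1); [pair_grp_bos] is the mirror case. *)
Lemma pair_bos_grp :
  (forall x g, ta (ia << x >> #a 0) (bone Rb #b g) = 0) ->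
  forall b a g, ta (b #a a) (bone Rb #b g) = eps b * beta a g.
Proof.
move=> h b a g.
have h1 : linear (fun b => ta (b #a a) (bone Rb #b g) : klm k).
  exact: (lin_bilc _ hta (hsa a)).
have h2 : linear (fun b : Ra => eps b * beta a g : klm k) by exact: lin_mull.
apply: (pn_ind hPa (subspace_eq h1 h2)) => [|x {}b _] /=.
  by rewrite (bb_counit1 ha) mul1r.
have -> : bmul (ia << x >>) b #a a = bmul (ia << x >> #a 0) (b #a a).
  by rewrite (bos_mulE ha) (bb_act0 ha) add0r.
rewrite pair_mul_grp.
rewrite -> (h x g), (bb_counitM ha), (pn_eps hPa); rewrite !mul0r; reflexivity.
Qed.

Lemma pair_grp_bos :
  (forall x a, ta (bone Ra #a a) (ib << x >> #b 0) = 0) ->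
  forall b a g, ta (bone Ra #a a) (b #b g) = eps b * beta a g.
Proof.
move=> h b a g.
have h1 : linear (fun b => ta (bone Ra #a a) (b #b g) : klm k).
  exact: (lin_comp (hta.1 _) (hsb g)).
have h2 : linear (fun b : Rb => eps b * beta a g : klm k) by exact: lin_mull.
apply: (pn_ind hPb (subspace_eq h1 h2)) => [|x {}b _] /=.
  by rewrite (bb_counit1 hb) mul1r.
have -> : bmul (ib << x >>) b #b g = bmul (ib << x >> #b 0) (b #b g).
  by rewrite (bos_mulE hb) (bb_act0 hb) add0r.
rewrite pair_grp_mul.
rewrite -> (h x a), (bb_counitM hb), (pn_eps hPb); rewrite mulr0 !mul0r; reflexivity.
Qed.

(** As x # 0 is skew-primitive, pairing it with group elements is a derivation twisted by [beta].
    Vanishing on the generators of the group therefore propagates to the whole group. *)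
Lemma pair_grp_genD x a a' :
  ta (bone Ra #a (a + a')) (ib << x >> #b 0)
  = ta (bone Ra #a a) (ib << x >> #b 0)
    + beta a (grb x) * ta (bone Ra #a a') (ib << x >> #b 0).
Proof.
rewrite <- (bos_grpD ha a a'); apply: etrans (spairMl htau _ _ _) _.
apply: etrans (bos_sw_prim hb 0 (hfB _ _) (pn_homog hPb x) (pn_comul hPb x)) _.
rewrite addr0; congr (_ + _).
have e : ta (bone Ra #a a') (bone Rb #b 0) = 1.
  exact: etrans (spair1r htau _) (etrans (smash_counitE ha _ _) (bb_counit1 ha)).
rewrite -> e; exact: mulr1.
Qed.

Lemma pair_grp_gen0 x : ta (bone Ra #a 0) (ib << x >> #b 0) = 0.
Proof. exact: etrans (spair1l htau _) (etrans (smash_counitE hb _ _) (pn_eps hPb x)). Qed.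

End BosonizationPairing.

(* Generators and relations of the double of two bosonizations [Ra # kGa] and
   [Rb # kGb]; every element is a combination of products [em b (gm a (ep c (gp g)))]. *)
Record is_bos_double {k : fieldType} {Ga Gb : zmodType} {Xa Xb : choiceType}
    (gra : Xa -> Ga) (grb : Xb -> Gb)
    {Ra Rb : bialg_sig k} (Ya : yd_sig Ga Ra) (Yb : yd_sig Gb Rb)
    (ya : Xa -> Ra) (yb : Xb -> Rb) (beta : Ga -> Gb -> k) (mu : Xa -> Xb -> k)
    (D : bialg_sig k) (em : Ra -> D) (gm : Ga -> D) (ep : Rb -> D) (gp : Gb -> D) : Prop
  := IsBosDouble {
  bd_bialg : is_bialg D;
  bd_antipode : exists S : D -> D, is_antipode S;
  bd_em : alg_hom em;
  bd_ep : alg_hom ep;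
  bd_gm0 : gm 0 = bone D;
  bd_gp0 : gp 0 = bone D;
  bd_gmD : forall a a', gm (a + a') = bmul (gm a) (gm a');
  bd_gpD : forall g g', gp (g + g') = bmul (gp g) (gp g');
  bd_gm_em : forall a b, bmul (gm a) (em b) = bmul (em (yact Ya a b)) (gm a);
  bd_gp_ep : forall g c, bmul (gp g) (ep c) = bmul (ep (yact Yb g c)) (gp g);
  bd_gp_em : forall g d b, homog (ycomp Ya) d b ->
    bmul (gp g) (em b) = beta d g *: bmul (em b) (gp g);
  bd_ep_gm : forall a d c, homog (ycomp Yb) d c ->
    bmul (ep c) (gm a) = beta a d *: bmul (gm a) (ep c);
  bd_gp_gm : forall a g, bmul (gp g) (gm a) = bmul (gm a) (gp g);
  bd_ep_em : forall j i, bmul (ep (yb i)) (em (ya j))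
    = beta (gra j) (grb i) *: bmul (em (ya j)) (ep (yb i))
      + mu j i *: (bone D - bmul (gm (gra j)) (gp (grb i)));
  bd_comul_gm : forall a, bcomul (gm a) = gm a \ox gm a;
  bd_comul_gp : forall g, bcomul (gp g) = gp g \ox gp g;
  bd_comul_em : forall j, bcomul (em (ya j))
    = em (ya j) \ox bone D + gm (gra j) \ox em (ya j);
  bd_comul_ep : forall i, bcomul (ep (yb i))
    = ep (yb i) \ox bone D + gp (grb i) \ox ep (yb i);
  bd_eps_gm : forall a, eps (gm a) = 1;
  bd_eps_gp : forall g, eps (gp g) = 1;
  bd_eps_em : forall j, eps (em (ya j)) = 0;
  bd_eps_ep : forall i, eps (ep (yb i)) = 0;
  eq_lin_bd : forall (W : lmodType k) (f h : D -> W), linear f -> linear h ->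
    (forall b a c g, f (bmul (em b) (bmul (gm a) (bmul (ep c) (gp g))))
       = h (bmul (em b) (bmul (gm a) (bmul (ep c) (gp g))))) -> forall d, f d = h d;
  bd_lift : forall (W : lmodType k) (f : Ra -> Ga -> Rb -> Gb -> W),
    (forall a g, bilin (fun b c => f b a c g)) ->
    exists2 h : D -> W, linear h
      & forall b a c g, h (bmul (em b) (bmul (gm a) (bmul (ep c) (gp g)))) = f b a c g }.

Section BosonizationDouble.
Context {k : fieldType} {Ga Gb : zmodType} {Xa Xb : choiceType}.
Context {gra : Xa -> Ga} {chia : Xa -> Ga -> k} {grb : Xb -> Gb} {chib : Xb -> Gb -> k}.
Context {Ra Rb : bialg_sig k} {Ya : yd_sig Ga Ra} {Yb : yd_sig Gb Rb}.
Context {nua : nat -> Ra -> Ra} {nub : nat -> Rb -> Rb}.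
Context {ia : {malg k[Xa]} -> Ra} {ib : {malg k[Xb]} -> Rb}.
Hypothesis hPa : is_pre_nichols (yd_diag gra chia) Ya nua ia.
Hypothesis hPb : is_pre_nichols (yd_diag grb chib) Yb nub ib.
Local Notation A := (bosonization Ya).
Local Notation B := (bosonization Yb).
Context {tau : tensor A B -> k^o} (htau : is_skew_pairing tau).
Context {SA : A -> A} (hSA : is_antipode SA) {SB : B -> B} (hSB : is_antipode SB).
Local Notation ta := (spair (tau := tau)).
Local Notation ti := (spair_inv (tau := tau) (S := SA)).
Context {D : bialg_sig k} {dt : A -> B -> D} (hd : is_double dt ta ti).
Local Notation "a #a g" := (smash Ya a g) (at level 39).
Local Notation "a #b g" := (smash Yb a g) (at level 39).
Local Notation beta := (grp_pair (tau := tau)).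
Local Notation u := (bone A).
Local Notation u' := (bone B).

Hypothesis pair_yg : forall x g, ta (ia << x >> #a 0) (bone Rb #b g) = 0.
Hypothesis pair_gy : forall x a, ta (bone Ra #a a) (ib << x >> #b 0) = 0.

Let ha := pn_bb hPa.
Let hb := pn_bb hPb.
Let hA := smash_bialg ha.
Let hB := smash_bialg hb.
Let hta := spair_bilin htau.
Let hti := spair_inv_bilin htau hSA.
Let hsa g : linear (fun a : Ra => a #a g) := @lin_smashc k Ga Ra Ya Ra (fun a => a) g (@lin_id _ _).
Let hsb g : linear (fun a : Rb => a #b g) := @lin_smashc k Gb Rb Yb Rb (fun a => a) g (@lin_id _ _).
Let hdt := dt_bilin hd.
Let hm := dt_mul_bilin hd.
Let mull := dt_mull hA hB htau hSA hd.
Let mulr := dt_mulr hA hB htau hSA hd.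

Let em b := dt (b #a 0) u'.
Let gm a := dt (bone Ra #a a) u'.
Let ep c := dt u (c #b 0).
Let gp g := dt u (bone Rb #b g).

Let ta_grp b a g : ta (b #a a) (bone Rb #b g) = eps b * beta a g.
Proof. exact: (pair_bos_grp hPa hPb htau pair_yg). Qed.
Let grp_ta b a g : ta (bone Ra #a a) (b #b g) = eps b * beta a g.
Proof. exact: (pair_grp_bos hPa hPb htau pair_gy). Qed.
Let betaDl a a' g : beta (a + a') g = beta a g * beta a' g.
Proof. exact: (grp_pairDl hPa hPb htau). Qed.
Let betaDr a g g' : beta a (g + g') = beta a g * beta a g'.
Proof. exact: (grp_pairDr hPa hPb htau). Qed.
Let beta0l g : beta 0 g = 1. Proof. exact: (grp_pair0l hPb htau). Qed.
Let beta0r a : beta a 0 = 1. Proof. exact: (grp_pair0r hPa htau). Qed.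

Let dd_split b a c g : bmul (em b) (bmul (gm a) (bmul (ep c) (gp g)))
  = dt (b #a a) (c #b g).
Proof.
rewrite /em /gm /ep /gp.
rewrite -> (mulr u (c #b 0) (bone Rb #b g)), (bos_split hb c g).
rewrite -> (mull (bone Ra #a a) u (c #b g)), (bmul1r hA).
by rewrite -> (mull (b #a 0) (bone Ra #a a) (c #b g)), (bos_split ha b a).
Qed.

(** In [double_comm] with a grouplike second argument, one side collapses by [bos_form_r] with the
    scalar [beta 0 g], which is 1, and the other by [bos_form_l] with [beta d g]. *)
Let gp_em g d b : homog (ycomp Ya) d b ->
    bmul (gp g) (em b) = beta d g *: bmul (em b) (gp g).
Proof.
move=> hbd; have := double_comm hA hB htau hSA hd (b #a 0) (bone Rb #b g).
have hg b1 b2 : bilin (fun x1 x2 => ta b2 x2 *: bmul (dt u x1) (dt b1 u')) by lin.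
have hg' b1 b2 : bilin (fun x1 x2 => ta b1 x1 *: dt b2 x2) by lin.
have hp : linear (fun a : A => ta a (bone Rb #b g) : klm k) := hta.2 _.
have hp' a a' : ta (a #a a') (bone Rb #b g) = eps a * beta a' g := ta_grp a a' g.
have -> : (\sw_(b1, b2 <- b #a 0) \sw_(x1, x2 <- bone Rb #b g)
    ta b2 x2 *: bmul (dt u x1) (dt b1 u')) = bmul (gp g) (em b).
  transitivity (\sw_(b1, b2 <- b #a 0) ta b2 (bone Rb #b g) *: bmul (gp g) (dt b1 u')).
    apply: eq_sw => b1 b2; exact: (bos_sw_grp hb g (hg b1 b2)).
  rewrite (bos_form_r ha hp hp' (L := fun b1 => bmul (gp g) (dt b1 u'))); last by lin.
  by rewrite beta0l scale1r.
have -> : (\sw_(b1, b2 <- b #a 0) \sw_(x1, x2 <- bone Rb #b g)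
    ta b1 x1 *: dt b2 x2) = beta d g *: bmul (em b) (gp g).
  transitivity (\sw_(b1, b2 <- b #a 0) ta b1 (bone Rb #b g) *: dt b2 (bone Rb #b g)).
    apply: eq_sw => b1 b2; exact: (bos_sw_grp hb g (hg' b1 b2)).
  rewrite (bos_form_l ha hp hp' (L := fun b2 => dt b2 (bone Rb #b g)) 0 _ _ hbd); last 2 first.
  - by lin.
  - by move=> a a'; exact: betaDl.
  rewrite /em /gp; rewrite -> (mull (b #a 0) u (bone Rb #b g)), (bmul1r hA).
  by rewrite beta0l mulr1.
by [].
Qed.

Let ep_gm a d c : homog (ycomp Yb) d c ->
    bmul (ep c) (gm a) = beta a d *: bmul (gm a) (ep c).
Proof.
move=> hbd; have := double_comm hA hB htau hSA hd (bone Ra #a a) (c #b 0).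
have hp : linear (fun x : B => ta (bone Ra #a a) x : klm k) := hta.1 _.
have hp' x x' : ta (bone Ra #a a) (x #b x') = eps x * beta a x' := grp_ta x a x'.
have hf : bilin (fun b1 b2 => \sw_(x1, x2 <- c #b 0) ta b2 x2 *: bmul (dt u x1) (dt b1 u')).
  by lin.
have hf' : bilin (fun b1 b2 => \sw_(x1, x2 <- c #b 0) ta b1 x1 *: dt b2 x2) by lin.
rewrite (bos_sw_grp ha _ hf) (bos_sw_grp ha _ hf').
rewrite (bos_form_r hb hp hp' (L := fun x1 => bmul (dt u x1) (gm a))); last by lin.
rewrite (bos_form_l hb hp hp' (L := fun x2 => dt (bone Ra #a a) x2) 0 _ _ hbd); last 2 first.
- by lin.
- by move=> x x'; exact: betaDr.
rewrite beta0r mulr1 scale1r => ->; rewrite /ep /gm.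
by rewrite -> (mull (bone Ra #a a) u (c #b 0)), (bmul1r hA).
Qed.

Let gp_gm a g : bmul (gp g) (gm a) = bmul (gm a) (gp g).
Proof.
have := double_comm hA hB htau hSA hd (bone Ra #a a) (bone Rb #b g).
have hf : bilin (fun b1 b2 => \sw_(x1, x2 <- bone Rb #b g)
  ta b2 x2 *: bmul (dt u x1) (dt b1 u')) by lin.
have hf' : bilin (fun b1 b2 => \sw_(x1, x2 <- bone Rb #b g) ta b1 x1 *: dt b2 x2) by lin.
rewrite (bos_sw_grp ha _ hf) (bos_sw_grp ha _ hf').
have hg b1 b2 : bilin (fun x1 x2 => ta b2 x2 *: bmul (dt u x1) (dt b1 u')) by lin.
have hg' b1 b2 : bilin (fun x1 x2 => ta b1 x1 *: dt b2 x2) by lin.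
rewrite (bos_sw_grp hb _ (hg _ _)) (bos_sw_grp hb _ (hg' _ _)).
have sc (b b' : k) (v w : D) : b' * b = 1 -> b *: v = b *: w -> v = w.
  by move=> e vw; rewrite -[v]scale1r -[w]scale1r -e -!scalerA vw.
have e : beta a (- g) * beta a g = 1 by rewrite -betaDr addNr beta0r.
move=> /(sc _ _ _ _ e) E; apply: etrans E _; rewrite /gp /gm.
by rewrite -> (mull (bone Ra #a a) u (bone Rb #b g)), (bmul1r hA).
Qed.

Let prim_a j : bcomul (ia << j >>)
  = ia << j >> \ox bone Ra + bone Ra \ox ia << j >>.
Proof. exact: pn_comul hPa j. Qed.
Let prim_b i : bcomul (ib << i >>)
  = ib << i >> \ox bone Rb + bone Rb \ox ib << i >>.
Proof. exact: pn_comul hPb i. Qed.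

Let ep_em j i : bmul (ep (ib << i >>)) (em (ia << j >>))
    = beta (gra j) (grb i) *: bmul (em (ia << j >>)) (ep (ib << i >>))
      + ta (ia << j >> #a 0) (ib << i >> #b 0)
        *: (bone D - bmul (gm (gra j)) (gp (grb i))).
Proof.
have dc := double_comm hA hB htau hSA hd (ia << j >> #a 0) (ib << i >> #b 0).
pose x := ia << j >> #a 0; pose z := ib << i >> #b 0.
pose e := bone Ra #a 0; pose e' := bone Rb #b 0.
pose g := bone Ra #a (gra j); pose g' := bone Rb #b (grb i).
have hf : bilin (fun b1 b2 => \sw_(x1, x2 <- z) ta b2 x2 *: bmul (dt u x1) (dt b1 u')).
  by lin.
have hf' : bilin (fun b1 b2 => \sw_(x1, x2 <- z) ta b1 x1 *: dt b2 x2) by lin.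
have hg b1 b2 : bilin (fun x1 x2 => ta b2 x2 *: bmul (dt u x1) (dt b1 u')) by lin.
have hg' b1 b2 : bilin (fun x1 x2 => ta b1 x1 *: dt b2 x2) by lin.
have hj := pn_homog hPa j; have hi := pn_homog hPb i.
have L := etrans (bos_sw_prim0 ha hf hj (prim_a j))
  (congr2 +%R (bos_sw_prim0 hb (hg x e) hi (prim_b i))
              (bos_sw_prim0 hb (hg g x) hi (prim_b i))).
have L' := etrans (bos_sw_prim0 ha hf' hj (prim_a j))
  (congr2 +%R (bos_sw_prim0 hb (hg' x e) hi (prim_b i))
              (bos_sw_prim0 hb (hg' g x) hi (prim_b i))).
(* Two skew-primitive elements give four terms on each side of the cross relation. The four pairings
   of a generator with a group element vanish and [ta e e'] is 1, so two terms survive on each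
   side. *)
have E : (ta e e' *: bmul (dt u z) (dt x u') + ta e z *: bmul (dt u g') (dt x u'))
   + (ta x e' *: bmul (dt u z) (dt g u') + ta x z *: bmul (dt u g') (dt g u'))
   = (ta x z *: dt e e' + ta x g' *: dt e z) + (ta g z *: dt x e' + ta g g' *: dt x z).
  exact: etrans (esym L) (etrans dc L').
have f1 : ta e e' = 1 by exact: beta0l.
have f2 : ta e z = 0 by exact: pair_gy.
have f3 : ta x e' = 0 by exact: pair_yg.
have f4 : ta x g' = 0 by exact: pair_yg.
have f5 : ta g z = 0 by exact: pair_gy.
have s1 : bmul (dt g u') (dt u g') = bmul (dt u g') (dt g u').
  exact: esym (gp_gm _ _).
have s2 : bmul (dt x u') (dt u z) = dt x z by rewrite -> (mull x u z), (bmul1r hA).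
have s3 : bone D = dt e e' := dt_one hd.
suff h : bmul (dt u z) (dt x u') = ta g g' *: bmul (dt x u') (dt u z)
    + ta x z *: (bone D - bmul (dt g u') (dt u g')) by exact: h.
clear L L' hf hf' hg hg' dc hj hi; clearbody x z e e' g g'.
rewrite s1 s2 s3; move: E f1 f2 f3 f4 f5.
move: (ta e e') (ta e z) (ta x e') (ta x g') (ta g z) => a1 a2 a3 a4 a5 E e1 e2 e3 e4 e5.
move: E; rewrite {}e1 {}e2 {}e3 {}e4 {}e5 !scale0r !addr0 !add0r scale1r => E.
have alg (p q r s : D) (t b : k) : p + t *: q = t *: r + b *: s -> p = b *: s + t *: (r - q).
  by move=> e1; rewrite scalerBr addrA [X in X - _]addrC -e1 addrK.
exact: alg E.
Qed.

Let comul_dt a x : bcomul (dt a x)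
  = \sw_(a1, a2 <- a) \sw_(x1, x2 <- x) dt a1 x1 \ox dt a2 x2.
Proof.
rewrite -[LHS]tlift_id; apply: (sw_dt hd (f := fun v w => v \ox w)).
exact: bilin_tens.
Qed.

Let comul_A a : bcomul (dt a u') = \sw_(a1, a2 <- a) dt a1 u' \ox dt a2 u'.
Proof.
rewrite comul_dt; apply: eq_sw => a1 a2.
by apply: (sw_one hB (f := fun x1 x2 => dt a1 x1 \ox dt a2 x2)); lin.
Qed.

Let comul_B x : bcomul (dt u x) = \sw_(x1, x2 <- x) dt u x1 \ox dt u x2.
Proof.
rewrite comul_dt.
by apply: (sw_one hA (f := fun a1 a2 => \sw_(x1, x2 <- x) dt a1 x1 \ox dt a2 x2)); lin.
Qed.

Let one_double : dt u u' = bone D. Proof. exact: esym (dt_one hd). Qed.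

Let lift (W : lmodType k) (f : Ra -> Ga -> Rb -> Gb -> W) :
  (forall a g, bilin (fun b c => f b a c g)) ->
  exists2 h : D -> W, linear h & forall b a c g, h (dt (b #a a) (c #b g)) = f b a c g.
Proof.
move=> hf.
pose F2 b a := fun (c : Rb) (w : {malg k[Gb]}) => mlift (fun g => f b a c g) w.
have h2 b a : bilin (F2 b a).
  split=> v; rewrite /F2; last by refine (lin_mliftb _ _) => g; exact: (hf a g).1.
  exact: mlift_linear.
pose F1 (t : tensor Rb {malg k[Gb]}) := fun (b : Ra) (v : {malg k[Ga]}) =>
  mlift (fun a => tlift (F2 b a) t) v.
have h2b a t : linear (fun b => tlift (F2 b a) t).
  refine (lin_tliftb _ _) => c w; rewrite /F2; refine (lin_mliftb _ _) => g.
  exact: (hf a g).2.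
have h1 t : bilin (F1 t).
  split=> v; rewrite /F1; last by refine (lin_mliftb _ _) => a; exact: h2b.
  exact: mlift_linear.
have h0 : bilin (fun (s : A) (t : B) => tlift (F1 t) s : W).
  split=> [s|t]; last exact: (tlift_linear (h1 t)).
  refine (lin_tliftb _ _) => b v; refine (lin_mliftb _ _) => a.
  exact: (tlift_linear (h2 b a)).
have [h hl hE] := dt_lift hd h0; exists h; first exact: hl.
move=> b a c g; apply: etrans (hE _ _) _.
apply: etrans (tlift_tens (h1 _) b << a >>) _; apply: etrans (mliftU _ _) _.
apply: etrans (tlift_tens (h2 _ _) c << g >>) _; exact: mliftU.
Qed.

Lemma bos_double : is_bos_double gra grb Ya Yb (fun j => ia << j >>)
  (fun i => ib << i >>) beta
  (fun j i => ta (ia << j >> #a 0) (ib << i >> #b 0)) (D := D)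
  (fun b => dt (b #a 0) u') (fun a => dt (bone Ra #a a) u')
  (fun c => dt u (c #b 0)) (fun g => dt u (bone Rb #b g)).
Proof.
have [_ _ ma1 mra1] := bb_alg ha; have [_ _ mb1 mrb1] := bb_alg hb.
split.
- exact (double_bialg hA hB htau hSA hd).
- exact (double_antipode hA hB htau hSA hSB hd).
- split; [exact: (lin_bilc _ hdt (hsa 0))|exact: one_double|].
  move=> b b'; rewrite -> mull.
  rewrite -> (bos_mulE ha), (bb_act0 ha).
  exact: (congr1 (fun d => dt (_ #a d) u') (esym (addr0 0))).
- split; [exact: (lin_comp (hdt.1 u) (hsb 0))|exact: one_double|].
  move=> c c'; rewrite -> mulr.
  rewrite -> (bos_mulE hb), (bb_act0 hb).
  exact: (congr1 (fun d => dt u (_ #b d)) (esym (addr0 0))).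
- exact: one_double.
- exact: one_double.
- by move=> a a'; rewrite -> mull, (bos_grpD ha).
- by move=> g g'; rewrite -> mulr, (bos_grpD hb).
- move=> a b; rewrite -> (mull (bone Ra #a a) (b #a 0) u').
  rewrite -> (mull (yact Ya a b #a 0) (bone Ra #a a) u'), (bos_split ha (yact Ya a b) a).
  rewrite -> (bos_mulE ha (bone Ra) a b 0), (ma1 (yact Ya a b)).
  exact: (congr1 (fun d => dt (_ #a d) u') (addr0 a)).
- move=> g c; rewrite -> (mulr u (bone Rb #b g) (c #b 0)).
  rewrite -> (mulr u (yact Yb g c #b 0) (bone Rb #b g)), (bos_split hb (yact Yb g c) g).
  rewrite -> (bos_mulE hb (bone Rb) g c 0), (mb1 (yact Yb g c)).
  exact: (congr1 (fun d => dt u (_ #b d)) (addr0 g)).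
- exact: gp_em.
- exact: ep_gm.
- exact: gp_gm.
- exact: ep_em.
- move=> a; apply: etrans (comul_A _) _.
  by apply: (bos_sw_grp ha (f := fun a1 a2 => dt a1 u' \ox dt a2 u')); lin.
- move=> g; apply: etrans (comul_B _) _.
  by apply: (bos_sw_grp hb (f := fun a1 a2 => dt u a1 \ox dt u a2)); lin.
- move=> j; apply: etrans (comul_A _) _.
  rewrite <- one_double.
  apply: (bos_sw_prim0 ha (f := fun a1 a2 => dt a1 u' \ox dt a2 u')).
  + by lin.
  + exact: pn_homog hPa j.
  + exact: prim_a.
- move=> i; apply: etrans (comul_B _) _.
  rewrite <- one_double.
  apply: (bos_sw_prim0 hb (f := fun a1 a2 => dt u a1 \ox dt u a2)).
  + by lin.
  + exact: pn_homog hPb i.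
  + exact: prim_b.
- move=> a; rewrite -> (dt_eps hd), (smash_counitE ha), (bb_counit1 ha), (eps1 hB).
  exact: mulr1.
- move=> g; rewrite -> (dt_eps hd), (smash_counitE hb), (bb_counit1 hb), (eps1 hA).
  exact: mulr1.
- move=> j; rewrite -> (dt_eps hd), (smash_counitE ha), (pn_eps hPa); exact: mul0r.
- move=> i; rewrite -> (dt_eps hd), (smash_counitE hb), (pn_eps hPb); exact: mulr0.
- move=> W f h hf hh fh; refine (eq_lin_dt hd hf hh _) => a x; move: a.
  refine (eq_lin_smash (lin_comp hf (hdt.2 x)) (lin_comp hh (hdt.2 x)) _) => b a.
  move: x.
  refine (eq_lin_smash (lin_comp hf (hdt.1 _)) (lin_comp hh (hdt.1 _)) _) => c g.
  exact: etrans (congr1 f (esym (dd_split b a c g)))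
    (etrans (fh b a c g) (congr1 h (dd_split b a c g))).
- move=> W f hf; have [h hl hE] := lift hf; exists h; first exact: hl.
  by move=> b a c g; exact: etrans (congr1 h (dd_split b a c g)) (hE b a c g).
Qed.

End BosonizationDouble.

(** A set that separates linear maps spans: the class map modulo [U] and the zero map agree on [S].
    This turns the extensionality clauses of the interfaces into spanning statements. *)
Lemma subspace_total {k : fieldType} (V : lmodType k) (S U : set V) :
  (forall (W : lmodType k) (f h : V -> W), linear f -> linear h ->
    (forall v, S v -> f v = h v) -> forall v, f v = h v) ->
  subspace U -> (forall v, S v -> U v) -> forall v, U v.
Proof.
move=> ext hU SU v; apply: (span_id hU); apply/cls0P.
by apply: (ext _ _ _ (cls_linear U) (@lin_zero _ _ _)) => w /SU hw; apply/cls0P => E _; exact.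
Qed.

Lemma subspace_preim {k : fieldType} (V W : lmodType k) (f : V -> W) (U : set W) :
  linear f -> subspace U -> subspace [set v | U (f v)]%classic.
Proof.
move=> hf [U0 UD]; split=> [|a u v hu hv]; first by rewrite /= (lin0 hf).
by rewrite /= hf; apply: UD.
Qed.

Lemma tmap_comp {k : fieldType} (U V W : lmodType k) (g : V -> W) (f : U -> V) t :
  linear f -> linear g ->
  tmap g g (tmap f f t) = tmap (fun u => g (f u)) (fun u => g (f u)) t.
Proof.
move=> hf hg; have hgf := lin_comp hg hf.
move: t; refine (eq_lin_tens (lin_comp (lin_tmap hg hg) (lin_tmap hf hf)) (lin_tmap hgf hgf) _) => u v.
by rewrite !tmap_tens.
Qed.

Lemma malg_int_lift (X : choiceType) (G : zmodType) (g : X -> G) :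
  exists phi : {malg int[X]} -> G,
    (forall a b, phi (a + b) = phi a + phi b) /\ forall x, phi << x >> = g x.
Proof.
pose phi (a : {malg int[X]}) := \sum_(x <- msupp a) g x *~ a@_x.
have phiE (a : {malg int[X]}) (d : {fset X}) : (msupp a `<=` d)%fset ->
    phi a = \sum_(x <- d) g x *~ a@_x.
  move=> le; rewrite /phi [RHS](big_fsetID _ (mem (msupp a))) /=.
  rewrite [X in _ + X]big1_fset ?addr0.
    apply: eq_fbigl => x; rewrite !inE.
    by apply/idP/andP => [h|[]//]; split => //; apply: (fsubsetP le).
  by move=> x; rewrite !inE => /andP[_ /mcoeff_outdom ->] _; rewrite mulr0z.
exists phi; split=> [a b|x]; last first.
  by rewrite /phi msuppU oner_eq0 big_seq_fset1 mcoeffUU.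
pose d := (msupp (a + b) `|` (msupp a `|` msupp b))%fset.
rewrite (phiE (a + b) d) ?fsubsetUl // (phiE a d); last first.
  by apply: fsubset_trans (fsubsetUr _ _); apply: fsubsetUl.
rewrite (phiE b d); last by apply: fsubset_trans (fsubsetUr _ _); apply: fsubsetUr.
by rewrite -big_split; apply: eq_bigr => x _; rewrite mcoeffD mulrzDr.
Qed.

Lemma eq_tensor_eval {k : fieldType} {X : choiceType} (R : bialg_sig k) (y y' : X -> R) f :
  (forall x, y x = y' x) -> tensor_eval y f = tensor_eval y' f.
Proof. by move=> /funext ->. Qed.

Section PreNicholsAction.
Context {k : fieldType} {G : zmodType} {X : choiceType}.
Context {gr : X -> G} {chi : X -> G -> k}.
Context {R : bialg_sig k} {Y : yd_sig G R} {nu : nat -> R -> R}.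
Context {iota : {malg k[X]} -> R}.
Hypothesis hPN : is_pre_nichols (yd_diag gr chi) Y nu iota.
Let hR := pn_bb hPN.
Let hm := alg_bilin (bb_alg hR).
Let hg := bb_grading hR.
Let hl := bb_act_lin hR.

(** The operator multiplying the action of [g] by [rho] of the degree fixes the generators and
    commutes with left multiplication by them, hence is the identity. This is where the conditions
    on the q_ij turn into centrality in the double. *)
Lemma pn_act_homog (rho : G -> k) g d c :
  (forall d e, rho (d + e) = rho d * rho e) -> rho 0 = 1 ->
  (forall x, rho (gr x) * chi x g = 1) ->
  homog (ycomp Y) d c -> rho d *: yact Y g c = c.
Proof.
move=> rD r0 rx.
pose W c := gsum (ycomp Y) (fun d x => rho d *: yact Y g x) c.
have hF d' : linear (fun x => rho d' *: yact Y g x) by apply: lin_scaler.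
have hW : linear W := lin_gsum hg hF.
have WE d' c' : homog (ycomp Y) d' c' -> W c' = rho d' *: yact Y g c'.
  by move=> hc'; exact: (gsum_homog hg hF hc').
suff h : forall c, W c = c by move=> hc; rewrite -WE.
apply: (pn_ind hPN (subspace_eq hW (@lin_id _ R))) => [|x a ha] /=.
  by rewrite (WE 0) ?r0 ?scale1r ?(bb_act1 hR) //; exact: bb_one_homog.
suff -> : W (bmul (iota << x >>) a) = bmul (iota << x >>) (W a) by rewrite ha.
move: {ha} a; refine (eq_lin_homog hg (lin_comp hW (hm.1 _)) (lin_comp (hm.1 _) hW) _) => e a ha.
rewrite (WE _ _ ha) (WE _ _ (bb_mul_homog hR (pn_homog hPN x) ha)).
rewrite (bb_actM hR) (pn_act hPN) (linZ (f := fun v => bmul v _) _ _ (hm.2 _)).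
by rewrite scalerA rD mulrAC rx mul1r (linZ _ _ (hm.1 _)).
Qed.

(* An algebra map out of the tensor algebra which kills the defining ideal
   factors through the pre-Nichols algebra. *)
Lemma pn_factor (B : bialg_sig k) (y : X -> B) : is_alg B ->
  (forall f, defining_ideal iota f -> tensor_eval y f = 0) ->
  exists2 h : R -> B, alg_hom h & forall x, h (iota << x >>) = y x.
Proof.
move=> hB ker; have hA := bb_alg hR.
have hl1 := lin_eval (fun x => iota << x >>); have hl2 := lin_eval y.
have [h hh hE] := lin_factor hl1 hl2 (pn_surj hPN) ker.
have surj := pn_surj hPN.
exists h.
  split; [exact: hh|by rewrite -(eval1 (fun x => iota << x >>)) hE (eval1 y)|].
  move=> a b; have [f <-] := surj a; have [f' <-] := surj b.
  by rewrite -(evalM hA) !hE (evalM hB).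
by move=> x; rewrite -(eval_gen hA (fun x => iota << x >>)) hE (eval_gen hB).
Qed.

End PreNicholsAction.

(** * The isomorphism between the two quotients *)

Section Isomorphism.
Context {k : fieldType} {G : zmodType} {Xp Xm : choiceType}.
Context {gr : Xp + Xm -> G} {chi : Xp + Xm -> G -> k} {lam : Xp -> Xm -> k}.
Context {chia : Xm -> {malg int[Xm]} -> k}.
Context {Rp : bialg_sig k} {Yp : yd_sig G Rp} {nup : nat -> Rp -> Rp}.
Context {ip : {malg k[Xp]} -> Rp}.
Hypothesis hPp : is_pre_nichols
  (yd_diag (fun i => gr (inl i)) (fun i => chi (inl i))) Yp nup ip.
Context {Rm : bialg_sig k} {Ym : yd_sig {malg int[Xm]} Rm} {num : nat -> Rm -> Rm}.
Context {im : {malg k[Xm]} -> Rm}.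
Hypothesis hPm : is_pre_nichols (yd_diag (fun j => << j >>) chia) Ym num im.
Local Notation gm_ j := (gr (inr j)).
Local Notation gp_ i := (gr (inl i)).

Hypothesis chiaE : forall j l, chia l << j >> = chi (inr l) (gm_ j).
Hypothesis q_inv : forall i j, chi (inr j) (gp_ i) * chi (inl i) (gm_ j) = 1.

Context {beta : {malg int[Xm]} -> G -> k}.
Hypothesis betaDl : forall a a' g, beta (a + a') g = beta a g * beta a' g.
Hypothesis betaDr : forall a g g', beta a (g + g') = beta a g * beta a g'.
Hypothesis beta0l : forall g, beta 0 g = 1.
Hypothesis beta0r : forall a, beta a 0 = 1.
Hypothesis betaE : forall j g, beta << j >> g = chi (inr j) g.

Context {T : bialg_sig k} {gen : Xp + Xm -> T} {grp : G -> T}.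
Context {wd : seq (Xp + Xm)%type -> G -> T}.
Hypothesis hT : is_free_bos gr chi gen grp wd.

Context {D : bialg_sig k} {em : Rm -> D} {gm : {malg int[Xm]} -> D}.
Context {ep : Rp -> D} {gp : G -> D}.
Hypothesis hD : is_bos_double (fun j => << j >>) (fun i => gp_ i) Ym Yp
  (fun j => im << j >>) (fun i => ip << i >>) beta (fun j i => - lam i j) em gm ep gp.

Definition ctr (j : Xm) : D := bmul (gm << j >>) (gp (- gm_ j)).

Definition Q_gen : set D := [set z | exists j : Xm, z = ctr j - bone D]%classic.

Definition J_gen : set T :=
  ([set tensor_eval (fun i => gen (inl i)) f | f in defining_ideal ip] `|`
   [set tensor_eval (fun j => gen (inr j)) f | f in defining_ideal im] `|`
   [set z | exists (i : Xp) (j : Xm),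
      z = bmul (gen (inl i)) (gen (inr j))
          - chi (inr j) (gp_ i) *: bmul (gen (inr j)) (gen (inl i))
          - lam i j *: (grp (gp_ i + gm_ j) - bone T)])%classic.

Local Notation Q := (ideal_gen Q_gen).
Local Notation J := (ideal_gen J_gen).
Local Notation TJ := (quot_bialg J).
Local Notation DQ := (quot_bialg Q).

Let hDb := bd_bialg hD.
Let hm := alg_bilin (bialg_alg hDb).
Let mA := bmulA hDb.
Let m1 := bmul1l hDb.
Let mr1 := bmul1r hDb.
Let hem := bd_em hD.
Let hep := bd_ep hD.
Let hlem : linear em. Proof. by case: hem. Qed.
Let hlep : linear ep. Proof. by case: hep. Qed.
Let hgm : is_grading (ycomp Ym) := bb_grading (pn_bb hPm).
Let hgp : is_grading (ycomp Yp) := bb_grading (pn_bb hPp).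

Let hTm := alg_bilin (fb_alg hT).
Let hQ : is_ideal Q := ideal_gen_ideal Q_gen.
Let hJ : is_ideal J := ideal_gen_ideal J_gen.

Let gmC a a' : bmul (gm a) (gm a') = bmul (gm a') (gm a).
Proof. by rewrite -!(bd_gmD hD) addrC. Qed.
Let gpC g g' : bmul (gp g) (gp g') = bmul (gp g') (gp g).
Proof. by rewrite -!(bd_gpD hD) addrC. Qed.

(** Moving [ctr j] past [em b] acts on [b] by g_j' and scales by [beta d (- gm_ j)]. On a generator
    x_l the two effects are χ_l(g_j) and χ_l(g_j)^{-1}. *)
Let act_m j d b : homog (ycomp Ym) d b ->
  beta d (- gm_ j) *: yact Ym << j >> b = b.
Proof.
move=> hb; apply: (pn_act_homog hPm (rho := fun d => beta d (- gm_ j))) => //.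
by move=> l; rewrite chiaE -betaE -betaDr addNr.
Qed.

(** The analogue for the plus part: on a generator x_i the two factors are χ_j(g_i) and χ_i(g_j),
    whose product is 1 by q_ij q_ji = 1. *)
Let act_p j d c : homog (ycomp Yp) d c -> beta << j >> d *: yact Yp (gm_ j) c = c.
Proof.
move=> hc; apply: (pn_act_homog hPp (rho := beta << j >>)) => //.
by move=> i; rewrite betaE.
Qed.

Let ctr_em j b : bmul (ctr j) (em b) = bmul (em b) (ctr j).
Proof.
move: b; refine (eq_lin_homog hgm (lin_comp (hm.1 _) hlem) (lin_comp (hm.2 _) hlem) _) => d b hb.
rewrite /ctr -mA (bd_gp_em hD _ hb) (linZ _ _ (hm.1 _)) mA (bd_gm_em hD).
rewrite -(linZ (f := fun v => bmul v _) _ _ (hm.2 _)).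
rewrite -(linZ (f := fun v => bmul v _) _ _ (hm.2 _)) -(linZ _ _ hlem).
by rewrite act_m // -mA.
Qed.

Let ctr_ep j c : bmul (ctr j) (ep c) = bmul (ep c) (ctr j).
Proof.
move: c; refine (eq_lin_homog hgp (lin_comp (hm.1 _) hlep) (lin_comp (hm.2 _) hlep) _) => d c hc.
rewrite /ctr [RHS]mA (bd_ep_gm hD _ hc) -mA (bd_gp_ep hD).
rewrite (linZ (f := fun v => bmul v _) _ _ (hm.2 _)) -mA -(linZ _ _ (hm.1 _)).
rewrite -(linZ (f := fun v => bmul v _) _ _ (hm.2 _)) -(linZ _ _ hlep).
congr (bmul _ (bmul (ep _) _)); rewrite -[in LHS](act_p j hc).
rewrite (linZ _ _ (bb_act_lin (pn_bb hPp) _)) -(bb_actD (pn_bb hPp)) addNr.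
by rewrite (bb_act0 (pn_bb hPp)).
Qed.

Let ctr_gm j a : bmul (ctr j) (gm a) = bmul (gm a) (ctr j).
Proof. by rewrite /ctr -mA (bd_gp_gm hD) !mA gmC. Qed.
Let ctr_gp j g : bmul (ctr j) (gp g) = bmul (gp g) (ctr j).
Proof. by rewrite /ctr -mA gpC !mA (bd_gp_gm hD). Qed.

Lemma ctr_central j d : bmul (ctr j) d = bmul d (ctr j).
Proof.
move: d; refine (eq_lin_bd hD (hm.1 _) (hm.2 _) _) => b a c g.
move: (ctr_em j b) (ctr_gm j a) (ctr_ep j c) (ctr_gp j g).
move: (ctr j) => z e1 e2 e3 e4.
by rewrite mA e1 -!mA -e4 [bmul (ep c) (bmul z _)]mA -e3 -!mA [bmul (gm a) (bmul z _)]mA -e2 -!mA.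
Qed.

Let ctrQ j : Q (ctr j - bone D).
Proof. by apply: ideal_gen_sub; exists j. Qed.

Let comul_ctr j : bcomul (ctr j) = ctr j \ox ctr j.
Proof.
case: (hDb) => _ _ _ _ ->; rewrite (bd_comul_gm hD) (bd_comul_gp hD) /tprod.
rewrite tlift_tens; last by lin.
by rewrite tlift_tens; last by lin.
Qed.

Let eps_ctr j : eps (ctr j) = 1.
Proof. by rewrite (epsM hDb) (bd_eps_gm hD) (bd_eps_gp hD) mulr1. Qed.

Let Q_coideal x : Q x -> tmap (cls Q) (cls Q) (bcomul x) = 0.
Proof.
have hDD := coalg_comul (bialg_coalg hDb).
apply: (ideal_gen_coideal hDb) => _ [j ->].
have h1 : bcomul (bone D) = bone D \ox bone D by case: hDb.
rewrite (linB _ _ hDD) comul_ctr h1 (linB (f := tmap (cls Q) (cls Q))); last by lin.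
rewrite !(tmap_tens _ _ (cls_linear Q) (cls_linear Q)).
by rewrite ((ideal_cls_eq _ _ hQ).2 (ctrQ j)) subrr.
Qed.

Let Q_counit x : Q x -> eps x = 0.
Proof.
have he := coalg_counit (bialg_coalg hDb).
apply: (ideal_gen_counit hDb) => _ [j ->].
by rewrite (linB _ _ he) eps_ctr (eps1 hDb) [LHS]subrr.
Qed.

Let Q_antipode S : is_antipode S -> forall x, Q x -> Q (S x).
Proof.
move=> hS; have hl := lin_antipode hS.
apply: (ideal_gen_antipode hDb hS) => _ [j ->].
rewrite (linB _ _ hl) (antipode1 hDb hS).
have e : bmul (S (ctr j)) (ctr j) = bone D.
  have := sw_antipodel hS (ctr j); rewrite eps_ctr scale1r /sweedler comul_ctr.
  by rewrite tlift_tens; last by lin.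
(* For the grouplike z = [ctr j], S(z) z = 1, so S(z) - 1 = - S(z)(z - 1) lies in Q. *)
have -> : S (ctr j) - bone D = - bmul (S (ctr j)) (ctr j - bone D).
  by rewrite (linB _ _ (hm.1 _)) e mr1 opprB.
rewrite -scaleN1r; apply: (subspaceZ _ hQ.1).
exact: (hQ.2 (S (ctr j)) _ (ctrQ j)).1.
Qed.

Let hDQ : is_bialg DQ. Proof. exact: quot_is_bialg hDb hQ Q_coideal Q_counit. Qed.

Lemma Q_hopf_ideal : is_hopf_ideal Q.
Proof.
split; [exact: hQ| |exact: Q_counit|exact: Q_antipode].
by move=> x hx; apply: (coideal_span hQ); exact: Q_coideal.
Qed.

Let DQ_antipode : exists S : DQ -> DQ, is_antipode S.
Proof.
have [S hS] := bd_antipode hD.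
have hc := cls_alg_hom hDb hQ; have hcc := cls_coalg_hom hDb hQ Q_coideal Q_counit.
have [S' [hS' _]] := @surj_antipode k D DQ (cls Q) (@cls_surj k D Q) (cls_linear Q) S hDb hc hcc hS
  (fun a ha => (ideal_cls0 _ hQ).2 (Q_antipode hS ((ideal_cls0 _ hQ).1 ha))).
by exists S'.
Qed.

Let clsJ_hom : @alg_hom k T TJ (cls J).
Proof.
split; [exact: cls_linear|by []|].
by move=> a b; exact: esym (quot_mulE a b hTm hJ).
Qed.

Let hTJ : is_alg TJ.
Proof. exact: (@surj_alg k T TJ (cls J) (@cls_surj k T J) (fb_alg hT) clsJ_hom). Qed.

Let hJm := alg_bilin hTJ.
Let JA : associative (@bmul k TJ). Proof. by case: hTJ. Qed.
Let J1 : left_id (bone TJ) (@bmul k TJ). Proof. by case: hTJ. Qed.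
Let Jr1 : right_id (bone TJ) (@bmul k TJ). Proof. by case: hTJ. Qed.

Let X x : TJ := cls J (gen x).
Let g_ h : TJ := cls J (grp h).

Let g_0 : g_ 0 = bone TJ. Proof. by rewrite /g_ -(fb_one hT). Qed.
Let g_D g h : g_ (g + h) = bmul (g_ g) (g_ h).
Proof. by rewrite /g_ (fb_grpD hT); case: clsJ_hom. Qed.
Let g_X h x : bmul (g_ h) (X x) = chi x h *: bmul (X x) (g_ h).
Proof.
rewrite /g_ /X; case: clsJ_hom => hl _ hM; rewrite -!hM (fb_grp_gen hT).
exact: (linZ _ _ hl).
Qed.

Let X_rel i j : bmul (X (inl i)) (X (inr j))
  = chi (inr j) (gp_ i) *: bmul (X (inr j)) (X (inl i))
    + lam i j *: (g_ (gp_ i + gm_ j) - bone TJ).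
Proof.
rewrite /X /g_; case: clsJ_hom => hl h1 hM; rewrite -!hM -h1.
rewrite -(linB _ _ hl) -!(linZ _ _ hl) -(linD _ _ hl).
apply/(ideal_cls_eq _ _ hJ); rewrite opprD addrA.
by apply: ideal_gen_sub; right; exists i, j.
Qed.

(** The defining ideal of R_+ is sent into J, so R_+ maps to T/J; [km_exists] is the same for
    R_-. *)
Let kp_exists : exists2 h : Rp -> TJ, alg_hom h & forall i, h (ip << i >>) = X (inl i).
Proof.
apply: (pn_factor hPp hTJ) => f hf.
rewrite -(eval_hom (fun i => gen (inl i)) clsJ_hom); apply/(ideal_cls0 _ hJ).
by apply: ideal_gen_sub; left; left; exists f.
Qed.

Let km_exists : exists2 h : Rm -> TJ, alg_hom h & forall j, h (im << j >>) = X (inr j).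
Proof.
apply: (pn_factor hPm hTJ) => f hf.
rewrite -(eval_hom (fun j => gen (inr j)) clsJ_hom); apply/(ideal_cls0 _ hJ).
by apply: ideal_gen_sub; left; right; exists f.
Qed.

Lemma retraction (F0 : T -> D) : alg_hom F0 ->
  (forall i, F0 (gen (inl i)) = ep (ip << i >>)) ->
  (forall j, F0 (gen (inr j)) = em (im << j >>)) ->
  (forall g, F0 (grp g) = gp g) ->
  exists Psi : D -> TJ, [/\ linear Psi, forall d, Q d -> Psi d = 0
    & (forall x, J x -> Q (F0 x)) -> forall z, Psi (F0 z) = cls J z].
Proof.
move=> hF0 Fp Fm Fg.
have [K hK KE] := kp_exists; have [M hM ME] := km_exists.
have [hKl K1 KM] := hK; have [hMl M1 MM] := hM.
have [phi [phiD phiE]] := malg_int_lift (fun j => gm_ j).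
have phi0 : phi 0 = 0 by apply: (addrI (phi 0)); rewrite -phiD !addr0.
have gK h c : bmul (g_ h) (K c) = bmul (K (yact Yp h c)) (g_ h).
  have hact := bb_act_lin (pn_bb hPp) h.
  have h1 : linear (fun c => bmul (g_ h) (K c)) by exact: (lin_comp (hJm.1 _) hKl).
  have h2 : linear (fun c => bmul (K (yact Yp h c)) (g_ h)).
    exact: (lin_comp (hJm.2 _) (lin_comp hKl hact)).
  apply: (pn_ind hPp (subspace_eq h1 h2)) => [|i a ih]; lazy beta delta [mkset].
    by rewrite (bb_act1 (pn_bb hPp)) K1 J1 Jr1.
  rewrite (bb_actM (pn_bb hPp)) !KM (pn_act hPp) (linZ _ _ hKl) KE JA g_X.
  rewrite !(linZ (f := fun v => bmul v _) _ _ (hJm.2 _)) -!JA.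
  by congr (_ *: bmul _ _); exact: ih.
(* Group elements of Γ' are sent to Γ through [phi], since g_j' and g_j have to be identified. *)
have [Psi hPsi PsiE] := bd_lift hD
  (f := fun b a c g => bmul (M b) (bmul (g_ (phi a)) (bmul (K c) (g_ g)))) ltac:(lin).
(* In normal form, a left factor [ctr j] adds g_j' to the Γ'-part, acts on [c] by the inverse of g_j
   and shifts [g] by it. In T/J the group element g_j commutes back past [K c], by [gK], and
   cancels. *)
have Psi_ctr j d : Psi (bmul (ctr j) d) = Psi d.
  move: d; refine (eq_lin_bd hD (lin_comp hPsi (hm.1 _)) hPsi _) => b a c g.
  have -> : bmul (ctr j) (bmul (em b) (bmul (gm a) (bmul (ep c) (gp g))))
      = bmul (em b) (bmul (gm (<< j >> + a)) (bmul (ep (yact Yp (- gm_ j) c)) (gp (- gm_ j + g)))).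
    rewrite mA ctr_em -mA; congr (bmul _ _).
    rewrite /ctr -mA [bmul (gp _) (bmul (gm _) _)]mA (bd_gp_gm hD) -mA mA -(bd_gmD hD).
    by congr (bmul _ _); rewrite mA (bd_gp_ep hD) -mA (bd_gpD hD).
  rewrite !PsiE phiD phiE [gm_ j + _]addrC g_D -JA; congr (bmul _ (bmul _ _)).
  rewrite g_D [bmul (K _) (bmul _ _)]JA -gK -!JA [LHS]JA -g_D.
  by rewrite subrr g_0 J1.
have kill w : Q w -> Psi w = 0.
  (* As Psi is only linear, Q is handled through the largest two-sided ideal inside its kernel;
     centrality of [ctr j] reduces membership of a generator to [Psi_ctr]. *)
  have hZ : is_ideal [set d | forall e e', Psi (bmul e (bmul d e')) = 0]%classic.
    split; first split.
    - move=> e e'; rewrite (lin0 (f := fun d => bmul d e') (hm.2 _)).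
      by rewrite (lin0 (hm.1 e)) (lin0 hPsi).
    - move=> z d d' h h' e e'; rewrite /= [bmul _ e'](hm.2 e' z d d') (hm.1 e) hPsi h h'.
      by rewrite scaler0 addr0.
    - move=> d x hx; split=> e e' /=; first by rewrite -mA mA hx.
      by rewrite -mA hx.
  move=> /(ideal_gen_min hZ) h; rewrite -[w]m1 -[w]mr1; apply: h => _ [j ->] e e' /=.
  rewrite (linB (f := fun d => bmul d e') _ _ (hm.2 _)) (linB _ _ (hm.1 _)) (linB _ _ hPsi).
  by rewrite m1 mA -ctr_central -mA Psi_ctr subrr.
exists Psi; split=> [//|//|FJ].
(* The span of the ordered products is stable under left multiplication by all generators ([Nj],
   [Ng], [Ni]), hence is all of T/J. *)
pose N := span [set t | exists b c g, t = bmul (M b) (bmul (K c) (g_ g))]%classic.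
have hN : subspace N := span_subspace _.
have NS b c g : N (bmul (M b) (bmul (K c) (g_ g))).
  by move=> U _; apply; exists b, c, g.
have closed t : (forall b c g, N (bmul t (bmul (M b) (bmul (K c) (g_ g))))) ->
    forall s, N s -> N (bmul t s).
  move=> h; apply: (span_min (subspace_preim (hJm.1 t) hN)).
  by move=> _ [b [c [g ->]]]; exact: h.
have Nj j s : N s -> N (bmul (X (inr j)) s).
  by apply: closed => b c g; rewrite JA -ME -MM; exact: NS.
have NS1 c g : N (bmul (K c) (g_ g)).
  by rewrite -[bmul _ _]J1 -M1; exact: NS.
have Ng h s : N s -> N (bmul (g_ h) s).
  apply: closed => b c g.
  have hl : linear (fun b => bmul (g_ h) (bmul (M b) (bmul (K c) (g_ g)))) by lin.
  apply: (pn_ind hPm (subspace_preim hl hN)) => [|j {}b ih]; lazy beta delta [mkset].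
    by rewrite M1 J1 JA gK -JA -g_D.
  rewrite MM ME -[bmul (bmul (X _) _) _]JA JA g_X.
  rewrite (linZ (f := fun v => bmul v _) _ _ (hJm.2 _)) -JA.
  by apply: (subspaceZ _ hN); apply: Nj; exact: ih.
(* Induction on [b]: the linking relation moves X_i past each X_j, and the error term involves only
   a group element and the unit times a shorter product. *)
have Ni i s : N s -> N (bmul (X (inl i)) s).
  apply: closed => b c g.
  have hl : linear (fun b => bmul (X (inl i)) (bmul (M b) (bmul (K c) (g_ g)))) by lin.
  apply: (pn_ind hPm (subspace_preim hl hN)) => [|j {}b ih]; lazy beta delta [mkset].
    by rewrite M1 J1 JA -KE -KM.
  rewrite MM ME -[bmul (bmul (X _) _) _]JA JA X_rel.
  set t := bmul (M b) _; have hr := hJm.2 t.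
  rewrite (linD (f := fun v => bmul v t) _ _ hr) !(linZ (f := fun v => bmul v t) _ _ hr).
  rewrite (linB (f := fun v => bmul v t) _ _ hr) J1 -JA.
  have ht : N t := NS b c g.
  apply: (subspaceD hN); apply: (subspaceZ _ hN); first by apply: Nj; exact: ih.
  by apply: (subspaceB hN); [exact: Ng|].
have Nall z : N (cls J z).
  apply: (@subspace_total k T [set z | exists s g, z = wd s g]%classic
    [set z | N (cls J z)]%classic _ (subspace_preim (cls_linear J) hN) _ z).
    move=> W f h hf hh fh; apply: (eq_lin_fb hT hf hh) => s g.
    by apply: fh; exists s, g.
  move=> _ [s [g ->]]; lazy beta delta [mkset]; elim: s => [|x s ih].
    by rewrite (fb_nil hT) -[cls J _]J1 -K1; exact: NS1.
  have -> : cls J (wd (x :: s) g) = bmul (X x) (cls J (wd s g)).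
    by rewrite (fb_cons hT); case: clsJ_hom.
  by case: x => [i|j]; [exact: Ni|exact: Nj].
have [hF0l F01 F0M] := hF0.
pose E := [set z | Psi (F0 z) = cls J z]%classic.
have hE : subspace E := subspace_eq (lin_comp hPsi hF0l) (cls_linear J).
(* Every ordered product has a lift to [T] on which Psi after F0 agrees with the class map: words in
   the minus generators, then words in the plus generators, then a group element. *)
have El t : N t -> exists2 z, E z & cls J z = t.
  have hI : subspace [set t | exists2 z, E z & cls J z = t]%classic.
    split; first by exists 0; [exact: hE.1|exact: lin0 (cls_linear J)].
    move=> a u v [z hz <-] [w hw <-]; exists (a *: z + w); first exact: hE.2.
    exact: cls_linear.
  apply: (span_min hI) => _ [b [c [g ->]]].
  have [f fb] := pn_surj hPm b; have [f' fc] := pn_surj hPp c.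
  pose z1 := tensor_eval (fun j => gen (inr j)) f.
  pose z2 := tensor_eval (fun i => gen (inl i)) f'.
  have e1 : cls J z1 = M b.
    rewrite -fb (eval_hom _ hM) /z1 (eval_hom _ clsJ_hom); by apply: (@eq_tensor_eval k _ TJ) => j; rewrite ME.
  have e2 : cls J z2 = K c.
    rewrite -fc (eval_hom _ hK) /z2 (eval_hom _ clsJ_hom); by apply: (@eq_tensor_eval k _ TJ) => i; rewrite KE.
  have e3 : F0 z1 = em b.
    rewrite -fb (eval_hom _ hem) /z1 (eval_hom _ hF0); by apply: eq_tensor_eval => j; rewrite Fm.
  have e4 : F0 z2 = ep c.
    rewrite -fc (eval_hom _ hep) /z2 (eval_hom _ hF0); by apply: eq_tensor_eval => i; rewrite Fp.
  have e5 : cls J (bmul z1 (bmul z2 (grp g))) = bmul (M b) (bmul (K c) (g_ g)).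
    by case: clsJ_hom => _ _ hM'; rewrite !hM' e1 e2.
  exists (bmul z1 (bmul z2 (grp g))); last exact: e5.
  rewrite /E; lazy beta delta [mkset]; rewrite e5 !F0M e3 e4 Fg.
  rewrite -[bmul (ep c) _]m1 -(bd_gm0 hD) PsiE phi0 g_0.
  by rewrite [bmul (bone TJ) _]J1.
move=> z; have [w hw wz] := El _ (Nall z).
(* The lift [w] need not be [z], but they differ by an element of J, which F0 sends into Q and Psi
   then kills. *)
have Jzw : J (w - z) by apply/(ideal_cls_eq _ _ hJ).
have /kill := FJ _ Jzw; rewrite (linB _ _ hF0l) (linB _ _ hPsi) => /subr0_eq <-.
by rewrite -wz.
Qed.

Let generator_hom : exists F0 : T -> D, [/\ alg_hom F0,
  forall i, F0 (gen (inl i)) = ep (ip << i >>),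
  forall j, F0 (gen (inr j)) = em (im << j >>) & forall g, F0 (grp g) = gp g].
Proof.
pose y x := match x with inl i => ep (ip << i >>) | inr j => em (im << j >>) end.
have [F0 [hF0 FX Fg]] : exists F0 : T -> D, [/\ alg_hom F0,
    forall x, F0 (gen x) = y x & forall g, F0 (grp g) = gp g].
  apply: (fb_lift hT (bialg_alg hDb)) => [|g h|g [i|j]].
  - exact: bd_gp0 hD.
  - exact: (bd_gpD hD g h).
  - rewrite /y (bd_gp_ep hD) (pn_act hPp) (linZ _ _ hlep).
    exact: (linZ (f := fun v => bmul v (gp g)) _ _ (hm.2 _)).
  - by rewrite /y (bd_gp_em hD _ (pn_homog hPm j)) betaE.
by exists F0; split=> // [i|j]; rewrite FX.
Qed.

Section Comparison.
Variable F0 : T -> D.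
Hypotheses (hF0 : alg_hom F0) (Fp : forall i, F0 (gen (inl i)) = ep (ip << i >>))
  (Fm : forall j, F0 (gen (inr j)) = em (im << j >>))
  (Fg : forall g, F0 (grp g) = gp g).

Let hl0 : linear F0. Proof. by case: hF0. Qed.
Let F (z : T) : DQ := cls Q (F0 z).

Let hF : alg_hom F.
Proof.
case: hF0 => _ F1 FM; have [hl h1 hM] := cls_alg_hom hDb hQ.
split; [exact: (lin_comp hl hl0)|by rewrite /F F1 h1|].
by move=> a b; rewrite /F FM hM.
Qed.

Lemma J_to_Q z : J z -> Q (F0 z).
Proof.
have [_ F1 FM] := hF0.
have hI : is_ideal [set z | Q (F0 z)]%classic.
  split; first exact: (subspace_preim hl0 hQ.1).
  by move=> a x hx; rewrite /= !FM; exact: hQ.2.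
move=> hz; apply: (ideal_gen_min hI _ hz) => {z hz} _ [[[f hf <-]|[f hf <-]]|[i [j ->]]] /=.
- have -> : F0 (tensor_eval (fun i => gen (inl i)) f) = ep (tensor_eval (fun i => ip << i >>) f).
    rewrite (eval_hom _ hF0) (eval_hom _ hep).
    by apply: eq_tensor_eval => i; rewrite Fp.
  by rewrite hf (lin0 hlep); exact: hQ.1.1.
- have -> : F0 (tensor_eval (fun j => gen (inr j)) f) = em (tensor_eval (fun j => im << j >>) f).
    rewrite (eval_hom _ hF0) (eval_hom _ hem).
    by apply: eq_tensor_eval => j; rewrite Fm.
  by rewrite hf (lin0 hlem); exact: hQ.1.1.
- rewrite !(linB _ _ hl0) !(linZ _ _ hl0) (linB _ _ hl0) !FM Fp Fm Fg F1.
  rewrite (bd_ep_em hD) betaE [X in X - lam i j *: _]addrC addKr scaleNr -opprD -scalerDr.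
  (* Since gm_j' gp(g_i) equals [ctr j] times gp(g_i + g_j), the failure of the linking relation in
     [D] is a multiple of [ctr j - bone D]. *)
  have -> : bone D - bmul (gm << j >>) (gp (gp_ i)) + (gp (gp_ i + gm_ j) - bone D)
      = - bmul (ctr j - bone D) (gp (gp_ i + gm_ j)).
    rewrite (linB (f := fun v => bmul v _) _ _ (hm.2 _)) m1 /ctr -mA -(bd_gpD hD).
    have alg (p q r : D) : p - q + (r - p) = - (q - r).
      by rewrite opprB [LHS]addrC addrA subrK.
    by rewrite [gp_ i + _]addrC addKr alg.
  rewrite scalerN opprK; apply: (subspaceZ _ hQ.1).
  exact: (hQ.2 _ _ (ctrQ j)).2.
Qed.

Let ker_F z : F z = 0 -> J z.
Proof.
move=> /(ideal_cls0 _ hQ) hz; apply/(ideal_cls0 _ hJ).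
have [Psi [hPsi kill PsiE]] := retraction hF0 Fp Fm Fg.
by rewrite -(PsiE J_to_Q) kill.
Qed.

Let F_ker z : J z -> F z = 0.
Proof. by move=> hz; exact: (ideal_cls0 (F0 z) hQ).2 (J_to_Q hz). Qed.

(** Modulo Q each generator of Γ' becomes an element of Γ; classes with this property are closed
    under sums and inverses. *)
Let cls_gm a : exists z, cls Q (gm a) = F z.
Proof.
have [hl h1 hM] := cls_alg_hom hDb hQ.
suff [g ->] : exists g, cls Q (gm a) = cls Q (gp g) by exists (grp g); rewrite /F Fg.
apply: (malg_int_ind (U := fun a => exists g, cls Q (gm a) = cls Q (gp g))) => {a}.
- by exists 0; rewrite (bd_gm0 hD) (bd_gp0 hD).
- by move=> a b [g ag] [h bh]; exists (g + h); rewrite (bd_gmD hD) hM ag bh -hM (bd_gpD hD).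
- move=> a [g ag]; exists (- g).
  have eg : bmul (gp g) (gp (- g)) = bone D by rewrite -(bd_gpD hD) subrr (bd_gp0 hD).
  have ea : bmul (gm (- a)) (gm a) = bone D by rewrite -(bd_gmD hD) addNr (bd_gm0 hD).
  rewrite -[gm _]mr1 -eg !hM -ag -!hM mA ea.
  by rewrite m1.
- move=> j; exists (gm_ j).
  have -> : gm << j >> = bmul (ctr j) (gp (gm_ j)).
    by rewrite /ctr -mA -(bd_gpD hD) addNr (bd_gp0 hD) mr1.
  by rewrite hM ((ideal_cls_eq _ _ hQ).2 (ctrQ j)) -hM m1.
Qed.

Let cls_em b : exists z, cls Q (em b) = F z.
Proof.
have [f <-] := pn_surj hPm b; exists (tensor_eval (fun j => gen (inr j)) f).
rewrite /F (eval_hom _ hem) (eval_hom _ hF0); congr (cls Q _).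
by apply: eq_tensor_eval => j; rewrite Fm.
Qed.

Let cls_ep c : exists z, cls Q (ep c) = F z.
Proof.
have [f <-] := pn_surj hPp c; exists (tensor_eval (fun i => gen (inl i)) f).
rewrite /F (eval_hom _ hep) (eval_hom _ hF0); congr (cls Q _).
by apply: eq_tensor_eval => i; rewrite Fp.
Qed.

Let F_surj d : exists z, F z = d.
Proof.
have [hl h1 hM] := cls_alg_hom hDb hQ; have [hFl _ FM] := hF.
have [e <-] := cls_surj d; move: e => {d}.
have hU : subspace [set d | exists z, F z = cls Q d]%classic.
  split; first by exists 0; rewrite (lin0 hFl) (lin0 (cls_linear Q)).
  by move=> a u v [z zu] [w wv]; exists (a *: z + w); rewrite hFl zu wv -(cls_linear Q).
apply: (@subspace_total k D [set d | exists b a c g,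
  d = bmul (em b) (bmul (gm a) (bmul (ep c) (gp g)))]%classic _ _ hU).
  move=> W f h hf hh fh; apply: (eq_lin_bd hD hf hh) => b a c g.
  by apply: fh; exists b, a, c, g.
move=> _ [b [a [c [g ->]]]].
have [z1 e1] := cls_em b; have [z2 e2] := cls_gm a; have [z3 e3] := cls_ep c.
exists (bmul z1 (bmul z2 (bmul z3 (grp g)))).
by rewrite !FM !hM e1 e2 e3 /F Fg.
Qed.

Let F_coalg : coalg_hom F.
Proof.
have [hl h1 hM] := cls_alg_hom hDb hQ.
have [cD ce] := cls_coalg_hom hDb hQ Q_coideal Q_counit.
have hlQ : linear (tmap (cls Q) (cls Q)) := lin_tmap (cls_linear Q) (cls_linear Q).
have tT u v : tmap (cls Q) (cls Q) (u \ox v) = cls Q u \ox cls Q v.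
  exact: (tmap_tens _ _ (cls_linear Q) (cls_linear Q)).
(* In [D] the coproduct of x_j ⊗ 1 involves g_j', in [T] that of x_j involves g_j; the two agree
   only modulo Q. *)
have gmj j : cls Q (gm << j >>) = F (grp (gm_ j)).
  have -> : gm << j >> = bmul (ctr j) (gp (gm_ j)).
    by rewrite /ctr -mA -(bd_gpD hD) addNr (bd_gp0 hD) mr1.
  by rewrite hM ((ideal_cls_eq _ _ hQ).2 (ctrQ j)) -hM m1 /F Fg.
apply: (fb_coalg_hom hT hDQ hF) => [g|g|[i|j]|[i|j]].
- by rewrite /F Fg cD (bd_comul_gp hD) tT.
- by rewrite /F Fg ce (bd_eps_gp hD).
- by rewrite /F Fp Fg cD (bd_comul_ep hD) (linD _ _ hlQ) !tT.
- by rewrite -gmj /F Fm cD (bd_comul_em hD) (linD _ _ hlQ) !tT.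
- by rewrite /F Fp ce (bd_eps_ep hD).
- by rewrite /F Fm ce (bd_eps_em hD).
Qed.

(** J is the kernel of the surjective coalgebra map F. Hence it is a coideal by [ker_tmap], the
    counit vanishes on it, and it is stable under any antipode because F intertwines antipodes. *)
Lemma J_hopf_ideal : is_hopf_ideal J.
Proof.
have [FD Fe] := F_coalg; have [hFl _ _] := hF.
split; [exact: hJ| | |].
- move=> x hx; have h0 : tmap F F (bcomul x) = 0.
    rewrite -FD (F_ker hx); exact: (lin0 (coalg_comul (bialg_coalg hDQ))).
  have := @ker_tmap k T DQ F F_surj hFl _ h0.
  apply: span_min; first exact: span_subspace.
  move=> _ [a [b [hab ->]]]; apply: Defs.sub_span; exists a, b; split=> //.
  by case: hab => /ker_F; [left|right].
- move=> x hx; rewrite -[bcounit x]/(eps x) -Fe (F_ker hx).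
  exact: (lin0 (coalg_counit (bialg_coalg hDQ))).
- move=> S hS x hx; have [S' hS'] := DQ_antipode; apply: ker_F.
  rewrite (fb_antipode hT hDQ hF F_coalg hS hS') (F_ker hx).
  exact: (lin0 (lin_antipode hS')).
Qed.

Lemma quotient_iso : exists f : TJ -> DQ, is_hopf_iso f /\ forall z, f (cls J z) = F z.
Proof.
have [hFl F1 FM] := hF; have [FD Fe] := F_coalg.
pose f (x : TJ) : DQ := F (rep x).
have fE z : f (cls J z) = F z.
  apply/eqP; rewrite -subr_eq0 -(linB _ _ hFl); apply/eqP/F_ker.
  by apply/(ideal_cls_eq _ _ hJ); rewrite repK.
have hf : linear f.
  by move=> a x y; rewrite -[x]repK -[y]repK -(cls_linear J) !fE hFl.
have fM x y : f (bmul x y) = bmul (f x) (f y).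
  have [_ _ cM] := clsJ_hom.
  by rewrite -[x]repK -[y]repK -cM !fE FM.
have f1 : f (bone TJ) = bone DQ by rewrite fE F1.
have fD x : bcomul (f x) = tmap f f (bcomul x).
  have fc : (fun z : T => f (cls J z)) = F by apply/funext => z; exact: fE.
  have e := tmap_comp (bcomul (rep x)) (cls_linear J) hf.
  by rewrite fc -FD in e; exact: esym e.
have fe x : eps (f x) = eps x by rewrite /f Fe.
have inj : injective f.
  move=> x y; rewrite -[x]repK -[y]repK !fE => xy.
  apply/(ideal_cls_eq _ _ hJ); apply: ker_F.
  apply: etrans (linB _ _ hFl) _.
  exact: etrans (congr1 (fun u => u - F (rep y)) xy) (subrr _).
have surj d : exists x, f x = d.
  by have [z <-] := F_surj d; exists (cls J z); rewrite fE.
have [g gK] := choice surj.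
have fK : cancel f g by move=> x; apply: inj; rewrite gK.
have hg : linear g by move=> a x y; apply: inj; rewrite hf !gK.
have g_alg : @alg_hom k DQ TJ g.
  split; [exact: hg|by apply: inj; rewrite gK f1|].
  by move=> x y; apply: inj; rewrite fM !gK.
have g_coalg : @coalg_hom k DQ TJ g.
  split=> d; last by rewrite -fe gK.
  have [x <-] := surj d; rewrite fD fK.
  have e := tmap_comp (bcomul x) hf hg.
  have gf : (fun u : TJ => g (f u)) = id by apply/funext => u; exact: fK.
  by rewrite gf in e; apply: etrans (esym e); exact: esym (tlift_id _).
have g_surj x : exists d, g d = x by exists (f x).
(* The bialgebra axioms of T/J are those of D/Q carried over by the inverse bijection [g]; the
   antipode follows in the same way. *)
have hTJb : is_bialg TJ := @surj_bialg k DQ TJ g g_surj hg hDQ g_alg g_coalg.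
have [S hS] := DQ_antipode.
have gS a : g a = 0 -> g (S a) = 0.
  move=> ga; have -> : a = 0 by rewrite -(gK a) ga (lin0 hf).
  by rewrite (lin0 (lin_antipode hS)) (lin0 hg).
have [S' [hS' _]] := @surj_antipode k DQ TJ g g_surj hg S hDQ g_alg g_coalg hS gS.
exists f; split; last exact: fE.
split; split.
- by split; [exact: hTJb|exists S'].
- by split; [exact: hDQ|exists S].
- exact: hf.
- by exists g.
- exact: f1.
- exact: fM.
- exact: fD.
- exact: fe.
Qed.

End Comparison.

Theorem double_presentation : [/\ is_hopf_ideal J, is_hopf_ideal Q
  & exists f : TJ -> DQ, [/\ is_hopf_iso f,
      forall i, f (cls J (gen (inl i))) = cls Q (ep (ip << i >>)),
      forall j, f (cls J (gen (inr j))) = cls Q (em (im << j >>))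
    & forall g, f (cls J (grp g)) = cls Q (gp g)]].
Proof.
have [F0 [hF0 Fp Fm Fg]] := generator_hom.
split; [exact: J_hopf_ideal hF0 Fp Fm Fg|exact: Q_hopf_ideal|].
have [f [hf fE]] := quotient_iso hF0 Fp Fm Fg.
exists f; split=> [//|i|j|g]; rewrite fE.
- by rewrite Fp.
- by rewrite Fm.
- by rewrite Fg.
Qed.

End Isomorphism.

(** * The given data as an instance of the abstract setting *)

Section Presentation.
Context {k : fieldType} {G : zmodType} {X : choiceType}.
Variables (gr : X -> G) (chi : X -> G -> k).
Hypothesis hchi : forall x, is_char (chi x).
Local Notation TA := (tensor_alg gr chi).
Local Notation Y := (yd_tensor_alg gr chi).
Local Notation T := (bosonization (R := TA) Y).
Local Notation "f # g" := (smash (R := TA) Y f g) (at level 39).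
Local Notation TX := {malg k[{fmonom X}]}.

Lemma tbos_mul0 (a b : TX) : bmul (a # 0) (b # 0) = (a * b) # 0.
Proof.
apply: etrans (@tbos_mul k G X gr chi _ _ _ _) _.
apply: (congr2 (smash (R := TA) Y)); last exact: addr0.
by congr (a * _); exact: tact0.
Qed.

Lemma tbos_inj_hom : @alg_hom k TA T (fun f => f # 0).
Proof.
split=> [|//|a b]; last exact: esym (tbos_mul0 a b).
exact: @lin_smashc k G TA Y TX (fun a => a) 0 (@lin_id _ _).
Qed.

Lemma eval_smash (X' : choiceType) (y : X' -> X) (f : {malg k[{fmonom X'}]}) :
  tensor_eval (R := TA) (fun x => tgen k (y x)) f # 0
  = tensor_eval (R := T) (fun x => tgen k (y x) # 0) f.
Proof. exact: (eval_hom (R := TA) (fun x => tgen k (y x)) tbos_inj_hom f). Qed.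

End Presentation.

Lemma free_char_gen (k : fieldType) (X : choiceType) (a : X -> k) x :
  free_char a << x >> = a x.
Proof. by rewrite /free_char msuppU oner_eq0 big_seq_fset1 mcoeffUU expr1z. Qed.

(** The embedding f |-> f # 0 is an algebra map, so evaluating a relation in TV and then embedding
    it is the same as evaluating it in TV # kΓ. *)
Lemma Hlambda_idealE (k : fieldType) (G : zmodType) (Xp Xm : choiceType)
    (gr : Xp + Xm -> G) (chi : Xp + Xm -> G -> k) (hchi : forall x, is_char (chi x))
    (lam : Xp -> Xm -> k) (Rp Rm : bialg_sig k)
    (ip : {malg k[Xp]} -> Rp) (im : {malg k[Xm]} -> Rm) :
  Hlambda_ideal gr chi lam (defining_ideal ip) (defining_ideal im)
  = ideal_gen (A := TV_bosonization gr chi)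
    (J_gen (gr := gr) (chi := chi) (lam := lam) (ip := ip) (im := im)
      (T := TV_bosonization gr chi)
      (gen := fun x => TVsmash gr chi (tgen k x) 0) (grp := TVsmash gr chi 1)).
Proof.
have hl := @lin_smashc k G (tensor_alg gr chi) (yd_tensor_alg gr chi)
  {malg k[{fmonom (Xp + Xm)%type}]} (fun a => a) 0 (@lin_id _ _).
have E (i : Xp) (j : Xm) (q : k) :
    TVsmash gr chi (tgen k (inl i) * tgen k (inr j)
      - q *: (tgen k (inr j) * tgen k (inl i))) 0
    = bmul (TVsmash gr chi (tgen k (inl i)) 0) (TVsmash gr chi (tgen k (inr j)) 0)
      - q *: bmul (TVsmash gr chi (tgen k (inr j)) 0) (TVsmash gr chi (tgen k (inl i)) 0).
  apply: etrans (linB _ _ hl) _; congr (_ - _).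
    exact: esym (tbos_mul0 gr hchi _ _).
  by apply: etrans (linZ _ _ hl) _; congr (_ *: _); exact: esym (tbos_mul0 gr hchi _ _).
rewrite /Hlambda_ideal /J_gen; congr ideal_gen; congr setU; first congr setU.
- by congr image; apply/funext => f; exact: eval_smash.
- by congr image; apply/funext => f; exact: eval_smash.
- by apply/predeqP => z; split=> -[i [j ->]]; exists i, j;
    [apply: (congr1 (fun u => u - _))|apply: (congr1 (fun u => u - _))]; rewrite E.
Qed.

Unset Implicit Arguments.
Set Strict Implicit.

Theorem theorem5p3 (k : fieldType) (G : zmodType) (Xp Xm : choiceType)
  (Xp_nonempty : inhabited Xp) (Xm_nonempty : inhabited Xm)
  (gr : Xp + Xm -> G) (chi : Xp + Xm -> G -> k)
  (chi_char : forall i, is_char (chi i))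
  (q_inv : forall (i : Xp) (j : Xm),
    qq gr chi (inl i) (inr j) * qq gr chi (inr j) (inl i) = 1)
  (lam : Xp -> Xm -> k)
  (lam0 : forall (i : Xp) (j : Xm),
    ~ (forall h : G, chi (inl i) h * chi (inr j) h = 1) -> lam i j = 0)
  (Rp : bialg_sig k) (Yp : yd_sig G Rp) (nup : nat -> Rp -> Rp)
  (iotap : {malg k[Xp]} -> Rp)
  (Rp_pre_nichols : is_pre_nichols (ydVp gr chi) Yp nup iotap)
  (Rm : bialg_sig k) (Ym : yd_sig G Rm) (num : nat -> Rm -> Rm)
  (iotam : {malg k[Xm]} -> Rm)
  (Rm_pre_nichols : is_pre_nichols (ydVm gr chi) Ym num iotam)
  (Ym' : yd_sig {malg int[Xm]} Rm)
  (Rm_pre_nichols' : is_pre_nichols (ydVm' gr chi) Ym' num iotam)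
  (tau : tensor (Hminus Ym') (Hplus Yp) -> k^o)
  (tau_skew : is_skew_pairing tau)
  (tau_gg : forall (j : Xm) (g : G),
    tau (smash Ym' (bone Rm) << j >> \ox smash Yp (bone Rp) g)
    = chi (inr j) g)
  (tau_gx : forall (j : Xm) (i : Xp),
    tau (smash Ym' (bone Rm) << j >> \ox smash Yp (iotap << i >>) 0) = 0)
  (tau_xg : forall (j : Xm) (g : G),
    tau (smash Ym' (iotam << j >>) 0 \ox smash Yp (bone Rp) g) = 0)
  (tau_xx : forall (j : Xm) (i : Xp),
    tau (smash Ym' (iotam << j >>) 0 \ox smash Yp (iotap << i >>) 0)
    = - lam i j) :
  let Ip := defining_ideal iotap in
  let Im := defining_ideal iotam in
  let J := Hlambda_ideal gr chi lam Ip Im in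
  let Q := Q_ideal gr tau in
  [/\ is_hopf_ideal J, is_hopf_ideal Q
    & exists f : Hlambda gr chi lam Ip Im -> quot_bialg Q,
      [/\ is_hopf_iso f,
          forall i : Xp,
            f (cls J (TVsmash gr chi (tgen k (inl i)) 0))
            = cls Q (bone (Hminus Ym') \ox smash Yp (iotap << i >>) 0),
          forall j : Xm,
            f (cls J (TVsmash gr chi (tgen k (inr j)) 0))
            = cls Q (smash Ym' (iotam << j >>) 0 \ox bone (Hplus Yp))
        & forall g : G,
            f (cls J (TVsmash gr chi 1 g))
            = cls Q (bone (Hminus Ym') \ox smash Yp (bone Rp) g)]].
Proof.
move=> Ip Im J Q.
have hm := pn_bb Rm_pre_nichols'; have hp := pn_bb Rp_pre_nichols.
have hA := smash_bialg hm; have hB := smash_bialg hp.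
have [SA hSA] := smash_antipode hm (pn_graded Rm_pre_nichols') (pn_conn Rm_pre_nichols').
have [SB hSB] := smash_antipode hp (pn_graded Rp_pre_nichols) (pn_conn Rp_pre_nichols).
have hd := deformation_is_double hA hB tau_skew hSA.
pose ta (a : Hminus Ym') (x : Hplus Yp) : k := tau (a \ox x).
(* The vanishing of τ(g', x_i) is given for the free generators of Γ' only. By the twisted
   derivation rule it extends to sums, and to inverses because the twisting factor
   [grp_pair a (gr (inl i))] is invertible. *)
have pair_gy (i : Xp) (a : {malg int[Xm]}) :
    ta (smash Ym' (bone Rm) a) (smash Yp (iotap << i >>) 0) = 0.
  have e0 : ta (smash Ym' (bone Rm) 0) (smash Yp (iotap << i >>) 0) = 0.
    exact: (pair_grp_gen0 Rp_pre_nichols tau_skew).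
  have eD a1 a2 := pair_grp_genD Rm_pre_nichols' Rp_pre_nichols tau_skew i a1 a2.
  apply: (malg_int_ind (U := fun a =>
    ta (smash Ym' (bone Rm) a) (smash Yp (iotap << i >>) 0) = 0)) => {a}.
  - exact: e0.
  - move=> a b ha hb; apply: etrans (eD a b) _.
    apply: etrans (congr2 (fun u v => u + _ * v) ha hb) _.
    by rewrite mulr0 addr0.
  - move=> a ha.
    have eb := grp_pairDr Rm_pre_nichols' Rp_pre_nichols tau_skew a
      (- gr (inl i)) (gr (inl i)).
    have e1 := grp_pair0r Rm_pre_nichols' tau_skew a.
    have e : ta (smash Ym' (bone Rm) a) (smash Yp (iotap << i >>) 0)
        + grp_pair (tau := tau) a (gr (inl i))
          * ta (smash Ym' (bone Rm) (- a)) (smash Yp (iotap << i >>) 0) = 0.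
      apply: etrans (esym (eD a (- a))) _.
      have e0' b : b = 0 -> ta (smash Ym' (bone Rm) b) (smash Yp (iotap << i >>) 0) = 0.
        by move=> ->; exact: e0.
      exact: e0' (subrr a).
    have eb' := etrans (esym e1) (etrans
      (congr1 (grp_pair (tau := tau) a) (esym (addNr (gr (inl i))))) eb).
    have unit_cancel (b b' t s : k) : 1 = b' * b -> s = 0 -> s + b * t = 0 -> t = 0.
      by move=> e2 ->; rewrite add0r => e3; rewrite -[LHS]mul1r e2 -mulrA e3 mulr0.
    exact: unit_cancel eb' ha e.
  - by move=> j; exact: tau_gx.
have hD := bos_double Rm_pre_nichols' Rp_pre_nichols tau_skew hSA hSB hd tau_xg pair_gy.
have muE : (fun (j : Xm) (i : Xp) => spair (tau := tau) (smash Ym' (iotam << j >>) 0)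
    (smash Yp (iotap << i >>) 0)) = (fun j i => - lam i j).
  by apply/funext => j; apply/funext => i; exact: tau_xx.
rewrite muE in hD.
have chiaE (j l : Xm) : free_char (fun l' => qq gr chi (inr l') (inr l)) << j >>
    = chi (inr l) (gr (inr j)) by exact: free_char_gen.
have main := double_presentation Rp_pre_nichols Rm_pre_nichols' chiaE q_inv
  (grp_pairDl Rm_pre_nichols' Rp_pre_nichols tau_skew)
  (grp_pairDr Rm_pre_nichols' Rp_pre_nichols tau_skew)
  (grp_pair0l Rp_pre_nichols tau_skew)
  (grp_pair0r Rm_pre_nichols' tau_skew) tau_gg (tbos_free gr chi_char) hD.
(* The element g_j' ⊗ g_j^{-1} is the product of g_j' ⊗ 1 and 1 ⊗ g_j^{-1} for the deformed
   multiplication too, by [dt_mull]. *)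
have EQ : Q = ideal_gen (A := Hdouble tau) (Q_gen (gr := gr) (D := Hdouble tau)
    (gm := fun a => smash Ym' (bone Rm) a \ox bone (Hplus Yp))
    (gp := fun g => bone (Hminus Ym') \ox smash Yp (bone Rp) g)).
  have ctrE (j : Xm) : smash Ym' (bone Rm) << j >> \ox smash Yp (bone Rp) (- gr (inr j))
      = @bmul k (Hdouble tau) (smash Ym' (bone Rm) << j >> \ox bone (Hplus Yp))
          (bone (Hminus Ym') \ox smash Yp (bone Rp) (- gr (inr j))).
    apply: esym; apply: etrans (dt_mull hA hB tau_skew hSA hd _ _ _) _.
    exact: (congr1 (fun a => a \ox _) (bmul1r hA _)).
  rewrite /Q /Q_ideal /Q_gen; congr ideal_gen.
  apply/predeqP => z; split=> -[j ->]; exists j.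
    exact: (congr1 (fun a => a - bone (Hdouble tau)) (ctrE j)).
  exact: (congr1 (fun a => a - bone (Hdouble tau)) (esym (ctrE j))).
have EJ : J = _ := Hlambda_idealE gr chi_char lam iotap iotam.
rewrite -EJ -EQ in main.
exact: main.
Qed.
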